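(* Let $X$ be a complex Banach space, let $A:D\subseteq X\to X$ be a sectorial operator of type $(M,\theta,\alpha,\mu)$ with associated $\alpha$-resolvent family $\{S_\alpha(t)\}_{t\ge0}$, let $t_i\ge 0$ and $y_i\in X$. If $0<\alpha<1$ and $t>t_i$, then $${}_{t_i}D_t^\alpha\, S_\alpha(t-t_i)y_i=A\,S_\alpha(t-t_i)y_i.$$
   Context: Sectorial operator: a closed linear operator $A:D\subseteq X\to X$ is sectorial of type $(M,\theta,\alpha,\mu)$ if there exist $0<\theta<\pi/2$, $M>0$ and $\mu\in\mathbb{R}$ such that the $\alpha$-resolvent $R(\lambda^\alpha,A)=(\lambda^\alpha I-A)^{-1}$ exists outside the sector $\mu+S_\theta=\{\mu+\lambda^\alpha:\lambda\in\mathbb{C},\ |\arg(-\lambda^\alpha)|<\theta\}$ and $\|(\lambda^\alpha I-A)^{-1}\|\le \frac{M}{|\lambda^\alpha-\mu|}$ for $\lambda^\alpha\notin\mu+S_\theta$. The $\alpha$-resolvent family generated by $A$ is $$S_\alpha(t)=\frac{1}{2\pi i}\int_c e^{\lambda t}\lambda^{\alpha-1}R(\lambda^\alpha,A)\,d\lambda=E_{\alpha,1}(At^\alpha),$$ where $c$ is a suitable path (inverse Laplace transform contour) and $E_{\alpha,\beta}(z)=\sum_{j\ge0}\frac{z^j}{\Gamma(\alpha j+\beta)}$ is the Mittag-Leffler function. The Caputo derivative of order $\alpha\in(0,1)$ with base point $a$ of a function $g:[a,\infty)\to X$ is ${}_aD_t^\alpha g(t)=\frac{1}{\Gamma(1-\alpha)}\int_a^t(t-\tau)^{-\alpha}g'(\tau)\,d\tau$.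 In the claim it is applied, with base point $a=t_i$, to the function $t\mapsto S_\alpha(t-t_i)y_i$ on $[t_i,\infty)$.
   Formalization: Existence of the Caputo derivative (improper integral) is claimed only for y_i in the closure of D; otherwise it fails, e.g. Dirichlet d²/dx² on C[0,1] with y_i=1. For every y_i, S_α(t-t_i)y_i is in D, and if the derivative exists it equals A S_α(t-t_i)y_i. *)

(* Defs.v *)
From Stdlib Require Import Reals Lra.
From Coquelicot Require Import Coquelicot.

Open Scope R_scope.

(* A complex Banach space [X] seen as a real one (same points, same norm, same
   uniform structure), so that Coquelicot's derivative and Riemann integral of
   functions [R -> X] apply. *)
Section RestrictScalars.

Variable X : CompleteNormedModule C_AbsRing.

Definition Rscal (a : R) (x : X) : X := scal (RtoC a : C_AbsRing) x.

Lemma Rscal_assoc (a b : R) (x : X) : Rscal a (Rscal b x) = Rscal (a * b) x.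
Proof. unfold Rscal; rewrite scal_assoc, RtoC_mult; reflexivity. Qed.

Lemma Rscal_one (x : X) : Rscal 1 x = x.
Proof. exact (scal_one x). Qed.

Lemma Rscal_distr_l (a : R) (x y : X) :
  Rscal a (plus x y) = plus (Rscal a x) (Rscal a y).
Proof. exact (scal_distr_l _ x y). Qed.

Lemma Rscal_distr_r (a b : R) (x : X) :
  Rscal (a + b) x = plus (Rscal a x) (Rscal b x).
Proof.
unfold Rscal; rewrite RtoC_plus.
exact (scal_distr_r (RtoC a : C_AbsRing) (RtoC b : C_AbsRing) x).
Qed.

Definition Real_ModuleSpace_mixin :=
  ModuleSpace.Mixin R_Ring X Rscal
    Rscal_assoc Rscal_one Rscal_distr_l Rscal_distr_r.

Definition Real_ModuleSpace : ModuleSpace R_Ring :=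
  ModuleSpace.Pack R_Ring X
    (ModuleSpace.Class R_Ring X (AbelianGroup.class X) Real_ModuleSpace_mixin) X.

Definition Real_NormedModuleAux : NormedModuleAux R_AbsRing :=
  NormedModuleAux.Pack R_AbsRing X
    (NormedModuleAux.Class R_AbsRing X
       (ModuleSpace.class R_Ring Real_ModuleSpace) (UniformSpace.class X)) X.

Lemma Rscal_norm (a : R) (x : X) : norm (Rscal a x) <= Rabs a * norm x.
Proof.
unfold Rscal; rewrite <- Cmod_R.
exact (norm_scal (RtoC a : C_AbsRing) x).
Qed.

Definition Real_NormedModule_mixin :=
  NormedModule.Mixin R_AbsRing Real_NormedModuleAux (@norm C_AbsRing X)
    (@norm_factor C_AbsRing X) (@norm_triangle C_AbsRing X) Rscal_norm
    (@norm_compat1 C_AbsRing X) (@norm_compat2 C_AbsRing X)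
    (@norm_eq_zero C_AbsRing X).

Definition Real_NormedModule : NormedModule R_AbsRing :=
  NormedModule.Pack R_AbsRing X
    (NormedModule.Class R_AbsRing X
       (NormedModuleAux.class R_AbsRing Real_NormedModuleAux)
       Real_NormedModule_mixin) X.

Definition realify : CompleteNormedModule R_AbsRing :=
  CompleteNormedModule.Pack R_AbsRing X
    (CompleteNormedModule.Class R_AbsRing X
       (NormedModule.class R_AbsRing Real_NormedModule)
       (CompleteNormedModule.mixin C_AbsRing X
          (CompleteNormedModule.class C_AbsRing X))) X.

End RestrictScalars.

Definition polar (s psi : R) : C := (s * cos psi, s * sin psi).

Definition Cexp (z : C) : C := polar (exp (Re z)) (Im z).

(* Principal argument, in (-PI, PI], with the convention Carg 0 = 0. *)
Definition Carg (z : C) : R :=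
  if Ceq_dec z 0 then 0
  else if Rle_dec 0 (Im z) then acos (Re z / Cmod z)
  else - acos (Re z / Cmod z).

(* Principal power; [Rpower 0 a] is 1, so 0 has to be treated apart (the value
   at 0 matters only for exponents in (0, 1), where it is 0). *)
Definition Cpow (z : C) (a : R) : C :=
  if Ceq_dec z 0 then 0%C else polar (Rpower (Cmod z) a) (a * Carg z).

Definition Gamma (x : R) : R :=
  RInt_gen (V := R_CompleteNormedModule)
    (fun s => Rpower s (x - 1) * exp (- s)) (at_right 0) (Rbar_locally p_infty).

Definition closure {T : UniformSpace} (P : T -> Prop) (x : T) : Prop :=
  forall eps : posreal, exists z : T, ball x eps z /\ P z.

(* A linear operator A : D -> X defined on a subspace D = [dom A]; the values of
   [app A] outside D are irrelevant. *)
Record operator (X : NormedModule C_AbsRing) := Operator {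
  dom : X -> Prop;
  app :> X -> X;
  dom_zero : dom zero;
  dom_plus : forall x y : X, dom x -> dom y -> dom (plus x y);
  dom_scal : forall (k : C) (x : X), dom x -> dom (scal (k : C_AbsRing) x);
  app_plus : forall x y : X, dom x -> dom y -> app (plus x y) = plus (app x) (app y);
  app_scal : forall (k : C) (x : X), dom x ->
    app (scal (k : C_AbsRing) x) = scal (k : C_AbsRing) (app x)
}.

Arguments dom {X} A x : rename.
Arguments app {X} A x : rename.

Definition closed_operator {X : NormedModule C_AbsRing} (A : operator X) : Prop :=
  closed (T := prod_UniformSpace X X)
    (fun p : X * X => dom A (fst p) /\ A (fst p) = snd p).

Section Operators.

Context {X : CompleteNormedModule C_AbsRing}.

Definition solves (A : operator X) (w : C) (y x : X) : Prop :=
  dom A x /\ minus (scal (w : C_AbsRing) x) (A x) = y.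

(* (w I - A)^-1 y, meaningful when w is in the resolvent set of A. *)
Definition resolvent (A : operator X) (w : C) (y : X) : X := iota (solves A w y).

Definition in_resolvent_set (A : operator X) (w : C) : Prop :=
  (forall y : X, exists! x : X, solves A w y x) /\
  (exists K : R, forall y : X, norm (resolvent A w y) <= K * norm y).

(* mu + S_theta, where S_theta is the whole sector of half-angle theta around the
   negative real axis: in its definition lambda^alpha ranges over all branches,
   hence over all of C.  The vertex mu belongs to it because Carg 0 = 0, so that
   M / |lambda^alpha - mu| below is never a division by 0. *)
Definition in_sector (mu theta : R) (w : C) : Prop :=
  Rabs (Carg (- (w - mu))%C) < theta.

(* Only principal values of lambda^alpha are constrained, which is all that the
   contour integral defining the resolvent family uses. *)
Definition sectorial (A : operator X) (M theta alpha mu : R) : Prop :=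
  closed_operator A /\ 0 < theta < PI / 2 /\ 0 < M /\
  forall lambda : C, ~ in_sector mu theta (Cpow lambda alpha) ->
    in_resolvent_set A (Cpow lambda alpha) /\
    forall y : X, norm (resolvent A (Cpow lambda alpha) y) <=
                  M / Cmod (Cpow lambda alpha - mu)%C * norm y.

(* The Hankel path with parameters r and phi: it comes from infinity along the
   ray arg = -phi, follows counterclockwise the arc |lambda| = r, and goes back to
   infinity along the ray arg = phi. *)
Definition on_hankel (r phi : R) (lambda : C) : Prop :=
  exists s psi : R, lambda = polar s psi /\
    ((r <= s /\ (psi = phi \/ psi = - phi)) \/ (s = r /\ - phi <= psi <= phi)).

Definition hankel_integral (r phi : R) (F : C -> X) : X :=
  plus
    (minus
       (RInt_gen (V := realify X)
          (fun s => scal (polar 1 phi : C_AbsRing) (F (polar s phi)))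
          (at_point r) (Rbar_locally p_infty))
       (RInt_gen (V := realify X)
          (fun s => scal (polar 1 (- phi) : C_AbsRing) (F (polar s (- phi))))
          (at_point r) (Rbar_locally p_infty)))
    (RInt (V := realify X)
       (fun psi => scal (Ci * polar r psi : C_AbsRing)%C (F (polar r psi)))
       (- phi) phi).

Definition suitable_path (theta alpha mu r phi : R) : Prop :=
  0 < r /\ PI / 2 < phi < PI /\
  forall lambda : C, on_hankel r phi lambda ->
    ~ in_sector mu theta (Cpow lambda alpha).

(* S_alpha(t) y; the integral diverges at t = 0, where S_alpha(0) = I. *)
Definition resolvent_family (A : operator X) (alpha r phi t : R) (y : X) : X :=
  if Req_EM_T t 0 then y
  else scal (/ (2 * PI * Ci) : C_AbsRing)%C
         (hankel_integral r phi (fun lambda =>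
            scal (Cexp (lambda * t) * Cpow lambda (alpha - 1) : C_AbsRing)%C
              (resolvent A (Cpow lambda alpha) y))).

(* v is the Caputo derivative of order alpha of g, with base point a, at t.  The
   integral is improper at both ends: the kernel is singular at t, and g' may be
   singular at a, possibly not absolutely integrable. *)
Definition is_caputo (alpha a : R) (g : R -> X) (t : R) (v : X) : Prop :=
  exists (g' : R -> X) (I : X),
    (forall tau : R, a < tau < t ->
       is_derive (V := realify X) g tau (g' tau)) /\
    is_RInt_gen (V := realify X)
      (fun tau => scal (RtoC (Rpower (t - tau) (- alpha)) : C_AbsRing) (g' tau))
      (at_right a) (at_left t) I /\
    v = scal (RtoC (/ Gamma (1 - alpha)) : C_AbsRing) I.

End Operators.

(* Main.v *)
Require Import Defs.
From Stdlib Require Import Reals Lra Lia ssreflect.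
From Stdlib Require List.
From Coquelicot Require Import Coquelicot.

(** On the Hankel path, [S_alpha(t) y] is the integral of
    [e^(lambda t) lambda^(alpha - 1) R(lambda^alpha) y], and its derivative, taken under
    the integral, has the kernel [e^(lambda t) lambda^alpha].  The Caputo integral of this
    derivative is computed from an explicit primitive, without interchanging integrals.
    Let [b(z)] be the integral of [(z + x)^(-alpha) e^(-x)] over [x > 0], that is
    [e^z Gamma(1 - alpha, z)] ([inc_gamma]).  Then [b' = b - z^(-alpha)], so that
    [e^(lambda u) lambda^(alpha - 1) b(lambda (T - u))] is a primitive in [u] of
    [(T - u)^(-alpha) e^(lambda u)].  Integrating it along the path against
    [lambda^delta R(lambda^alpha) y] gives [caputo_primitive], and the Caputo integral over
    [[s, u]] is the difference of its values at [u] and at [s].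

    Two properties of [b] in a sector [|arg z| <= phi < PI] give the limits.  As
    [b(z)] tends to [Gamma(1 - alpha)] at [0], the value at [u] tends to [Gamma(1 - alpha)]
    times the integral of [e^(lambda T) lambda^(delta + alpha - 1) R(lambda^alpha) y]
    ([caputo_primitive_lim]).  As [b(z)] is [O(|z|^(-alpha))], and the path may be moved to
    the radius [1 / s], the value at [s] is [O(s^(alpha - delta))]
    ([caputo_primitive_small]).

    If [x] is in the domain of [A], then [lambda^alpha R(lambda^alpha) x] is
    [x + R(lambda^alpha) A x], and [e^(lambda t)] integrates to [0] along the path.  So the
    Caputo integrand of [x] is also the one with [delta = 0] and [A x] in place of [x]: the
    value at [s] tends to [0], and the limit is [Gamma(1 - alpha) S_alpha(T) A x], where
    [S_alpha(T) A x = A S_alpha(T) x].  For [y] in the closure of the domain, [delta = alpha]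
    gives a bound of the truncated Caputo integrals by a multiple of the norm of [y],
    uniform in the truncation, and the limit passes from [x] to [y] ([caputo_exists]).
    For an arbitrary [y], a Caputo derivative [v] is identified after applying the
    resolvent [R_0] of [A] at one point of the path: it is injective, commutes with the
    integrals, and maps [y] into the domain, where the limit is known ([caputo_unique]).
    Finally, [R(lambda^alpha) y = R_0 (y + (w_0 - lambda^alpha) R(lambda^alpha) y)], where
    [R_0 = R(w_0)], puts [S_alpha(t) y] in the range of [R_0], which is the domain of [A]
    ([sigma_spec]).

    Two facts about the path are needed.  Every [lambda^alpha] with [lambda] to the right of
    the path is outside the sector, with [|lambda^alpha - mu| >= c |lambda^alpha|]
    ([region_resolvent]): moving left horizontally one meets the image of the path, whose
    points are outside the sector, and the complement of the sector is stable under moves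
    to the right.  And the integral does not depend on the radius of the path
    ([hankel_shift]); this form of Cauchy's theorem is proved by showing that the integrals
    at the radii [e^xi] and [e^xi'] differ by [O((xi' - xi)^2)]. *)

Open Scope R_scope.

(** * Identities between linear combinations of vectors *)
Section LinearCombinations.

Context {K : Ring} {V : ModuleSpace K}.

(** A reified linear combination; the number in [LVar] is a position in a list of vectors. *)
Inductive lincomb : Type :=
  | LVar (n : nat) | LZero | LPlus (e1 e2 : lincomb) | LOpp (e : lincomb)
  | LScal (k : K) (e : lincomb).

Fixpoint leval (vs : list V) (e : lincomb) : V :=
  match e with
  | LVar n => List.nth n vs zero
  | LZero => zero
  | LPlus e1 e2 => plus (leval vs e1) (leval vs e2)
  | LOpp e => opp (leval vs e)
  | LScal k e => scal k (leval vs e)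
  end.

Fixpoint lcoef (e : lincomb) (n : nat) : K :=
  match e with
  | LVar m => if Nat.eqb m n then one else zero
  | LZero => zero
  | LPlus e1 e2 => plus (lcoef e1 n) (lcoef e2 n)
  | LOpp e => opp (lcoef e n)
  | LScal k e => mult k (lcoef e n)
  end.

Fixpoint lsum (vs : list V) (c : nat -> K) : V :=
  match vs with
  | nil => zero
  | cons v vs => plus (scal (c O) v) (lsum vs (fun n => c (S n)))
  end.

Lemma lsum_zero vs : lsum vs (fun _ => zero) = zero.
Proof. elim: vs => [|v vs IH] //=; rewrite IH scal_zero_l plus_zero_l //. Qed.

Lemma lsum_plus vs c1 c2 :
  lsum vs (fun n => plus (c1 n) (c2 n)) = plus (lsum vs c1) (lsum vs c2).
Proof.
elim: vs c1 c2 => [|v vs IH] c1 c2 /=; first by rewrite plus_zero_l.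
rewrite (IH (fun n => c1 (S n)) (fun n => c2 (S n))) scal_distr_r -!plus_assoc.
congr plus; rewrite !plus_assoc; congr plus; exact: plus_comm.
Qed.

Lemma lsum_scal vs k c : lsum vs (fun n => mult k (c n)) = scal k (lsum vs c).
Proof.
elim: vs c => [|v vs IH] c /=; first by rewrite scal_zero_r.
by rewrite (IH (fun n => c (S n))) scal_distr_l scal_assoc.
Qed.

Lemma lsum_opp vs c : lsum vs (fun n => opp (c n)) = opp (lsum vs c).
Proof.
elim: vs c => [|v vs IH] c /=; first by rewrite opp_zero.
by rewrite (IH (fun n => c (S n))) opp_plus scal_opp_l.
Qed.

Lemma lsum_var vs n :
  lsum vs (fun m => if Nat.eqb n m then one else zero) = List.nth n vs zero.
Proof.
elim: vs n => [|v vs IH] [|n] //=.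
  by rewrite lsum_zero scal_one plus_zero_r.
by rewrite IH scal_zero_l plus_zero_l.
Qed.

Lemma leval_lsum vs e : leval vs e = lsum vs (lcoef e).
Proof.
elim: e => [n||e1 IH1 e2 IH2|e IH|k e IH] /=.
- by rewrite lsum_var.
- by rewrite lsum_zero.
- by rewrite lsum_plus IH1 IH2.
- by rewrite lsum_opp IH.
- by rewrite lsum_scal IH.
Qed.

Fixpoint same_coefs (vs : list V) (n : nat) (e1 e2 : lincomb) : Prop :=
  match vs with
  | nil => True
  | cons _ vs => lcoef e1 n = lcoef e2 n /\ same_coefs vs (S n) e1 e2
  end.

(** The reduction behind the tactic [vlin]: an equation between linear combinations of
    vectors follows from the equations between the coefficients of each vector. *)
Lemma leval_eq vs e1 e2 : same_coefs vs 0 e1 e2 -> leval vs e1 = leval vs e2.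
Proof.
rewrite !leval_lsum.
suff H : forall vs n, same_coefs vs n e1 e2 ->
    lsum vs (fun m => lcoef e1 (n + m)) = lsum vs (fun m => lcoef e2 (n + m)).
  exact: (H vs 0%nat).
clear; elim=> [|v vs IH] n //= [H1 H2].
rewrite Nat.add_0_r H1; congr plus.
have := IH (S n) H2.
have E c : lsum vs (fun m => c (n + S m)%nat) = lsum vs (fun m => c (S n + m)%nat).
  clear; move: vs; suff H : forall c1 c2 : nat -> K, (forall m, c1 m = c2 m) ->
     forall vs, lsum vs c1 = lsum vs c2.
    by apply: H => m; congr c; lia.
  move=> c1 c2 E vs; elim: vs c1 c2 E => [|v vs IH] c1 c2 E //=.
  by rewrite E (IH _ (fun n => c2 (S n))).
by rewrite !E.
Qed.

End LinearCombinations.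

Ltac vindex x vs :=
  match vs with
  | cons x _ => constr:(O)
  | cons _ ?tl => let n := vindex x tl in constr:(S n)
  end.

Ltac vmem x vs :=
  match vs with
  | nil => constr:(false)
  | cons x _ => constr:(true)
  | cons _ ?tl => vmem x tl
  end.

Ltac vcollect vs e :=
  match e with
  | plus ?a ?b => let vs := vcollect vs a in vcollect vs b
  | minus ?a ?b => let vs := vcollect vs a in vcollect vs b
  | opp ?a => vcollect vs a
  | zero => vs
  | scal _ ?a => vcollect vs a
  | ?x => match vmem x vs with true => vs | false => constr:(cons x vs) end
  end.

Ltac vreify K vs e :=
  match e with
  | plus ?a ?b => let x := vreify K vs a in let y := vreify K vs b in
                  constr:(@LPlus K x y)
  | minus ?a ?b => let x := vreify K vs a in let y := vreify K vs b in
                  constr:(@LPlus K x (@LOpp K y))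
  | opp ?a => let x := vreify K vs a in constr:(@LOpp K x)
  | zero => constr:(@LZero K)
  | scal ?k ?a => let x := vreify K vs a in constr:(@LScal K k x)
  | ?x => let n := vindex x vs in constr:(@LVar K n)
  end.

Ltac vlin_in K V :=
  match goal with
  | |- @eq _ ?a ?b =>
    let vs := vcollect (@nil V) a in
    let vs := vcollect vs b in
    let x := vreify K vs a in
    let y := vreify K vs b in
    change (@leval K V vs x = @leval K V vs y);
    apply leval_eq; cbv [same_coefs lcoef Nat.eqb]; repeat split
  end.

Ltac vlin V := vlin_in R_Ring (NormedModule.ModuleSpace R_AbsRing V);
   rewrite /plus /opp /mult /one /zero /=; try ring.

Ltac vlinC X := vlin_in C_Ring (NormedModule.ModuleSpace C_AbsRing X);
   rewrite /plus /opp /mult /one /zero /=; try ring.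

(** * Calculus in real Banach spaces *)
Section BanachCalculus.

Context {V : CompleteNormedModule R_AbsRing}.
Implicit Types (f : R -> V) (a b p q : R).

Lemma norm_minus_triangle (u v w : V) :
  norm (minus u w) <= norm (minus u v) + norm (minus v w).
Proof.
have -> : minus u w = plus (minus u v) (minus v w).
  by rewrite (minus_trans v).
exact: norm_triangle.
Qed.

Lemma norm_minus_sym (u v : V) : norm (minus u v) = norm (minus v u).
Proof. by rewrite -opp_minus norm_opp. Qed.

Lemma norm_scal_R (k : R) (u : V) : norm (scal k u) = Rabs k * norm u.
Proof.
case: (Req_dec k 0) => [->|Hk].
  have -> : scal 0 u = zero by apply: scal_zero_l.
  by rewrite norm_zero Rabs_R0 Rmult_0_l.
apply: Rle_antisym; first exact: norm_scal.
have Hp : 0 < Rabs k by apply: Rabs_pos_lt.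
apply: (Rmult_le_reg_l (/ Rabs k)); first exact: Rinv_0_lt_compat.
rewrite -Rmult_assoc Rinv_l ?Rmult_1_l; last lra.
have {1}-> : u = scal (/ k) (scal k u).
  rewrite scal_assoc /mult /= Rinv_l //; symmetry; exact: (scal_one u).
rewrite -Rabs_inv; exact: norm_scal.
Qed.

Lemma norm_le_eps_eq (u v : V) (K : R) :
  (forall eps, 0 < eps -> norm (minus u v) <= K * eps) -> u = v.
Proof.
move=> H.
have H0 : norm (minus u v) = 0.
  have Hn := norm_ge_0 (minus u v).
  apply: Rle_antisym => //.
  apply: Rnot_lt_le => Hp.
  have Hd : 0 < norm (minus u v) / (2 * (Rabs K + 1)).
    apply: Rdiv_lt_0_compat => //; have := Rabs_pos K; lra.
  have := H _ Hd.
  have HK : K * (norm (minus u v) / (2 * (Rabs K + 1))) <= norm (minus u v) / 2.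
    have -> : K * (norm (minus u v) / (2 * (Rabs K + 1)))
      = norm (minus u v) / 2 * (K / (Rabs K + 1)).
      field; have := Rabs_pos K; lra.
    rewrite -{2}(Rmult_1_r (norm _ / 2)).
    apply: Rmult_le_compat_l; first lra.
    have Hp1 : 0 < Rabs K + 1 by have := Rabs_pos K; lra.
    apply/(Rdiv_le_1 _ _ Hp1); have := Rle_abs K; lra.
  lra.
apply: (plus_reg_r (opp v)); rewrite plus_opp_r.
exact: norm_eq_zero.
Qed.

(** Halving [[a, b]] halves the constant [K], hence the increment is at most
    [K (b - a)^2 / 2^n] for every [n]. *)
Lemma const_of_quad f a b (K : R) : a <= b ->
  (forall p q, a <= p <= q -> q <= b ->
     norm (minus (f q) (f p)) <= K * (q - p) ^ 2) ->
  f a = f b.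
Proof.
move=> Hab H.
have Hn : forall n : nat, forall p q, a <= p <= q -> q <= b ->
     norm (minus (f q) (f p)) <= K * (/ 2) ^ n * (q - p) ^ 2.
  elim=> [|n IH] p q Hp Hq /=.
    by rewrite Rmult_1_r; apply: H.
  apply: Rle_trans (norm_minus_triangle _ (f ((p + q) / 2)) _) _.
  have H1 := IH ((p + q) / 2) q ltac:(lra) Hq.
  have H2 := IH p ((p + q) / 2) ltac:(lra) ltac:(lra).
  have -> : K * (/ 2 * (/ 2) ^ n) * ((q - p) * ((q - p) * 1)) =
    K * (/ 2) ^ n * (q - (p + q) / 2) ^ 2 +
    K * (/ 2) ^ n * ((p + q) / 2 - p) ^ 2 by simpl; field.
  lra.
symmetry; apply: (norm_le_eps_eq _ _ (Rabs K * (b - a) ^ 2)) => eps Heps.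
have [N HN] := pow_lt_1_zero (/ 2) ltac:(rewrite Rabs_pos_eq; lra) eps Heps.
have := Hn N a b ltac:(lra) ltac:(lra).
have := HN N (Nat.le_refl _).
rewrite Rabs_pos_eq; last by apply: pow_le; lra.
move=> Hlt Hle; apply: Rle_trans Hle _.
have -> : K * (/ 2) ^ N * (b - a) ^ 2 = (/ 2) ^ N * (b - a) ^ 2 * K by ring.
have -> : Rabs K * (b - a) ^ 2 * eps = eps * (b - a) ^ 2 * Rabs K by ring.
have H0 : 0 <= (/ 2) ^ N by apply: pow_le; lra.
apply: Rle_trans (Rmult_le_compat_l _ _ _ _ (Rle_abs K)) _.
  by apply: Rmult_le_pos => //; apply: pow2_ge_0.
apply: Rmult_le_compat_r; first exact: Rabs_pos.
apply: Rmult_le_compat_r; first exact: pow2_ge_0.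
lra.
Qed.

(** Precomposing with [clamp a b] extends a function on [[a, b]] to the whole line, for
    theorems that ask for two-sided continuity at the end points. *)
Definition clamp a b x := Rmax a (Rmin b x).

Lemma clamp_in a b x : a <= b -> a <= clamp a b x <= b.
Proof. by rewrite /clamp /Rmax /Rmin; repeat case: Rle_dec; lra. Qed.

Lemma clamp_id a b x : a <= x <= b -> clamp a b x = x.
Proof. by rewrite /clamp /Rmax /Rmin; repeat case: Rle_dec; lra. Qed.

Lemma clamp_lip a b x y : a <= b ->
  Rabs (clamp a b x - clamp a b y) <= Rabs (x - y).
Proof.
by rewrite /clamp /Rmax /Rmin /Rabs; repeat case: Rle_dec; repeat case: Rcase_abs; lra.
Qed.

Definition cont_on f a b := forall x, a <= x <= b -> forall eps, 0 < eps ->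
  exists d, 0 < d /\ forall x', a <= x' <= b -> Rabs (x' - x) < d ->
    norm (minus (f x') (f x)) < eps.

Lemma continuous_of_norm f x :
  (forall eps, 0 < eps -> exists d, 0 < d /\ forall x', Rabs (x' - x) < d ->
    norm (minus (f x') (f x)) < eps) -> continuous f x.
Proof.
move=> H; apply/filterlim_locally => eps.
have [d [Hd Hx]] := H _ (cond_pos eps).
exists (mkposreal _ Hd) => y Hy; apply: norm_compat1; exact: Hx.
Qed.

Lemma ex_RInt_cont_on f a b : a <= b -> cont_on f a b -> ex_RInt f a b.
Proof.
move=> Hab H.
apply: (ex_RInt_ext (fun x => f (clamp a b x))).
  move=> x; rewrite Rmin_left ?Rmax_right // => Hx.
  by rewrite clamp_id //; lra.
apply: ex_RInt_continuous => x _.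
apply: continuous_of_norm => eps Heps.
have [d [Hd Hx]] := H (clamp a b x) (clamp_in a b x Hab) eps Heps.
exists d; split=> // x' Hx'; apply: Hx; first exact: clamp_in.
apply: Rle_lt_trans (clamp_lip _ _ _ _ Hab) Hx'.
Qed.

Lemma cont_on_lip f a b (K : R) :
  (forall p q, a <= p <= b -> a <= q <= b ->
     norm (minus (f q) (f p)) <= K * Rabs (q - p)) -> cont_on f a b.
Proof.
move=> H x Hx eps Heps.
have HK : 0 < Rabs K + 1 by have := Rabs_pos K; lra.
exists (eps / (Rabs K + 1)); split; first exact: Rdiv_lt_0_compat.
move=> y Hy Hd; apply: Rle_lt_trans (H _ _ Hx Hy) _.
apply: Rle_lt_trans (_ : (Rabs K + 1) * Rabs (y - x) < _).
  apply: Rmult_le_compat_r; first exact: Rabs_pos.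
  have := Rle_abs K; lra.
rewrite Rmult_comm; apply/Rlt_div_r => //.
Qed.

(** The hypothesis makes [f'] Lipschitz, hence integrable; then [f] minus the integral of
    [f'] has quadratically small increments, hence is constant.  Nothing is asked outside
    [[a, b]], so that [f] may be a function controlled only on a closed
    sector. *)
Lemma ftc_quad f (f' : R -> V) a b (K : R) : a <= b ->
  (forall p q, a <= p <= b -> a <= q <= b ->
     norm (minus (minus (f q) (f p)) (scal (q - p) (f' p))) <= K * (q - p) ^ 2) ->
  is_RInt f' a b (minus (f b) (f a)).
Proof.
move=> Hab H.
(* add the hypotheses for (p, q) and (q, p) *)
have Hlip : forall p q, a <= p <= b -> a <= q <= b ->
     norm (minus (f' q) (f' p)) <= 2 * K * Rabs (q - p).
  move=> p q Hp Hq.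
  case: (Req_dec p q) => [->|Hpq].
    rewrite minus_eq_zero norm_zero Rminus_diag Rabs_R0; lra.
  have Hd : 0 < Rabs (q - p) by apply: Rabs_pos_lt; lra.
  apply: (Rmult_le_reg_l (Rabs (q - p))) => //.
  have -> : Rabs (q - p) * norm (minus (f' q) (f' p))
     = norm (scal (q - p) (minus (f' q) (f' p))) by rewrite norm_scal_R.
  have -> : scal (q - p) (minus (f' q) (f' p)) =
     plus (minus (minus (f q) (f p)) (scal (q - p) (f' p)))
          (minus (minus (f p) (f q)) (scal (p - q) (f' q))).
    by vlin V.
  apply: Rle_trans (norm_triangle _ _) _.
  have H1 := H p q Hp Hq. have H2 := H q p Hq Hp.
  have -> : Rabs (q - p) * (2 * K * Rabs (q - p)) = K * (q - p) ^ 2 + K * (p - q) ^ 2.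
    have -> : (p - q) ^ 2 = (q - p) ^ 2 by ring.
    rewrite -(pow2_abs (q - p)); ring.
  lra.
have Hex : ex_RInt f' a b by apply: ex_RInt_cont_on => //; apply: cont_on_lip Hlip.
have Hsub : forall p q, a <= p <= q -> q <= b -> ex_RInt f' p q.
  move=> p q Hp Hq.
  apply: ex_RInt_cont_on; first lra.
  by apply: (cont_on_lip _ _ _ (2 * K)) => u v Hu Hv; apply: Hlip; lra.
have Heq : minus (f a) (RInt f' a a) = minus (f b) (RInt f' a b).
  apply: (const_of_quad (fun x => minus (f x) (RInt f' a x)) a b (3 * K)) => //.
  move=> p q Hp Hq.
  have HC := RInt_Chasles f' a p q (Hsub a p ltac:(lra) ltac:(lra)) (Hsub p q Hp Hq).
  rewrite -HC.
  have -> : minus (minus (f q) (plus (RInt f' a p) (RInt f' p q)))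
                  (minus (f p) (RInt f' a p))
     = minus (minus (minus (f q) (f p)) (scal (q - p) (f' p)))
         (minus (RInt f' p q) (scal (q - p) (f' p))).
    by vlin V.
  have Hi : norm (minus (RInt f' p q) (scal (q - p) (f' p))) <= (q - p) * (2 * K * (q - p)).
    apply: (norm_RInt_le_const (fun x => minus (f' x) (f' p)) p q); first lra.
      move=> x Hx; apply: Rle_trans (Hlip p x _ _) _; try lra.
      case: (Rle_lt_dec 0 K) => HK.
        apply: Rmult_le_compat_l; first lra.
        by rewrite Rabs_pos_eq; lra.
      have [E|E] : q = p \/ p < q by lra.
        have -> : x = p by lra.
        rewrite E Rminus_diag Rabs_R0; lra.
      exfalso; have := H p q ltac:(lra) ltac:(lra).
      have := norm_ge_0 (minus (minus (f q) (f p)) (scal (q - p) (f' p))).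
      have : 0 < (q - p) ^ 2 by apply: pow_lt; lra.
      nra.
    apply: is_RInt_minus; last exact: is_RInt_const.
    exact: (RInt_correct f' p q (Hsub p q Hp Hq)).
  apply: Rle_trans (norm_triangle _ _) _; rewrite norm_opp.
  have := H p q ltac:(lra) ltac:(lra).
  have -> : 3 * K * (q - p) ^ 2 = K * (q - p) ^ 2 + (q - p) * (2 * K * (q - p)) by ring.
  lra.
have -> : minus (f b) (f a) = RInt f' a b.
  rewrite RInt_point minus_zero_r in Heq.
  rewrite Heq /minus opp_plus opp_opp plus_assoc plus_opp_r plus_zero_l //.
exact: (RInt_correct f' a b Hex).
Qed.

Lemma is_derive_quad f p (l : V) (K d : R) : 0 < d ->
  (forall q, Rabs (q - p) < d ->
     norm (minus (minus (f q) (f p)) (scal (q - p) l)) <= K * (q - p) ^ 2) ->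
  is_derive f p l.
Proof.
move=> Hd H; split; first exact: is_linear_scal_l.
move=> x Hx.
have -> : x = p by symmetry; apply: is_filter_lim_locally_unique Hx.
move=> eps.
have HK : 0 < Rabs K + 1 by have := Rabs_pos K; lra.
have Hd' : 0 < Rmin d (eps / (Rabs K + 1)).
  apply: Rmin_pos => //; apply: Rdiv_lt_0_compat => //; exact: cond_pos.
exists (mkposreal _ Hd') => q Hq.
have {}Hq : Rabs (q - p) < Rmin d (eps / (Rabs K + 1)) by exact: Hq.
have H1 := Rlt_le_trans _ _ _ Hq (Rmin_l _ _).
have H2 := Rlt_le_trans _ _ _ Hq (Rmin_r _ _).
apply: Rle_trans (H q H1) _.
have -> : norm (minus q p) = Rabs (q - p) by [].
rewrite -(pow2_abs (q - p)).
have H3 : Rabs (q - p) * (Rabs K + 1) < eps by apply/Rlt_div_r.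
have := Rle_abs K; have := Rabs_pos (q - p); nra.
Qed.

Lemma is_derive_unique_normed f p (l l' : V) :
  is_derive f p l -> is_derive f p l' -> l = l'.
Proof.
move=> [_ H] [_ H'].
apply: (norm_le_eps_eq l l' 2) => eps Heps.
have Hp : is_filter_lim (locally p) p by [].
have [d Hd] := filter_and _ _ (H p Hp (mkposreal _ Heps)) (H' p Hp (mkposreal _ Heps)).
have Hd0 := cond_pos d.
have [h1 h2] := Hd (p + d / 2) ltac:(rewrite /ball /= /AbsRing_ball /abs /minus /plus /opp /=; apply: Rabs_def1; lra).
have Eq : minus (p + d / 2) p = d / 2 by rewrite /minus /plus /opp /=; ring.
rewrite !Eq /= in h1 h2.
have Hn : norm (d / 2 : R_NormedModule) = d / 2 by rewrite /norm /= /abs /= Rabs_pos_eq; lra.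
rewrite !Hn in h1 h2.
have E : scal (d / 2) (minus l l') =
   minus (minus (minus (f (p + d / 2)) (f p)) (scal (d / 2) (l')))
     (minus (minus (f (p + d / 2)) (f p)) (scal (d / 2) (l))) .
  by vlin V.
have h3 : d / 2 * norm (minus l l') <= eps * (d / 2) + eps * (d / 2).
  rewrite -{1}(Rabs_pos_eq (d / 2)); last lra.
  rewrite -norm_scal_R E.
  apply: Rle_trans (norm_triangle _ _) _; rewrite norm_opp.
  exact: Rplus_le_compat h2 h1.
apply: (Rmult_le_reg_l (d / 2)); first lra.
refine (Rle_trans _ _ _ h3 _); lra.
Qed.

(** Cauchy's criterion: two integrals of [f] differ by at most the difference of the
    integrals of [m]. *)
Lemma ex_RInt_gen_dominated f (m : R -> R) (Fa Fb : (R -> Prop) -> Prop) (lm : R) :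
  ProperFilter Fa -> ProperFilter Fb ->
  filter_prod Fa Fb (fun ab => fst ab <= snd ab) ->
  filter_prod Fa Fb (fun ab => ex_RInt f (fst ab) (snd ab) /\
    forall x, fst ab <= x <= snd ab -> norm (f x) <= m x) ->
  is_RInt_gen m Fa Fb lm -> ex_RInt_gen f Fa Fb.
Proof.
move=> HFa HFb Hle Hf Hm.
pose h (ab : R * R) := RInt f (fst ab) (snd ab).
have [l Hl] : exists l, filterlim h (filter_prod Fa Fb) (locally l).
  apply/filterlim_locally_cauchy => eps.
  have He4 : 0 < eps / 4 by have := cond_pos eps; lra.
  have Hm' : filter_prod Fa Fb (fun ab => exists y,
      is_RInt m (fst ab) (snd ab) y /\ ball_norm lm (mkposreal _ He4) y) :=
    Hm _ (locally_ball_norm lm (mkposreal _ He4)).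
  have [P Q HP HQ HPQ] := filter_and _ _ Hm' (filter_and _ _ Hle Hf).
  have mono a a' b b' : P a -> P a' -> Q b -> Q b' -> a <= a' ->
      norm (minus (RInt f a b) (RInt f a' b)) < eps / 2.
    move=> Pa Pa' Qb Qb' Haa.
    have [/= [I [HI HIl]] [Hab [Hex Hn]]] := HPQ a b Pa Qb.
    have [/= [I' [HI' HIl']] [Hab' [Hex' Hn']]] := HPQ a' b Pa' Qb.
    have Hexa : ex_RInt f a a' by apply: ex_RInt_Chasles_1 Hex; lra.
    have -> : minus (RInt f a b) (RInt f a' b) = RInt f a a'.
      by rewrite -(RInt_Chasles f a a' b Hexa Hex'); vlin V.
    have HIm : is_RInt m a a' (minus I I').
      have -> : minus I I' = plus I (opp I') by [].
      apply: is_RInt_Chasles HI _; exact: is_RInt_swap.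
    apply: Rle_lt_trans
      (norm_RInt_le f m a a' _ _ Haa _ (RInt_correct f a a' Hexa) HIm) _.
      by move=> x Hx; apply: Hn; lra.
    move: HIl HIl'; rewrite /ball_norm /minus /plus /opp /norm /= /abs /=.
    move=> /Rabs_def2 H1 /Rabs_def2 H2; lra.
  have monob a b b' : P a -> Q b -> Q b' -> b <= b' ->
      norm (minus (RInt f a b') (RInt f a b)) < eps / 2.
    move=> Pa Qb Qb' Hbb.
    have [/= [I [HI HIl]] [Hab [Hex Hn]]] := HPQ a b Pa Qb.
    have [/= [I' [HI' HIl']] [Hab' [Hex' Hn']]] := HPQ a b' Pa Qb'.
    have Hexb : ex_RInt f b b' by apply: ex_RInt_Chasles_2 Hex'; lra.
    have -> : minus (RInt f a b') (RInt f a b) = RInt f b b'.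
      by rewrite -(RInt_Chasles f a b b' Hex Hexb); vlin V.
    have HIm : is_RInt m b b' (plus (opp I) I').
      apply: is_RInt_Chasles HI'; exact: is_RInt_swap.
    apply: Rle_lt_trans
      (norm_RInt_le f m b b' _ _ Hbb _ (RInt_correct f b b' Hexb) HIm) _.
      by move=> x Hx; apply: Hn'; lra.
    move: HIl HIl'; rewrite /ball_norm /minus /plus /opp /norm /= /abs /=.
    move=> /Rabs_def2 H1 /Rabs_def2 H2; lra.
  exists (fun ab => P (fst ab) /\ Q (snd ab)); split.
    by exists P Q.
  move=> [a b] [a' b'] /= [Pa Qb] [Pa' Qb'].
  apply: norm_compat1.
  apply: Rle_lt_trans (norm_minus_triangle _ (RInt f a' b) _) _.
  rewrite /h /=.
  have H1 : norm (minus (RInt f a' b') (RInt f a' b)) < eps / 2.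
    case: (Rle_dec b b') => Hb; first exact: monob.
    rewrite norm_minus_sym; apply: monob => //; lra.
  have H2 : norm (minus (RInt f a' b) (RInt f a b)) < eps / 2.
    case: (Rle_dec a' a) => Ha; first exact: (mono a' a b b).
    rewrite norm_minus_sym; apply: (mono a a' b b) => //; lra.
  lra.
exists l => P HP.
have Hh : filter_prod Fa Fb (fun ab => P (h ab)) := Hl P HP.
refine (filter_imp _ _ _ (filter_and _ _ Hh Hf)) => -[a b] /= [{}Hh [Hex _]].
by exists (h (a, b)); split=> //; apply: RInt_correct.
Qed.

Lemma is_RInt_gen_primitive f (P : R -> V) (Fa Fb : (R -> Prop) -> Prop) (la lb : V) :
  Filter Fa -> Filter Fb ->
  filter_prod Fa Fb (fun ab =>
    is_RInt f (fst ab) (snd ab) (minus (P (snd ab)) (P (fst ab)))) ->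
  filterlim P Fa (locally la) -> filterlim P Fb (locally lb) ->
  is_RInt_gen f Fa Fb (minus lb la).
Proof.
move=> HFa HFb Hf Ha Hb.
have Hl : filterlim (fun ab : R * R => minus (P (snd ab)) (P (fst ab)))
   (filter_prod Fa Fb) (locally (minus lb la)).
  apply: (filterlim_comp_2 (F := filter_prod Fa Fb)
    (fun ab => P (snd ab)) (fun ab => opp (P (fst ab))) plus).
  - exact: filterlim_comp filterlim_snd Hb.
  - apply: filterlim_comp (filterlim_opp _).
    exact: filterlim_comp filterlim_fst Ha.
  - exact: filterlim_plus.
move=> Q HQ.
have HlQ : filter_prod Fa Fb (fun ab => Q (minus (P (snd ab)) (P (fst ab)))) := Hl Q HQ.
refine (filter_imp _ _ _ (filter_and _ _ HlQ Hf)) => -[a b] /= [H1 H2]; by exists (minus (P b) (P a)).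
Qed.

End BanachCalculus.

Section LinearMaps.

Context {V W : CompleteNormedModule R_AbsRing} (L : V -> W) (HL : is_linear L).

Lemma Riemann_sum_linear (f : R -> V) ptd :
  Riemann_sum (fun x => L (f x)) ptd = L (Riemann_sum f ptd).
Proof.
have L0 : L zero = zero.
  have -> : zero = scal 0 zero :> V by symmetry; apply: scal_zero_l.
  by rewrite (linear_scal L HL); apply: scal_zero_l.
apply (SF_cons_ind (fun ptd => Riemann_sum (fun x => L (f x)) ptd = L (Riemann_sum f ptd))).
  by move=> x0; rewrite /Riemann_sum /= L0.
move=> h s IH.
by rewrite !Riemann_sum_cons IH (linear_plus L HL) (linear_scal L HL).
Qed.

Lemma is_RInt_linear (f : R -> V) a b l :
  is_RInt f a b l -> is_RInt (fun x => L (f x)) a b (L l).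
Proof.
move=> H.
apply: (filterlim_ext (fun ptd => L (scal (sign (b - a)) (Riemann_sum f ptd)))).
  by move=> ptd; rewrite (linear_scal L HL) Riemann_sum_linear.
apply: filterlim_comp H _; exact: linear_cont.
Qed.

Lemma is_RInt_gen_linear (f : R -> V) Fa Fb l : Filter Fa -> Filter Fb ->
  is_RInt_gen f Fa Fb l -> is_RInt_gen (fun x => L (f x)) Fa Fb (L l).
Proof.
move=> HFa HFb H P HP.
have HP' : filter_prod Fa Fb (fun ab => exists y,
    is_RInt f (fst ab) (snd ab) y /\ P (L y)) := H _ (linear_cont L l HL P HP).
refine (filter_imp _ _ _ HP') => ab [y [H1 H2]].
exists (L y); split=> //.
exact: is_RInt_linear.
Qed.

End LinearMaps.

(** * Complex functions of a real variable *)
Lemma mean_value_le (f df : R -> R) a b K :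
  (forall x, Rmin a b <= x <= Rmax a b -> is_derive f x (df x) /\ Rabs (df x) <= K) ->
  Rabs (f b - f a) <= K * Rabs (b - a).
Proof.
move=> H.
have [||c [Hc ->]] := MVT_gen f a b df.
- by move=> x Hx; apply: (proj1 (H x _)); lra.
- move=> x Hx; apply/continuity_pt_filterlim.
  apply: (ex_derive_continuous f); exists (df x); exact: (proj1 (H x Hx)).
rewrite Rabs_mult; apply: Rmult_le_compat_r; first exact: Rabs_pos.
exact: (proj2 (H c Hc)).
Qed.

Lemma taylor_le (f df ddf : R -> R) a b K :
  (forall x, Rmin a b <= x <= Rmax a b ->
     is_derive f x (df x) /\ is_derive df x (ddf x) /\ Rabs (ddf x) <= K) ->
  Rabs (f b - f a - (b - a) * df a) <= K * (b - a) ^ 2.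
Proof.
move=> H.
have -> : f b - f a - (b - a) * df a =
  (fun x => f x - (x - a) * df a) b - (fun x => f x - (x - a) * df a) a by ring.
rewrite -(pow2_abs (b - a)).
have -> : K * Rabs (b - a) ^ 2 = K * Rabs (b - a) * Rabs (b - a) by ring.
apply: (mean_value_le (fun x => f x - (x - a) * df a) (fun x => df x - df a)
  a b (K * Rabs (b - a))) => x Hx; split.
  have [Hd _] := H x Hx.
  by auto_derive; [exists (df x) | rewrite (is_derive_unique _ _ _ Hd); ring].
have Hx' : Rabs (x - a) <= Rabs (b - a).
  move: Hx; rewrite /Rmin /Rmax /Rabs; case: Rle_dec; repeat case: Rcase_abs; lra.
apply: Rle_trans (_ : K * Rabs (x - a) <= _).
  apply: (mean_value_le df ddf a x) => y Hy.
  have : Rmin a b <= y <= Rmax a b.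
    by move: Hx Hy; rewrite /Rmin /Rmax; repeat case: Rle_dec; lra.
  by move=> /H [_].
apply: Rmult_le_compat_l => //.
have [_ [_ HK]] := H x Hx; have := Rabs_pos (ddf x); lra.
Qed.

Lemma Cmod_le_sum (z : C) : Cmod z <= Rabs (fst z) + Rabs (snd z).
Proof.
rewrite /Cmod; apply: Rsqr_incr_0_var; last first.
  have := Rabs_pos (fst z); have := Rabs_pos (snd z); lra.
rewrite Rsqr_sqrt; last by have := pow2_ge_0 (fst z); have := pow2_ge_0 (snd z); lra.
rewrite -(pow2_abs (fst z)) -(pow2_abs (snd z)) /Rsqr.
have := Rabs_pos (fst z); have := Rabs_pos (snd z); nra.
Qed.

Lemma fst_le_Cmod (z : C) : Rabs (fst z) <= Cmod z.
Proof. have := Rmax_Cmod z; have := Rmax_l (Rabs (fst z)) (Rabs (snd z)); lra. Qed.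

Lemma snd_le_Cmod (z : C) : Rabs (snd z) <= Cmod z.
Proof. have := Rmax_Cmod z; have := Rmax_r (Rabs (fst z)) (Rabs (snd z)); lra. Qed.

(** Componentwise, so that derivatives of explicit functions reduce to real ones. *)
Definition is_derive_C (f : R -> C) (p : R) (l : C) : Prop :=
  is_derive (fun q => fst (f q)) p (fst l) /\ is_derive (fun q => snd (f q)) p (snd l).

Lemma derive_C_ext f g p l : (forall q, f q = g q) -> is_derive_C f p l -> is_derive_C g p l.
Proof.
by move=> E [H1 H2]; split; [apply: is_derive_ext H1 | apply: is_derive_ext H2] => q;
  rewrite E.
Qed.

Lemma derive_C_eq f p l l' : l = l' -> is_derive_C f p l -> is_derive_C f p l'.
Proof. by move=> ->. Qed.

Lemma derive_C_const c p : is_derive_C (fun _ => c) p 0.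
Proof. by split; apply: is_derive_const. Qed.

Lemma derive_C_RtoC f p l : is_derive f p l -> is_derive_C (fun q => RtoC (f q)) p l.
Proof. by move=> H; split=> //=; apply: is_derive_const. Qed.

Lemma derive_C_pair (f g : R -> R) p l m :
  is_derive f p l -> is_derive g p m -> is_derive_C (fun q => (f q, g q)) p (l, m).
Proof. by []. Qed.

Lemma derive_C_plus f g p l m : is_derive_C f p l -> is_derive_C g p m ->
  is_derive_C (fun q => f q + g q)%C p (l + m)%C.
Proof. by move=> [H1 H2] [H3 H4]; split; apply: is_derive_plus. Qed.

Lemma derive_C_mult f g p l m : is_derive_C f p l -> is_derive_C g p m ->
  is_derive_C (fun q => f q * g q)%C p (l * g p + f p * m)%C.
Proof.
move=> [H1 H2] [H3 H4]; split; rewrite /Cmult /Cplus /=.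
  have -> : fst l * fst (g p) - snd l * snd (g p) + (fst (f p) * fst m - snd (f p) * snd m)
     = minus (fst l * fst (g p) + fst (f p) * fst m) (snd l * snd (g p) + snd (f p) * snd m).
    rewrite /minus /plus /opp /=; ring.
  apply: is_derive_minus; apply: is_derive_mult => //; exact: Rmult_comm.
have -> : fst l * snd (g p) + snd l * fst (g p) + (fst (f p) * snd m + snd (f p) * fst m)
     = plus (fst l * snd (g p) + fst (f p) * snd m) (snd l * fst (g p) + snd (f p) * fst m).
  rewrite /plus /=; ring.
apply: (is_derive_plus (V := R_NormedModule)); apply: is_derive_mult => //; exact: Rmult_comm.
Qed.

Lemma derive_C_Cexp u p l : is_derive_C u p l -> is_derive_C (fun q => Cexp (u q)) p (l * Cexp (u p))%C.
Proof.
move=> [H1 H2]; rewrite /Cexp /polar /Re /Im.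
move: H1 H2; set f := fun q => fst (u q); set g := fun q => snd (u q) => H1 H2.
have E1 := is_derive_unique _ _ _ H1; have E2 := is_derive_unique _ _ _ H2.
have D1 : ex_derive f p by eexists; exact: H1.
have D2 : ex_derive g p by eexists; exact: H2.
split; rewrite /Cmult /=.
  change (is_derive (fun q => exp (f q) * cos (g q)) p
    (fst l * (exp (f p) * cos (g p)) - snd l * (exp (f p) * sin (g p)))).
  by auto_derive; [split | rewrite E1 E2; ring].
change (is_derive (fun q => exp (f q) * sin (g q)) p
    (fst l * (exp (f p) * sin (g p)) + snd l * (exp (f p) * cos (g p)))).
by auto_derive; [split | rewrite E1 E2; ring].
Qed.

Lemma derive_C_comp (f : R -> C) (g : R -> R) (p : R) (l : C) (m : R) :
  is_derive_C f (g p) l -> is_derive g p m -> is_derive_C (fun q => f (g q)) p (RtoC m * l)%C.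
Proof.
move=> [H1 H2] Hg; split.
  have -> : fst (RtoC m * l)%C = scal m (fst l) by rewrite /scal /= /mult /=; ring.
  exact: (is_derive_comp (fun q => fst (f q)) g).
have -> : snd (RtoC m * l)%C = scal m (snd l) by rewrite /scal /= /mult /=; ring.
exact: (is_derive_comp (fun q => snd (f q)) g).
Qed.

Lemma derive_C_line z k p : is_derive_C (fun p => z + RtoC p * k)%C p k.
Proof.
apply: (derive_C_eq _ _ (0 + (1 * k + RtoC p * 0))%C); first ring.
apply: derive_C_plus; first exact: derive_C_const.
apply: derive_C_mult; last exact: derive_C_const.
apply: derive_C_RtoC; exact: is_derive_id.
Qed.

Lemma derive_C_Cexp_line z k p : is_derive_C (fun p => Cexp (z + RtoC p * k)%C) p (k * Cexp (z + RtoC p * k))%C.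
Proof. apply: derive_C_Cexp; exact: derive_C_line. Qed.

(** The factor [2] comes from bounding the two components separately. *)
Lemma C_mean_value (f df : R -> C) a b K :
  (forall x, Rmin a b <= x <= Rmax a b -> is_derive_C f x (df x) /\ Cmod (df x) <= K) ->
  Cmod (f b - f a)%C <= 2 * K * Rabs (b - a).
Proof.
move=> H; apply: Rle_trans (Cmod_le_sum _) _.
have -> : 2 * K * Rabs (b - a) = K * Rabs (b - a) + K * Rabs (b - a) by ring.
apply: Rplus_le_compat.
  apply: (mean_value_le (fun q => fst (f q)) (fun q => fst (df q))) => x Hx.
  have [[H1 H2] H3] := H x Hx; split=> //; have := fst_le_Cmod (df x); lra.
apply: (mean_value_le (fun q => snd (f q)) (fun q => snd (df q))) => x Hx.
have [[H1 H2] H3] := H x Hx; split=> //; have := snd_le_Cmod (df x); lra.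
Qed.

Lemma C_taylor (f df ddf : R -> C) a b K :
  (forall x, Rmin a b <= x <= Rmax a b ->
     is_derive_C f x (df x) /\ is_derive_C df x (ddf x) /\ Cmod (ddf x) <= K) ->
  Cmod (f b - f a - RtoC (b - a) * df a)%C <= 2 * K * (b - a) ^ 2.
Proof.
move=> H; apply: Rle_trans (Cmod_le_sum _) _.
have -> : 2 * K * (b - a) ^ 2 = K * (b - a) ^ 2 + K * (b - a) ^ 2 by ring.
apply: Rplus_le_compat.
  have -> : fst (f b - f a - RtoC (b - a) * df a)%C
     = fst (f b) - fst (f a) - (b - a) * fst (df a) by simpl; ring.
  apply: (taylor_le (fun q => fst (f q)) (fun q => fst (df q)) (fun q => fst (ddf q))) => x Hx.
  have [[H1 _] [[H2 _] H3]] := H x Hx; do !split=> //; have := fst_le_Cmod (ddf x); lra.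
have -> : snd (f b - f a - RtoC (b - a) * df a)%C
     = snd (f b) - snd (f a) - (b - a) * snd (df a) by simpl; ring.
apply: (taylor_le (fun q => snd (f q)) (fun q => snd (df q)) (fun q => snd (ddf q))) => x Hx.
have [[_ H1] [[_ H2] H3]] := H x Hx; do !split=> //; have := snd_le_Cmod (ddf x); lra.
Qed.

Lemma Cmod_polar s psi : 0 <= s -> Cmod (polar s psi) = s.
Proof.
move=> Hs; rewrite /Cmod /polar /=.
have -> : s * cos psi * (s * cos psi * 1) + s * sin psi * (s * sin psi * 1) = Rsqr s.
  have := sin2_cos2 psi; rewrite /Rsqr => E.
  have -> : s * cos psi * (s * cos psi * 1) + s * sin psi * (s * sin psi * 1) =
    s * s * (sin psi * sin psi + cos psi * cos psi) by ring.
  by rewrite E Rmult_1_r.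
exact: sqrt_Rsqr.
Qed.

Lemma Cexp_polar s psi : 0 < s -> Cexp (ln s, psi) = polar s psi.
Proof. by move=> Hs; rewrite /Cexp /Re /Im /= exp_ln. Qed.

Lemma polar_mult s t psi eta : (polar s psi * polar t eta)%C = polar (s * t) (psi + eta).
Proof. rewrite /polar /Cmult /= cos_plus sin_plus; congr pair; ring. Qed.

Lemma polar_scale a b psi : polar (a * b) psi = (RtoC a * polar b psi)%C.
Proof. by rewrite /polar /Cmult /=; congr pair; ring. Qed.

Lemma Cexp_plus z w : Cexp (z + w) = (Cexp z * Cexp w)%C.
Proof. by rewrite /Cexp polar_mult /= exp_plus. Qed.

Lemma Cmod_Cexp z : Cmod (Cexp z) = exp (Re z).
Proof. by rewrite /Cexp Cmod_polar //; left; apply: exp_pos. Qed.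

Lemma polar_neq_0 s psi : 0 < s -> polar s psi <> 0%C.
Proof. by move=> Hs; apply/Cmod_gt_0; rewrite Cmod_polar; lra. Qed.

Lemma Carg_polar s psi : 0 < s -> - PI < psi < PI -> Carg (polar s psi) = psi.
Proof.
move=> Hs Hpsi; rewrite /Carg; case: Ceq_dec => [/(polar_neq_0 s psi Hs) //|_].
rewrite Cmod_polar; last lra.
have -> : Re (polar s psi) / s = cos psi by rewrite /Re /=; field; lra.
rewrite /Im /=; case: Rle_dec => H.
  apply: acos_cos; split; last lra.
  apply: Rnot_lt_le => Hn.
  have : sin psi < 0 by apply: sin_lt_0_var; lra.
  nra.
have Hn : psi < 0.
  apply: Rnot_le_lt => Hn; apply: H; apply: Rmult_le_pos; first lra.
  apply: sin_ge_0; lra.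
rewrite -cos_neg acos_cos; lra.
Qed.

Lemma Cpow_polar s psi a : 0 < s -> - PI < psi < PI ->
  Defs.Cpow (polar s psi) a = polar (Rpower s a) (a * psi).
Proof.
move=> Hs Hpsi; rewrite /Defs.Cpow; case: Ceq_dec => [/(polar_neq_0 s psi Hs) //|_].
by rewrite Carg_polar // Cmod_polar //; lra.
Qed.

(** The half-angle formula for the argument is smooth on the whole cut plane, unlike one with
    [acos]. *)
Definition Clog (z : C) : C := (ln (Cmod z), 2 * atan (snd z / (Cmod z + fst z))).

Lemma derive_C_Clog u p l : is_derive_C u p l -> 0 < Cmod (u p) + fst (u p) ->
  is_derive_C (fun q => Clog (u q)) p (l / u p)%C.
Proof.
move=> [H1 H2]; rewrite /Clog /Cmod.
have -> : (l / u p)%C = ((fst l * fst (u p) + snd l * snd (u p)) / (fst (u p) ^ 2 + snd (u p) ^ 2),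
   (snd l * fst (u p) - fst l * snd (u p)) / (fst (u p) ^ 2 + snd (u p) ^ 2)).
  by rewrite /Cdiv /Cmult /Cinv /=; congr pair; rewrite /Rdiv; ring.
move: H1 H2; move: (fst l) (snd l) => X' Y'.
rewrite /is_derive_C.
set f := fun q => fst (u q); set g := fun q => snd (u q) => H1 H2.
change (0 < sqrt (f p ^ 2 + g p ^ 2) + f p ->
  is_derive (fun q => ln (sqrt (f q ^ 2 + g q ^ 2))) p
    ((X' * f p + Y' * g p) / (f p ^ 2 + g p ^ 2)) /\
  is_derive (fun q => 2 * atan (g q / (sqrt (f q ^ 2 + g q ^ 2) + f q))) p
    ((Y' * f p - X' * g p) / (f p ^ 2 + g p ^ 2))).
have E1 := is_derive_unique _ _ _ H1; have E2 := is_derive_unique _ _ _ H2.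
have D1 : ex_derive f p by eexists; exact: H1.
have D2 : ex_derive g p by eexists; exact: H2.
move=> Hp.
have HD : 0 < f p ^ 2 + g p ^ 2.
  apply: Rnot_le_lt => Hn; move: Hp.
  have -> : f p = 0 by nra.
  have -> : g p = 0 by nra.
  have -> : 0 ^ 2 + 0 ^ 2 = 0 by ring.
  rewrite sqrt_0; lra.
have Hm : 0 < sqrt (f p ^ 2 + g p ^ 2) by apply: sqrt_lt_R0.
have Hmm : sqrt (f p ^ 2 + g p ^ 2) * sqrt (f p ^ 2 + g p ^ 2) = f p ^ 2 + g p ^ 2.
  by apply: sqrt_sqrt; lra.
split; auto_derive.
- by do !split=> //; simpl in *.
- rewrite E1 E2.
  have -> : f p * (f p * 1) + g p * (g p * 1) = f p ^ 2 + g p ^ 2 by ring.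
  move: Hm Hmm HD; move: (sqrt _) => m; move: (f p) (g p) => X Y Hm Hmm HD.
  rewrite -Hmm; field; lra.
- by do !split=> //; simpl in *; lra.
rewrite E1 E2.
have -> : f p * (f p * 1) + g p * (g p * 1) = f p ^ 2 + g p ^ 2 by ring.
move: Hm Hmm HD Hp; move: (sqrt _) => m; move: (f p) (g p) => X Y Hm Hmm HD Hp.
rewrite -Hmm.
have HY : Y * Y = m * m - X * X by nra.
have Hden : (m + X) * (m + X) + Y * Y = 2 * m * (m + X) by rewrite HY; ring.
have -> : 1 + Y / (m + X) * (Y / (m + X) * 1) = 2 * m / (m + X).
  apply: (Rmult_eq_reg_r ((m + X) * (m + X))); last by nra.
  have -> : (1 + Y / (m + X) * (Y / (m + X) * 1)) * ((m + X) * (m + X))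
     = (m + X) * (m + X) + Y * Y by field; lra.
  rewrite Hden; field; lra.
apply: (Rmult_eq_reg_r (m * m * (m + X))); last first.
  by apply: Rgt_not_eq; apply: Rmult_gt_0_compat => //; apply: Rmult_gt_0_compat.
transitivity (Y' * m * (m + X) - Y * X * X' - Y * Y * Y' - m * X' * Y).
  by field; lra.
by rewrite HY; field; lra.
Qed.

Lemma Clog_polar s psi : 0 < s -> - PI < psi < PI -> Clog (polar s psi) = (ln s, psi).
Proof.
move=> Hs Hpsi; rewrite /Clog Cmod_polar; last lra.
congr pair; rewrite /polar /=.
have Hc : 0 < cos (psi / 2) by apply: cos_gt_0; lra.
have E1 : sin psi = 2 * sin (psi / 2) * cos (psi / 2).
  by rewrite -sin_2a; congr sin; field.
have E2 : 1 + cos psi = 2 * cos (psi / 2) * cos (psi / 2).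
  have -> : psi = 2 * (psi / 2) by field.
  rewrite cos_2a_cos; replace (2 * (psi / 2) / 2) with (psi / 2) by field; ring.
have -> : s * sin psi / (s + s * cos psi) = tan (psi / 2).
  have -> : s + s * cos psi = s * (1 + cos psi) by ring.
  rewrite E1 E2 /tan; field; lra.
rewrite atan_tan; lra.
Qed.

(** * Real improper integrals *)
Lemma Rpower_pos x a : 0 < Rpower x a.
Proof. exact: exp_pos. Qed.

Lemma exp_le x y : x <= y -> exp x <= exp y.
Proof. by move=> [H | ->]; [left; apply: exp_increasing | right]. Qed.

Lemma Rpower_anti x y a : 0 < x <= y -> a <= 0 -> Rpower y a <= Rpower x a.
Proof.
move=> [Hx Hxy] Ha; rewrite /Rpower; apply: exp_le.
have : ln x <= ln y by apply: ln_le.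
nra.
Qed.

Lemma Rpower_mono x y a : 0 < x <= y -> 0 <= a -> Rpower x a <= Rpower y a.
Proof.
move=> [Hx Hxy] Ha; rewrite /Rpower; apply: exp_le.
have : ln x <= ln y by apply: ln_le.
nra.
Qed.

Lemma Rpower_small a eps : 0 < a -> 0 < eps -> exists d, 0 < d /\
  forall s, 0 < s < d -> Rpower s a < eps.
Proof.
move=> Ha He; exists (Rpower eps (/ a)); split; first exact: Rpower_pos.
move=> s Hs.
have -> : eps = Rpower (Rpower eps (/ a)) a by rewrite Rpower_mult Rinv_l ?Rpower_1 //; lra.
by apply: Rlt_Rpower_l.
Qed.

Lemma continuous_of_derive (f : R -> R) x l : is_derive f x l -> continuous f x.
Proof. by move=> H; apply: (ex_derive_continuous f); exists l. Qed.

Lemma filterlim_exp_decay k : 0 < k ->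
  filterlim (fun x => exp (- (k * x))) (Rbar_locally p_infty) (locally 0).
Proof.
move=> Hk; apply/filterlim_locally => eps.
exists (- ln eps / k) => x Hx.
rewrite /ball /= /AbsRing_ball /abs /minus /plus /opp /=.
rewrite Ropp_0 Rplus_0_r Rabs_pos_eq; last by left; apply: exp_pos.
rewrite -(exp_ln eps); last exact: cond_pos.
apply: exp_increasing.
have := Rmult_lt_compat_l k _ _ Hk Hx.
have -> : k * (- ln eps / k) = - ln eps by field; lra.
lra.
Qed.

Lemma is_RInt_exp_decay (K k a b : R) : 0 < k ->
  is_RInt (fun x => K * exp (- (k * x))) a b
    (minus (- K / k * exp (- (k * b))) (- K / k * exp (- (k * a)))).
Proof.
move=> Hk.
apply: (is_RInt_derive (V := R_CompleteNormedModule) (fun x => - K / k * exp (- (k * x)))) => x _.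
  by auto_derive => //; field; lra.
apply: (ex_derive_continuous (fun x => K * exp (- (k * x)))); by auto_derive.
Qed.

Lemma filterlim_scal_exp_decay (K k : R) : 0 < k ->
  filterlim (fun x => K * exp (- (k * x))) (Rbar_locally p_infty) (locally 0).
Proof.
move=> Hk.
have -> : 0 = scal K (0 : R) by rewrite /scal /= /mult /= Rmult_0_r.
apply: filterlim_comp (filterlim_exp_decay k Hk) _.
exact: (filterlim_scal_r (V := R_NormedModule) K 0).
Qed.

Lemma is_RInt_gen_exp_decay (K k a : R) : 0 < k ->
  is_RInt_gen (V := R_NormedModule) (fun x => K * exp (- (k * x))) (at_point a)
    (Rbar_locally p_infty) (K / k * exp (- (k * a))).
Proof.
move=> Hk.
have -> : K / k * exp (- (k * a)) = minus 0 (- K / k * exp (- (k * a))).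
  rewrite /minus /plus /opp /=; field; lra.
apply: (is_RInt_gen_primitive (V := R_CompleteNormedModule) _
   (fun x => - K / k * exp (- (k * x)))).
- by apply: filter_forall => -[u v]; apply: is_RInt_exp_decay.
- move=> P HP; exact: locally_singleton.
- exact: filterlim_scal_exp_decay.
Qed.

Lemma at_right_near a d : 0 < d -> at_right a (fun s => a < s < a + d).
Proof.
move=> Hd; exists (mkposreal _ Hd) => x Hx Hx0; split=> //.
move: Hx; rewrite /ball /= /AbsRing_ball /abs /minus /plus /opp /= => /Rabs_def2; lra.
Qed.

Lemma at_left_near b d : 0 < d -> at_left b (fun s => b - d < s < b).
Proof.
move=> Hd; exists (mkposreal _ Hd) => x Hx Hx0; split=> //.
move: Hx; rewrite /ball /= /AbsRing_ball /abs /minus /plus /opp /= => /Rabs_def2; lra.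
Qed.

Lemma halfline_eventually (P : R * R -> Prop) :
  (forall a b, 0 < a -> a <= b -> P (a, b)) ->
  filter_prod (at_right 0) (Rbar_locally p_infty) P.
Proof.
move=> H.
exists (fun x => 0 < x < 0 + 1) (fun x => 1 < x); first exact: (at_right_near 0 1 Rlt_0_1).
  by exists 1.
by move=> x y Hx Hy; apply: H; lra.
Qed.

Lemma is_RInt_gen_exp_halfline (K k : R) : 0 < k ->
  is_RInt_gen (V := R_NormedModule) (fun x => K * exp (- (k * x))) (at_right 0)
    (Rbar_locally p_infty) (K / k).
Proof.
move=> Hk.
have -> : K / k = minus 0 (- K / k * exp (- (k * 0))).
  rewrite Rmult_0_r Ropp_0 exp_0 /minus /plus /opp /=; field; lra.
apply: (is_RInt_gen_primitive (V := R_CompleteNormedModule) _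
   (fun x => - K / k * exp (- (k * x)))).
- apply: filter_forall => -[u v]; exact: is_RInt_exp_decay.
- apply: filterlim_filter_le_1 (_ : filterlim _ (locally 0) _).
    exact: filter_le_within.
  apply: (ex_derive_continuous (fun x => - K / k * exp (- (k * x)))); by auto_derive.
- exact: filterlim_scal_exp_decay.
Qed.

Lemma is_RInt_gen_exp (K : R) :
  is_RInt_gen (V := R_NormedModule) (fun x => K * exp (- x)) (at_right 0)
    (Rbar_locally p_infty) K.
Proof.
have {2}-> : K = K / 1 by field.
apply: is_RInt_gen_ext (is_RInt_gen_exp_halfline K 1 Rlt_0_1).
by apply: filter_forall => ab x _; rewrite Rmult_1_l.
Qed.

Lemma filterlim_Rpower_0 a : 0 < a ->
  filterlim (fun x => Rpower x a) (at_right 0) (locally 0).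
Proof.
move=> Ha; apply/filterlim_locally => eps.
have He : 0 < Rpower eps (/ a) by exact: Rpower_pos.
exists (mkposreal _ He) => x Hx Hx0.
rewrite /ball /= /AbsRing_ball /abs /minus /plus /opp /=.
rewrite Ropp_0 Rplus_0_r Rabs_pos_eq; last by left; apply: Rpower_pos.
have -> : (eps : R) = Rpower (Rpower eps (/ a)) a.
  by rewrite Rpower_mult Rinv_l ?Rpower_1 //; [exact: cond_pos | lra].
apply: Rlt_Rpower_l => //; split=> //.
move: Hx; rewrite /ball /= /AbsRing_ball /abs /minus /plus /opp /= => /Rabs_def2; lra.
Qed.

Lemma is_derive_Rpower x a : 0 < x ->
  is_derive (fun s => Rpower s a) x (a * Rpower x (a - 1)).
Proof.
move=> Hx; apply/is_derive_Reals; exact: derivable_pt_lim_power.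
Qed.

(** The integrand is dominated by the derivative [m] of a function [N] with finite limits at
    both ends: integrating by parts removes the singularity at [0]. *)
Lemma ex_RInt_gen_Gamma x : 0 < x < 1 ->
  ex_RInt_gen (V := R_NormedModule) (fun s => Rpower s (x - 1) * exp (- s)) (at_right 0)
    (Rbar_locally p_infty).
Proof.
move=> Hx.
pose N s := Rpower s x * exp (- s) / x + - (4 / x) * exp (- (/ 2 * s)).
pose m s := Rpower s (x - 1) * exp (- s) - Rpower s x * exp (- s) / x
            + 2 / x * exp (- (/ 2 * s)).
have HN s : 0 < s -> is_derive N s (m s).
  move=> Hs; rewrite /N /m; have Hd := is_derive_Rpower s x Hs.
  auto_derive; first by repeat split; eexists; exact: Hd.
  rewrite (is_derive_unique _ _ _ Hd); field; lra.
have Hf s : 0 < s -> continuous (fun s => Rpower s (x - 1) * exp (- s)) s.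
  move=> Hs; apply: (ex_derive_continuous (fun s => Rpower s (x - 1) * exp (- s))).
  have Hd := is_derive_Rpower s (x - 1) Hs.
  auto_derive; repeat split; by eexists; exact: Hd.
have Hm s : 0 < s -> continuous m s.
  move=> Hs; apply: (ex_derive_continuous m); rewrite /m.
  have Hd := is_derive_Rpower s (x - 1) Hs.
  have Hd' := is_derive_Rpower s x Hs.
  auto_derive; repeat split; by [eexists; exact: Hd | eexists; exact: Hd'].
have Hpx s : 0 < s -> Rpower s x <= 1 + s.
  move=> Hs; case: (Rle_dec 1 s) => H1.
    have : Rpower s x <= Rpower s 1 by apply: Rle_Rpower; lra.
    rewrite Rpower_1 //; lra.
  have : Rpower s x <= Rpower 1 x by apply: Rpower_mono; lra.
  rewrite /Rpower ln_1 Rmult_0_r exp_0; lra.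
apply: (ex_RInt_gen_dominated (V := R_CompleteNormedModule) _ m _ _ (minus 0 (0 - 4 / x))).
- by apply: halfline_eventually.
- apply: halfline_eventually => a b /= Ha Hab; split.
    apply: (ex_RInt_continuous (V := R_CompleteNormedModule)) => s.
    rewrite Rmin_left // => Hs; apply: Hf; lra.
  move=> s Hs; have Hs0 : 0 < s by lra.
  rewrite /norm /= /abs /= Rabs_pos_eq; last first.
    by left; apply: Rmult_lt_0_compat; [exact: Rpower_pos | exact: exp_pos].
  rewrite /m.
  suff : Rpower s x * exp (- s) <= 2 * exp (- (/ 2 * s)).
    move=> H; have := Rmult_le_compat_l (/ x) _ _ (Rlt_le _ _ (Rinv_0_lt_compat x ltac:(lra))) H.
    rewrite /Rdiv; lra.
  have -> : - s = - (/ 2 * s) + - (/ 2 * s) by field.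
  rewrite exp_plus.
  have HE := exp_pos (- (/ 2 * s)).
  have : Rpower s x * exp (- (/ 2 * s)) <= 2.
    have H1 := exp_ineq1_le (/ 2 * s).
    have H2 : exp (/ 2 * s) * exp (- (/ 2 * s)) = 1 by rewrite -exp_plus Rplus_opp_r exp_0.
    have := Hpx s Hs0; nra.
  nra.
- apply: (is_RInt_gen_primitive (V := R_CompleteNormedModule) m N).
  + apply: halfline_eventually => a b /= Ha Hab.
    apply: (is_RInt_derive (V := R_CompleteNormedModule)) => s;
      rewrite Rmin_left // => Hs; [apply: HN | apply: Hm]; lra.
  + have -> : 0 - 4 / x = plus (0 * exp (- 0) / x) (- (4 / x) * exp (- (/ 2 * 0))).
      by rewrite /plus /= Rmult_0_r Ropp_0 exp_0; field; lra.
    apply: (filterlim_comp_2 (F := at_right 0) _ _ plus _ _ (filterlim_plus _ _)).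
      apply: (filterlim_ext (fun s => scal (Rpower s x) (exp (- s) / x))).
        move=> s; rewrite /scal /= /mult /=; field; lra.
      have -> : 0 * exp (-0) / x = scal 0 (exp (- 0) / x).
        rewrite /scal /= /mult /=; field; lra.
      apply: (filterlim_comp_2 (F := at_right 0) _ _ scal _ _ (filterlim_scal _ _)).
        apply: filterlim_Rpower_0; lra.
      apply: filterlim_filter_le_1 (_ : filterlim _ (locally 0) _).
        exact: filter_le_within.
      apply: (ex_derive_continuous (fun s => exp (- s) / x)); auto_derive; lra.
    apply: filterlim_filter_le_1 (_ : filterlim _ (locally 0) _).
      exact: filter_le_within.
    by apply: (ex_derive_continuous (fun s => - (4 / x) * exp (- (/ 2 * s)))); auto_derive.
  + have {1}-> : 0 = plus 0 0 :> R by rewrite /plus /= Rplus_0_r.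
    apply: (filterlim_comp_2 (F := Rbar_locally p_infty) _ _ plus _ _ (filterlim_plus _ _)); last first.
      apply: filterlim_scal_exp_decay; lra.
    apply/filterlim_locally => eps.
    have H4 : 0 < / 2 by lra.
    have := proj1 (filterlim_locally _ _) (filterlim_scal_exp_decay (2 / x) (/ 2) H4) eps.
    move=> [B HB]; exists (Rmax B 0) => s Hs.
    have Hs1 : B < s by have := Rmax_l B 0; lra.
    have Hs0 : 0 < s by have := Rmax_r B 0; lra.
    have := HB s Hs1.
    rewrite /ball /= /AbsRing_ball /abs /minus /plus /opp /= !Ropp_0 !Rplus_0_r.
    have Hxi : 0 < / x by apply: Rinv_0_lt_compat; lra.
    have He := exp_pos (- (/ 2 * s)).
    have He' := exp_pos (- s).
    have Hp := Rpower_pos s x.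
    rewrite !Rabs_pos_eq; last 2 first.
    * apply: Rmult_le_pos; last lra; nra.
    * apply: Rmult_le_pos; [rewrite /Rdiv; nra | lra].
    suff : Rpower s x * exp (- s) / x <= 2 / x * exp (- (/ 2 * s)) by lra.
    have -> : 2 / x * exp (- (/ 2 * s)) = (2 * exp (- (/ 2 * s))) * / x by field; lra.
    rewrite /Rdiv; apply: Rmult_le_compat_r; first lra.
    have -> : - s = - (/ 2 * s) + - (/ 2 * s) by field.
    rewrite exp_plus.
    have : Rpower s x * exp (- (/ 2 * s)) <= 2.
      have H1 := exp_ineq1_le (/ 2 * s).
      have H2 : exp (/ 2 * s) * exp (- (/ 2 * s)) = 1 by rewrite -exp_plus Rplus_opp_r exp_0.
      have := Hpx s Hs0; nra.
    nra.
Qed.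

(** * Powers on the cut plane and complex improper integrals *)
Lemma Cexp_Clog z : 0 < Cmod z + fst z -> Cexp (Clog z) = z.
Proof.
move=> Hp; case: z Hp => X Y /= Hp; rewrite /Clog /Cexp /polar /Re /Im /=.
have Hm : 0 < Cmod (X, Y) by have := fst_le_Cmod (X, Y); have := Rle_abs X; rewrite /=; lra.
have Hmm : Cmod (X, Y) * Cmod (X, Y) = X * X + Y * Y.
  rewrite /Cmod sqrt_sqrt /=; last nra. ring.
rewrite exp_ln //.
move: (Cmod (X, Y)) Hp Hm Hmm => m Hp Hm Hmm.
set t := Y / (m + X).
have Ht : 1 + t² = 2 * m / (m + X).
  rewrite /Rsqr /t; apply: (Rmult_eq_reg_r ((m + X) * (m + X))); last by nra.
  have -> : (1 + Y / (m + X) * (Y / (m + X))) * ((m + X) * (m + X))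
     = (m + X) * (m + X) + (Y * Y) by field; lra.
  have -> : Y * Y = m * m - X * X by lra.
  field; lra.
have Hs : sqrt (1 + t²) * sqrt (1 + t²) = 2 * m / (m + X).
  rewrite sqrt_sqrt //; have := Rle_0_sqr t; lra.
have Hs0 : 0 < sqrt (1 + t²) by apply: sqrt_lt_R0; have := Rle_0_sqr t; lra.
rewrite sin_2a cos_2a_cos cos_atan sin_atan.
congr pair.
  have -> : m * (2 * (1 / sqrt (1 + t²)) * (1 / sqrt (1 + t²)) - 1) =
     m * (2 / (sqrt (1 + t²) * sqrt (1 + t²)) - 1) by field; lra.
  rewrite Hs; field; lra.
have -> : m * (2 * (t / sqrt (1 + t²)) * (1 / sqrt (1 + t²))) =
     m * (2 * t / (sqrt (1 + t²) * sqrt (1 + t²))) by field; lra.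
rewrite Hs /t; field; lra.
Qed.

Definition cut_pow (a : R) (z : C) : C := Cexp (RtoC a * Clog z).

Lemma Cmod_cut_pow a z : Cmod (cut_pow a z) = Rpower (Cmod z) a.
Proof. by rewrite /cut_pow Cmod_Cexp /Rpower /Clog /Re /=; congr exp; ring. Qed.

Lemma cut_pow_shift a z : 0 < Cmod z + fst z -> cut_pow a z = (cut_pow (a - 1) z * z)%C.
Proof.
move=> Hz; rewrite -{3}(Cexp_Clog z Hz) /cut_pow -Cexp_plus; congr Cexp.
rewrite RtoC_minus; ring.
Qed.

Lemma cut_pow_polar a s psi : 0 < s -> - PI < psi < PI ->
  cut_pow a (polar s psi) = polar (Rpower s a) (a * psi).
Proof.
move=> Hs Hpsi; rewrite /cut_pow Clog_polar // /Cexp /Rpower; congr polar.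
  by rewrite /Re /=; congr exp; ring.
by rewrite /Im /=; ring.
Qed.

Lemma derive_C_cut_pow a u p l : is_derive_C u p l -> 0 < Cmod (u p) + fst (u p) ->
  is_derive_C (fun q => cut_pow a (u q)) p (RtoC a * l * cut_pow (a - 1) (u p))%C.
Proof.
move=> Hu Hp.
have Hz : u p <> 0%C.
  by move=> E; move: Hp; rewrite E Cmod_0 /=; lra.
apply: (derive_C_eq _ _ ((0 * Clog (u p) + RtoC a * (l / u p)) * cut_pow a (u p))%C).
  rewrite (cut_pow_shift a) //; field => //.
apply: derive_C_Cexp; apply: derive_C_mult; [exact: derive_C_const | exact: derive_C_Clog].
Qed.

Lemma cos_ge_of_abs_le psi phi : Rabs psi <= phi <= PI -> cos phi <= cos psi.
Proof.
move=> H.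
have -> : cos psi = cos (Rabs psi).
  by rewrite /Rabs; case: Rcase_abs => _ //; rewrite cos_neg.
apply: cos_decr_1; try lra; have := Rabs_pos psi; lra.
Qed.

(** The horizontal half-line issued from [q e^(i psi)], on which [inc_gamma] is an integral:
    it stays in the cut plane, at distance from [0] comparable to [q + x]. *)
Definition shiftp (q psi x : R) : C := (RtoC x + polar q psi)%C.

Lemma shiftp_sq q psi x :
  Cmod (shiftp q psi x) ^ 2 = x ^ 2 + 2 * x * q * cos psi + q ^ 2.
Proof.
rewrite /Cmod pow2_sqrt; last first.
  have := pow2_ge_0 (fst (shiftp q psi x)); have := pow2_ge_0 (snd (shiftp q psi x)); lra.
rewrite /shiftp /polar /=.
have := sin2_cos2 psi; rewrite /Rsqr => E.
have -> : q * (q * 1) = q * q * (sin psi * sin psi + cos psi * cos psi) by rewrite E; ring.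
ring.
Qed.

(** The squared difference of both sides is at least [(1 - cos phi) (q - x)^2 / 2]. *)
Lemma shiftp_bound q psi x phi : 0 <= q -> 0 <= x -> Rabs psi <= phi < PI ->
  cos (phi / 2) * (q + x) <= Cmod (shiftp q psi x).
Proof.
move=> Hq Hx Hpsi.
have Hphi : 0 <= phi by have := Rabs_pos psi; lra.
have Hc := cos_ge_of_abs_le psi phi ltac:(lra).
have Hc2 : cos phi = 2 * cos (phi / 2) * cos (phi / 2) - 1.
  rewrite -cos_2a_cos; congr cos; field.
have Hc1 : cos phi <= 1 by have := COS_bound phi; lra.
apply: Rsqr_incr_0_var; last exact: Cmod_ge_0.
have -> : (Cmod (shiftp q psi x))² = Cmod (shiftp q psi x) ^ 2 by rewrite /Rsqr /=; ring.
rewrite shiftp_sq /Rsqr.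
have : x * q * cos phi <= x * q * cos psi by apply: Rmult_le_compat_l => //; nra.
have : 0 <= (1 - cos phi) * (q - x) ^ 2 by apply: Rmult_le_pos; [lra | apply: pow2_ge_0].
have -> : cos (phi / 2) * (q + x) * (cos (phi / 2) * (q + x)) =
   (cos phi + 1) / 2 * (q + x) ^ 2 by rewrite Hc2; field.
nra.
Qed.

Lemma cos_half_pos phi : 0 <= phi < PI -> 0 < cos (phi / 2).
Proof. by move=> H; apply: cos_gt_0; lra. Qed.

Lemma shiftp_cut q psi x : 0 <= q -> 0 <= x -> 0 < q + x -> Rabs psi < PI ->
  0 < Cmod (shiftp q psi x) + fst (shiftp q psi x).
Proof.
move=> Hq Hx Hqx Hpsi.
have Hc : cos (Rabs psi) = cos psi.
  by rewrite /Rabs; case: Rcase_abs => _ //; rewrite cos_neg.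
have H1 : 0 < 1 + cos psi.
  have E := cos_2a_cos (Rabs psi / 2).
  have := cos_half_pos (Rabs psi) (conj (Rabs_pos _) Hpsi).
  replace (2 * (Rabs psi / 2)) with (Rabs psi) in E by field; nra.
have H2 := shiftp_sq q psi x.
have H3 := Cmod_ge_0 (shiftp q psi x).
have E : fst (shiftp q psi x) = x + q * cos psi by [].
rewrite E.
have [Hq0|Hq0] : q = 0 \/ 0 < q by lra.
  subst q; have : 0 < x by lra.
  nra.
have H4 : q - x <= Cmod (shiftp q psi x).
  case: (Rle_dec (q - x) 0) => Hn; first lra.
  apply: Rsqr_incr_0_var => //; rewrite /Rsqr.
  have -> : Cmod (shiftp q psi x) * Cmod (shiftp q psi x) = Cmod (shiftp q psi x) ^ 2 by ring.
  rewrite H2; have : 0 <= x * q by nra. nra.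
nra.
Qed.

Lemma cut_pow_shiftp_le a q psi x phi : a <= 0 -> 0 <= q -> 0 <= x -> 0 < q + x ->
  Rabs psi <= phi < PI ->
  Cmod (cut_pow a (shiftp q psi x)) <= Rpower (cos (phi / 2) * (q + x)) a.
Proof.
move=> Ha Hq Hx Hqx Hpsi; rewrite Cmod_cut_pow; apply: Rpower_anti => //; split.
  apply: Rmult_lt_0_compat => //; apply: cos_half_pos; have := Rabs_pos psi; lra.
exact: shiftp_bound.
Qed.

Lemma derive_C_shiftp_x q psi x : is_derive_C (fun x => shiftp q psi x) x 1.
Proof.
have -> : RtoC 1 = (RtoC 1 + 0)%C by ring.
apply: derive_C_plus; last exact: derive_C_const.
apply: derive_C_RtoC; exact: is_derive_id.
Qed.

Lemma derive_C_shiftp_q q psi x : is_derive_C (fun q => shiftp q psi x) q (polar 1 psi).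
Proof.
have -> : polar 1 psi = (0 + polar 1 psi)%C by ring.
apply: derive_C_plus; first exact: derive_C_const.
by apply: derive_C_pair; auto_derive.
Qed.

Lemma derive_C_shiftp_psi q psi x : is_derive_C (fun psi => shiftp q psi x) psi (Ci * polar q psi)%C.
Proof.
have -> : (Ci * polar q psi)%C = (0 + ((- (q * sin psi))%R, (q * cos psi)%R))%C.
  by rewrite /polar /Ci /Cmult /Cplus /=; congr pair; ring.
apply: derive_C_plus; first exact: derive_C_const.
by apply: derive_C_pair; auto_derive => //; ring.
Qed.

Definition is_CInt (f : R -> C) (l : C) : Prop :=
  is_RInt_gen (V := R_NormedModule) (fun x => fst (f x)) (at_right 0)
    (Rbar_locally p_infty) (fst l) /\
  is_RInt_gen (V := R_NormedModule) (fun x => snd (f x)) (at_right 0)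
    (Rbar_locally p_infty) (snd l).

Definition CInt (f : R -> C) : C :=
  (RInt_gen (V := R_CompleteNormedModule) (fun x => fst (f x)) (at_right 0)
    (Rbar_locally p_infty),
  RInt_gen (V := R_CompleteNormedModule) (fun x => snd (f x)) (at_right 0)
    (Rbar_locally p_infty)).

Lemma is_RInt_gen_halfline_dominated (g m : R -> R) lm :
  (forall x, 0 < x -> continuous g x) -> (forall x, 0 < x -> Rabs (g x) <= m x) ->
  is_RInt_gen (V := R_NormedModule) m (at_right 0) (Rbar_locally p_infty) lm ->
  is_RInt_gen (V := R_NormedModule) g (at_right 0) (Rbar_locally p_infty)
    (RInt_gen (V := R_CompleteNormedModule) g (at_right 0) (Rbar_locally p_infty)).
Proof.
move=> Hc Hm Hi.
refine (RInt_gen_correct (V := R_CompleteNormedModule) g _).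
refine (ex_RInt_gen_dominated (V := R_CompleteNormedModule) g m _ _ lm _ _ _ _ Hi).
  by apply: halfline_eventually.
apply: halfline_eventually => a b /= Ha Hab; split.
  apply: (ex_RInt_continuous (V := R_CompleteNormedModule)) => s.
  rewrite Rmin_left // => Hs; apply: Hc; lra.
move=> x Hx; apply: Hm; lra.
Qed.

Lemma is_CInt_dominated (f df : R -> C) (m : R -> R) lm :
  (forall x, 0 < x -> is_derive_C f x (df x)) ->
  (forall x, 0 < x -> Cmod (f x) <= m x) ->
  is_RInt_gen (V := R_NormedModule) m (at_right 0) (Rbar_locally p_infty) lm ->
  is_CInt f (CInt f).
Proof.
move=> Hd Hm Hi; split.
  refine (is_RInt_gen_halfline_dominated _ m lm _ _ Hi) => x Hx.
    exact: continuous_of_derive (proj1 (Hd x Hx)).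
  exact: Rle_trans (fst_le_Cmod _) (Hm x Hx).
refine (is_RInt_gen_halfline_dominated _ m lm _ _ Hi) => x Hx.
  exact: continuous_of_derive (proj2 (Hd x Hx)).
exact: Rle_trans (snd_le_Cmod _) (Hm x Hx).
Qed.

Lemma is_CInt_ext f g l : (forall x, 0 < x -> f x = g x) -> is_CInt f l -> is_CInt g l.
Proof.
move=> E [H1 H2]; split; [apply: is_RInt_gen_ext H1 | apply: is_RInt_gen_ext H2];
 apply: halfline_eventually => a b /= Ha Hab x; rewrite Rmin_left // => Hx; rewrite E //; lra.
Qed.

Lemma is_CInt_plus f g k l : is_CInt f k -> is_CInt g l ->
  is_CInt (fun x => f x + g x)%C (k + l)%C.
Proof. by move=> [H1 H2] [H3 H4]; split; apply: is_RInt_gen_plus. Qed.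

Lemma is_CInt_scal c f l : is_CInt f l -> is_CInt (fun x => c * f x)%C (c * l)%C.
Proof.
move=> [H1 H2]; split; rewrite /Cmult /=.
  apply: (is_RInt_gen_minus (V := R_NormedModule)); exact: is_RInt_gen_scal.
apply: (is_RInt_gen_plus (V := R_NormedModule)); exact: is_RInt_gen_scal.
Qed.

Lemma is_CInt_norm f l (m : R -> R) lm : is_CInt f l ->
  (forall x, 0 < x -> Cmod (f x) <= m x) ->
  is_RInt_gen (V := R_NormedModule) m (at_right 0) (Rbar_locally p_infty) lm ->
  Cmod l <= 2 * lm.
Proof.
move=> [H1 H2] Hm Hi; apply: Rle_trans (Cmod_le_sum _) _.
suff : Rabs (fst l) <= lm /\ Rabs (snd l) <= lm by lra.
split; [apply: (RInt_gen_norm (V := R_CompleteNormedModule) _ m _ _ _ _ H1 Hi)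
      | apply: (RInt_gen_norm (V := R_CompleteNormedModule) _ m _ _ _ _ H2 Hi)];
 apply: halfline_eventually => a b /= Ha Hab // x Hx.
  apply: Rle_trans (fst_le_Cmod _) _; apply: Hm; lra.
apply: Rle_trans (snd_le_Cmod _) _; apply: Hm; lra.
Qed.

Lemma is_CInt_unique f k l : is_CInt f k -> is_CInt f l -> k = l.
Proof.
move=> [H1 H2] [H3 H4]; rewrite (surjective_pairing k) (surjective_pairing l).
have E1 := is_RInt_gen_unique (V := R_CompleteNormedModule) _ _ H1.
have E2 := is_RInt_gen_unique (V := R_CompleteNormedModule) _ _ H2.
have E3 := is_RInt_gen_unique (V := R_CompleteNormedModule) _ _ H3.
have E4 := is_RInt_gen_unique (V := R_CompleteNormedModule) _ _ H4.
by rewrite -E1 -E2 -E3 -E4.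
Qed.

(** * The incomplete Gamma function in a sector *)
Definition gamma_integrand (a q psi x : R) : C := (cut_pow a (shiftp q psi x) * RtoC (exp (- x)))%C.

Lemma derive_C_exp_neg x : is_derive_C (fun x => RtoC (exp (- x))) x (- RtoC (exp (- x)))%C.
Proof.
rewrite -RtoC_opp; apply: derive_C_RtoC; auto_derive => //; ring.
Qed.

Lemma derive_C_gamma_integrand_x a q psi x : 0 <= q -> 0 <= x -> 0 < q + x -> Rabs psi < PI ->
  is_derive_C (gamma_integrand a q psi) x (RtoC a * gamma_integrand (a - 1) q psi x - gamma_integrand a q psi x)%C.
Proof.
move=> Hq Hx Hqx Hpsi; rewrite /gamma_integrand.
apply: (derive_C_eq _ _ (RtoC a * 1 * cut_pow (a - 1) (shiftp q psi x) * RtoC (exp (- x)) +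
   cut_pow a (shiftp q psi x) * (- RtoC (exp (- x))))%C); first ring.
apply: derive_C_mult; last exact: derive_C_exp_neg.
apply: derive_C_cut_pow; [exact: derive_C_shiftp_x | exact: shiftp_cut].
Qed.

Lemma derive_C_gamma_integrand_q a q psi x : 0 <= q -> 0 <= x -> 0 < q + x -> Rabs psi < PI ->
  is_derive_C (fun q => gamma_integrand a q psi x) q (RtoC a * polar 1 psi * gamma_integrand (a - 1) q psi x)%C.
Proof.
move=> Hq Hx Hqx Hpsi; rewrite /gamma_integrand.
apply: (derive_C_eq _ _ (RtoC a * polar 1 psi * cut_pow (a - 1) (shiftp q psi x) * RtoC (exp (- x)) +
   cut_pow a (shiftp q psi x) * 0)%C); first ring.
apply: derive_C_mult; last exact: derive_C_const.
apply: (derive_C_cut_pow _ (fun q => shiftp q psi x)); [exact: derive_C_shiftp_q | exact: shiftp_cut].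
Qed.

Lemma derive_C_gamma_integrand_psi a q psi x : 0 <= q -> 0 <= x -> 0 < q + x -> Rabs psi < PI ->
  is_derive_C (fun psi => gamma_integrand a q psi x) psi
    (RtoC a * (Ci * polar q psi) * gamma_integrand (a - 1) q psi x)%C.
Proof.
move=> Hq Hx Hqx Hpsi; rewrite /gamma_integrand.
apply: (derive_C_eq _ _ (RtoC a * (Ci * polar q psi) * cut_pow (a - 1) (shiftp q psi x) * RtoC (exp (- x)) +
   cut_pow a (shiftp q psi x) * 0)%C); first ring.
apply: derive_C_mult; last exact: derive_C_const.
apply: (derive_C_cut_pow _ (fun psi => shiftp q psi x)); [exact: derive_C_shiftp_psi | exact: shiftp_cut].
Qed.

Lemma gamma_integrand_le a q psi x phi : a <= 0 -> 0 <= q -> 0 <= x -> 0 < q + x ->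
  Rabs psi <= phi < PI ->
  Cmod (gamma_integrand a q psi x) <= Rpower (cos (phi / 2) * (q + x)) a * exp (- x).
Proof.
move=> Ha Hq Hx Hqx Hpsi.
rewrite /gamma_integrand Cmod_mult Cmod_R (Rabs_pos_eq (exp _)); last by left; apply: exp_pos.
apply: Rmult_le_compat_r; first by left; apply: exp_pos.
exact: cut_pow_shiftp_le.
Qed.

Lemma gamma_integrand_le_q a q psi x phi : a <= 0 -> 0 < q -> 0 <= x ->
  Rabs psi <= phi < PI ->
  Cmod (gamma_integrand a q psi x) <= Rpower (cos (phi / 2) * q) a * exp (- x).
Proof.
move=> Ha Hq Hx Hpsi.
apply: Rle_trans (gamma_integrand_le _ _ _ _ _ Ha _ Hx _ Hpsi) _; try lra.
apply: Rmult_le_compat_r; first by left; apply: exp_pos.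
have Hc := cos_half_pos phi ltac:(have := Rabs_pos psi; lra).
apply: Rpower_anti => //; nra.
Qed.

Lemma gamma_integrand_le_x a q psi x phi : a <= 0 -> 0 <= q -> 0 < x ->
  Rabs psi <= phi < PI ->
  Cmod (gamma_integrand a q psi x) <= Rpower (cos (phi / 2)) a * (Rpower x a * exp (- x)).
Proof.
move=> Ha Hq Hx Hpsi.
apply: Rle_trans (gamma_integrand_le _ _ _ _ _ Ha Hq _ _ Hpsi) _; try lra.
have Hc := cos_half_pos phi ltac:(have := Rabs_pos psi; lra).
rewrite -Rmult_assoc Rpower_mult_distr //.
apply: Rmult_le_compat_r; first by left; apply: exp_pos.
apply: Rpower_anti => //; nra.
Qed.

(** The integral of [(z + x)^(-alpha) e^(-x)] over [x > 0], where [z = q e^(i psi)]; this is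
    [e^z Gamma(1 - alpha, z)]. *)
Definition inc_gamma (alpha q psi : R) : C := CInt (gamma_integrand (- alpha) q psi).

Lemma is_CInt_gamma_integrand a q psi : a <= 0 -> 0 < q -> Rabs psi < PI ->
  is_CInt (gamma_integrand a q psi) (CInt (gamma_integrand a q psi)).
Proof.
move=> Ha Hq Hpsi.
apply: (is_CInt_dominated _ _ _ _ _ _
  (is_RInt_gen_exp (Rpower (cos (Rabs psi / 2) * q) a))) => x Hx.
  apply: derive_C_gamma_integrand_x => //; lra.
apply: gamma_integrand_le_q => //; lra.
Qed.

Lemma inc_gamma_le_q alpha q psi phi : 0 < alpha -> 0 < q -> Rabs psi <= phi < PI ->
  Cmod (inc_gamma alpha q psi) <= 2 * Rpower (cos (phi / 2) * q) (- alpha).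
Proof.
move=> Ha Hq Hpsi.
apply: is_CInt_norm (is_RInt_gen_exp _).
  apply: is_CInt_gamma_integrand; lra.
move=> x Hx; apply: gamma_integrand_le_q; lra.
Qed.

Lemma is_RInt_gen_Gamma alpha : 0 < alpha < 1 ->
  is_RInt_gen (V := R_NormedModule) (fun x => Rpower x (- alpha) * exp (- x)) (at_right 0)
    (Rbar_locally p_infty) (Gamma (1 - alpha)).
Proof.
move=> Ha.
refine (is_RInt_gen_ext (V := R_NormedModule) _ _ _ _
  (RInt_gen_correct (V := R_CompleteNormedModule)
    (fun s => Rpower s (1 - alpha - 1) * exp (- s)) _)).
  apply: filter_forall => ab x _.
  by congr (Rpower x _ * _); ring.
apply: ex_RInt_gen_Gamma; lra.
Qed.

(** As [ln x <= x], the integrand is at least [e^(-2 x)]. *)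
Lemma Gamma_pos alpha : 0 < alpha < 1 -> 0 < Gamma (1 - alpha).
Proof.
move=> Ha.
have H0 : is_RInt_gen (V := R_NormedModule) (fun x => 1 * exp (- (2 * x))) (at_right 0)
    (Rbar_locally p_infty) (1 / 2) by apply: is_RInt_gen_exp_halfline; lra.
suff H : norm (1 / 2 : R_NormedModule) <= Gamma (1 - alpha).
  move: H; rewrite /norm /= /abs /= Rabs_pos_eq; lra.
refine (RInt_gen_norm (V := R_CompleteNormedModule) (fun x => 1 * exp (- (2 * x)))
     (fun x => Rpower x (- alpha) * exp (- x)) _ _ _ _ H0 (is_RInt_gen_Gamma alpha Ha)).
  by apply: halfline_eventually.
apply: halfline_eventually => a b /= Hap Hab x Hx.
rewrite Rmult_1_l /norm /= /abs /= Rabs_pos_eq; last by left; exact: exp_pos.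
rewrite /Rpower -exp_plus; apply: exp_le.
have : ln x <= x by have := exp_ineq1_le (ln x); rewrite exp_ln; lra.
nra.
Qed.

Lemma inc_gamma_le alpha q psi phi : 0 < alpha < 1 -> 0 < q -> Rabs psi <= phi < PI ->
  Cmod (inc_gamma alpha q psi) <=
    2 * (Rpower (cos (phi / 2)) (- alpha) * Gamma (1 - alpha)).
Proof.
move=> Ha Hq Hpsi.
apply: is_CInt_norm (is_RInt_gen_scal (V := R_NormedModule) _ _ _ (is_RInt_gen_Gamma alpha Ha)).
  apply: is_CInt_gamma_integrand; lra.
move=> x Hx; apply: gamma_integrand_le_x; lra.
Qed.

Lemma derive_C_quad (f : R -> C) (p : R) (l : C) (K d : R) : 0 < d ->
  (forall h, Rabs h < d -> Cmod (f (p + h)%R - f p - RtoC h * l)%C <= K * h ^ 2) ->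
  is_derive_C f p l.
Proof.
move=> Hd H; split; apply: (is_derive_quad (V := R_CompleteNormedModule) _ _ _ K d Hd) => q Hq.
  have {1}-> : q = p + (q - p) by ring.
  apply: Rle_trans (H (q - p) Hq).
  apply: Rle_trans (fst_le_Cmod _); right; congr Rabs.
  rewrite /minus /plus /opp /scal /= /mult /=; ring.
have {1}-> : q = p + (q - p) by ring.
apply: Rle_trans (H (q - p) Hq).
apply: Rle_trans (snd_le_Cmod _); right; congr Rabs.
rewrite /minus /plus /opp /scal /= /mult /=; ring.
Qed.

(** The integrand is the derivative of [(z + x)^(-alpha) e^(-x)]. *)
Lemma is_CInt_gamma_integrand_parts alpha q psi : 0 < alpha -> 0 < q -> Rabs psi < PI ->
  is_CInt (fun x => RtoC (- alpha) * gamma_integrand (- alpha - 1) q psi x - gamma_integrand (- alpha) q psi x)%C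
    (- cut_pow (- alpha) (polar q psi))%C.
Proof.
move=> Ha Hq Hpsi.
have Hlim : filterlim (fun x => Rpower (cos (Rabs psi / 2) * q) (- alpha) * exp (- x))
   (Rbar_locally p_infty) (locally 0).
  apply: (filterlim_ext (fun x => Rpower (cos (Rabs psi / 2) * q) (- alpha) * exp (- (1 * x)))).
    by move=> x; rewrite Rmult_1_l.
  apply: filterlim_scal_exp_decay; lra.
have Hk0 : gamma_integrand (- alpha) q psi 0 = cut_pow (- alpha) (polar q psi).
  by rewrite /gamma_integrand Ropp_0 exp_0 Cmult_1_r /shiftp Cplus_0_l.
have HD x : 0 <= x -> is_derive_C (gamma_integrand (- alpha) q psi) x
   (RtoC (- alpha) * gamma_integrand (- alpha - 1) q psi x - gamma_integrand (- alpha) q psi x)%C.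
  move=> Hx; apply: derive_C_gamma_integrand_x => //; lra.
have HDD x : 0 <= x -> exists l, is_derive_C (fun x => RtoC (- alpha) * gamma_integrand (- alpha - 1) q psi x - gamma_integrand (- alpha) q psi x)%C x l.
  move=> Hx; eexists.
  apply: derive_C_plus.
    apply: derive_C_mult; first exact: derive_C_const.
    apply: derive_C_gamma_integrand_x => //; lra.
  apply: (derive_C_ext (fun x => RtoC (-1) * gamma_integrand (- alpha) q psi x)%C).
    by move=> y; rewrite (RtoC_opp 1) /Cminus; ring.
  apply: derive_C_mult; [exact: derive_C_const | exact: HD].
have main (pr : C -> R) : (forall z, Rabs (pr z) <= Cmod z) ->
    (forall f x l, is_derive_C f x l -> is_derive (fun x => pr (f x)) x (pr l)) ->
  is_RInt_gen (V := R_NormedModule) (fun x => pr (RtoC (- alpha) *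
      gamma_integrand (- alpha - 1) q psi x - gamma_integrand (- alpha) q psi x)%C)
    (at_right 0) (Rbar_locally p_infty) (minus 0 (pr (cut_pow (- alpha) (polar q psi)))).
  move=> Hpr Hprd; rewrite -Hk0.
  apply: (is_RInt_gen_primitive (V := R_CompleteNormedModule) _
    (fun x => pr (gamma_integrand (- alpha) q psi x))).
  - apply: halfline_eventually => a b /= H0 Hab.
    apply: (is_RInt_derive (V := R_CompleteNormedModule)
      (fun x => pr (gamma_integrand (- alpha) q psi x))) => s; rewrite Rmin_left // => Hs.
      apply: Hprd; apply: HD; lra.
    have [l Hl] := HDD s ltac:(lra); exact: continuous_of_derive (Hprd _ _ _ Hl).
  - apply: filterlim_filter_le_1 (_ : filterlim _ (locally 0) _).
      exact: filter_le_within.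
    apply: continuous_of_derive (Hprd _ _ _ (HD 0 _)); lra.
  - apply/filterlim_locally => eps.
    have [B HB] := proj1 (filterlim_locally _ _) Hlim eps.
    exists (Rmax B 0) => x Hx.
    have HxB : B < x by have := Rmax_l B 0; lra.
    have Hx0 : 0 < x by have := Rmax_r B 0; lra.
    have := HB x HxB.
    rewrite /ball /= /AbsRing_ball /abs /minus /plus /opp /= !Ropp_0 !Rplus_0_r.
    apply: Rle_lt_trans; apply: Rle_trans (Hpr _) _.
    apply: Rle_trans (Rle_abs _).
    apply: gamma_integrand_le_q; lra.
split.
  have -> : fst (- cut_pow (- alpha) (polar q psi))%C =
     minus 0 (fst (cut_pow (- alpha) (polar q psi))) by rewrite /minus /plus /opp /=; ring.
  by apply: main => //; [exact: fst_le_Cmod | move=> f x l []].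
have -> : snd (- cut_pow (- alpha) (polar q psi))%C =
   minus 0 (snd (cut_pow (- alpha) (polar q psi))) by rewrite /minus /plus /opp /=; ring.
by apply: main => //; [exact: snd_le_Cmod | move=> f x l []].
Qed.

(** This is [b' = b - z^(-alpha)] along the ray of argument [psi]: differentiation under the
    integral, then integration by parts. *)
Lemma derive_C_inc_gamma alpha q psi : 0 < alpha -> 0 < q -> Rabs psi < PI ->
  is_derive_C (fun q => inc_gamma alpha q psi) q
    (polar 1 psi * (inc_gamma alpha q psi - cut_pow (- alpha) (polar q psi)))%C.
Proof.
move=> Ha Hq Hpsi.
have I0 q' : 0 < q' -> is_CInt (gamma_integrand (- alpha) q' psi) (inc_gamma alpha q' psi).
  move=> Hq'; apply: is_CInt_gamma_integrand; lra.
have I1 := is_CInt_gamma_integrand (- alpha - 1) q psi ltac:(lra) Hq Hpsi.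
have E : (inc_gamma alpha q psi - cut_pow (- alpha) (polar q psi))%C =
   (RtoC (- alpha) * CInt (gamma_integrand (- alpha - 1) q psi))%C.
  apply: is_CInt_unique (is_CInt_scal _ _ _ I1).
  apply: is_CInt_ext (is_CInt_plus _ _ _ _ (I0 q Hq) (is_CInt_gamma_integrand_parts alpha q psi Ha Hq Hpsi)).
  move=> x Hx /=; ring.
rewrite E.
pose c := (RtoC (- alpha) * polar 1 psi * (RtoC (- alpha - 1) * polar 1 psi))%C.
pose K := Cmod c * Rpower (cos (Rabs psi / 2) * (q / 2)) (- alpha - 2).
apply: (derive_C_quad _ _ _ (4 * K) (q / 2)); first lra.
move=> h /Rabs_def2 Hh.
have -> : 4 * K * h ^ 2 = 2 * (2 * K * h ^ 2) by ring.
apply: (is_CInt_norm (fun x => gamma_integrand (- alpha) (q + h) psi x - gamma_integrand (- alpha) q psi x -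
    RtoC h * (RtoC (- alpha) * polar 1 psi * gamma_integrand (- alpha - 1) q psi x))%C _
    (fun x => (2 * K * h ^ 2) * exp (- x))).
- apply: (is_CInt_ext (fun x => gamma_integrand (- alpha) (q + h) psi x + RtoC (-1) * gamma_integrand (- alpha) q psi x
     + RtoC (- 1) * RtoC h * RtoC (- alpha) * polar 1 psi * gamma_integrand (- alpha - 1) q psi x)%C).
    by move=> x Hx; rewrite (RtoC_opp 1); ring.
  have -> : (inc_gamma alpha (q + h) psi - inc_gamma alpha q psi -
      RtoC h * (polar 1 psi * (RtoC (- alpha) * CInt (gamma_integrand (- alpha - 1) q psi))))%C =
      (inc_gamma alpha (q + h) psi + RtoC (-1) * inc_gamma alpha q psi +
       RtoC (-1) * RtoC h * RtoC (- alpha) * polar 1 psi * CInt (gamma_integrand (- alpha - 1) q psi))%C.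
    by rewrite (RtoC_opp 1); ring.
  apply: is_CInt_plus; last exact: is_CInt_scal.
  apply: is_CInt_plus; first by apply: I0; lra.
  apply: is_CInt_scal; exact: I0.
- move=> x Hx.
  have -> : 2 * K * h ^ 2 * exp (- x) = 2 * (K * exp (- x)) * ((q + h) - q) ^ 2 by ring.
  have {2}-> : h = (q + h) - q by ring.
  apply: (C_taylor (fun q => gamma_integrand (- alpha) q psi x)
    (fun q => RtoC (- alpha) * polar 1 psi * gamma_integrand (- alpha - 1) q psi x)%C
    (fun q => c * gamma_integrand (- alpha - 2) q psi x)%C) => y Hy.
  have Hy' : q / 2 <= y.
    by move: Hy; rewrite /Rmin; case: Rle_dec; lra.
  split; first by apply: derive_C_gamma_integrand_q => //; lra.
  split.
    apply: (derive_C_eq _ _ (0 * gamma_integrand (- alpha - 1) y psi x + RtoC (- alpha) * polar 1 psi *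
      (RtoC (- alpha - 1) * polar 1 psi * gamma_integrand (- alpha - 1 - 1) y psi x))%C).
      have -> : - alpha - 1 - 1 = - alpha - 2 by ring.
      rewrite /c; ring.
    apply: derive_C_mult; first exact: derive_C_const.
    apply: derive_C_gamma_integrand_q => //; lra.
  rewrite Cmod_mult /K Rmult_assoc; apply: Rmult_le_compat_l; first exact: Cmod_ge_0.
  apply: Rle_trans (gamma_integrand_le_q _ y psi x (Rabs psi) _ _ _ _) _; try lra.
  apply: Rmult_le_compat_r; first by left; apply: exp_pos.
  have Hc := cos_half_pos (Rabs psi) ltac:(have := Rabs_pos psi; lra).
  apply: Rpower_anti; last lra; nra.
- exact: is_RInt_gen_exp.
Qed.

Lemma inc_gamma_lip_psi alpha q phi : 0 < alpha -> 0 < q -> 0 <= phi < PI ->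
  exists K, forall psi psi', Rabs psi <= phi -> Rabs psi' <= phi ->
    Cmod (inc_gamma alpha q psi' - inc_gamma alpha q psi)%C <= K * Rabs (psi' - psi).
Proof.
move=> Ha Hq Hphi.
pose K := alpha * q * Rpower (cos (phi / 2) * q) (- alpha - 1).
exists (2 * (2 * K)) => psi psi' Hpsi Hpsi'.
have -> : 2 * (2 * K) * Rabs (psi' - psi) = 2 * (2 * K * Rabs (psi' - psi)) by ring.
apply: (is_CInt_norm (fun x => gamma_integrand (- alpha) q psi' x + RtoC (-1) * gamma_integrand (- alpha) q psi x)%C
   _ (fun x => (2 * K * Rabs (psi' - psi)) * exp (- x))).
- have -> : (inc_gamma alpha q psi' - inc_gamma alpha q psi)%C =
     (inc_gamma alpha q psi' + RtoC (-1) * inc_gamma alpha q psi)%C by rewrite (RtoC_opp 1); ring.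
  apply: is_CInt_plus; first by apply: is_CInt_gamma_integrand; lra.
  apply: is_CInt_scal; apply: is_CInt_gamma_integrand; lra.
- move=> x Hx.
  have -> : (gamma_integrand (- alpha) q psi' x + RtoC (-1) * gamma_integrand (- alpha) q psi x)%C =
     (gamma_integrand (- alpha) q psi' x - gamma_integrand (- alpha) q psi x)%C by rewrite (RtoC_opp 1); ring.
  have -> : 2 * K * Rabs (psi' - psi) * exp (- x) = 2 * (K * exp (- x)) * Rabs (psi' - psi) by ring.
  apply: (C_mean_value (fun psi => gamma_integrand (- alpha) q psi x)
    (fun psi => RtoC (- alpha) * (Ci * polar q psi) * gamma_integrand (- alpha - 1) q psi x)%C) => y Hy.
  have Hy' : Rabs y <= phi.
    move: Hpsi Hpsi' => /Rabs_le_between H1 /Rabs_le_between H2; apply/Rabs_le_between.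
    by move: Hy; rewrite /Rmin /Rmax; case: Rle_dec; lra.
  split; first by apply: derive_C_gamma_integrand_psi; lra.
  rewrite Cmod_mult (Cmod_mult (RtoC _)) (Cmod_mult Ci) Cmod_polar; last lra.
  rewrite Cmod_R Rabs_Ropp (Rabs_pos_eq alpha); last lra.
  have -> : Cmod Ci = 1.
    rewrite /Cmod /Ci /=; have -> : 0 * (0 * 1) + 1 * (1 * 1) = 1 by ring. exact: sqrt_1.
  have -> : alpha * (1 * q) = alpha * q by ring.
  rewrite /K (Rmult_assoc (alpha * q)); apply: Rmult_le_compat_l; first nra.
  apply: gamma_integrand_le_q; lra.
- exact: is_RInt_gen_exp.
Qed.

(** The integrands at [z] and at [0] differ by [O(x^(-alpha) min(1, |z| / x))]; the minimum
    is bounded by [(|z| / x)^((1 - alpha) / 2)], which keeps the integral convergent at [0]. *)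
Lemma inc_gamma_lim alpha phi : 0 < alpha < 1 -> 0 <= phi < PI ->
  exists K, 0 <= K /\ forall q psi, 0 < q -> Rabs psi <= phi ->
    Cmod (inc_gamma alpha q psi - RtoC (Gamma (1 - alpha)))%C <= K * Rpower q ((1 - alpha) / 2).
Proof.
move=> Ha Hphi.
set ka := (1 - alpha) / 2.
have Hc := cos_half_pos phi Hphi.
have Hc1 : cos (phi / 2) <= 1 by have := COS_bound (phi / 2); lra.
pose c := Rpower (cos (phi / 2)) (- alpha - 1).
have Hcp : 0 < c by exact: Rpower_pos.
have Hcc : Rpower (cos (phi / 2)) (- alpha) <= c.
  rewrite /c /Rpower; apply: exp_le.
  have : ln (cos (phi / 2)) <= 0 by rewrite -ln_1; apply: ln_le.
  nra.
have HG := is_RInt_gen_Gamma (alpha + ka) ltac:(rewrite /ka; lra).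
have HG0 : 0 <= Gamma (1 - (alpha + ka)).
  have H0 : is_RInt_gen (V := R_NormedModule) (fun x => 0 * exp (- x)) (at_right 0)
    (Rbar_locally p_infty) 0 by exact: is_RInt_gen_exp.
  refine (Rle_trans _ _ _ (norm_ge_0 (V := R_NormedModule) 0)
    (RInt_gen_norm (V := R_CompleteNormedModule) (fun x => 0 * exp (- x))
     (fun x => Rpower x (- (alpha + ka)) * exp (- x)) 0 _ _ _ H0 HG)).
    by apply: halfline_eventually.
  apply: halfline_eventually => a b /= Hap Hab x Hx.
  rewrite Rmult_0_l norm_zero; apply: Rmult_le_pos; left; [exact: Rpower_pos | exact: exp_pos].
exists (2 * (2 * c * Gamma (1 - (alpha + ka)))); split; first nra.
move=> q psi Hq Hpsi.
have -> : 2 * (2 * c * Gamma (1 - (alpha + ka))) * Rpower q ka =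
   2 * scal (2 * c * Rpower q ka) (Gamma (1 - (alpha + ka))).
  rewrite /scal /= /mult /=; ring.
apply: (is_CInt_norm (fun x => gamma_integrand (- alpha) q psi x +
   RtoC (-1) * RtoC (Rpower x (- alpha) * exp (- x)))%C _ _ _ _ _
   (is_RInt_gen_scal (V := R_NormedModule) _ _ _ HG)).
  have -> : (inc_gamma alpha q psi - RtoC (Gamma (1 - alpha)))%C =
     (inc_gamma alpha q psi + RtoC (-1) * RtoC (Gamma (1 - alpha)))%C by rewrite (RtoC_opp 1); ring.
  apply: is_CInt_plus; first by apply: is_CInt_gamma_integrand; lra.
  apply: is_CInt_scal; split=> /=; first exact: is_RInt_gen_Gamma.
  apply: is_RInt_gen_ext (is_RInt_gen_exp 0).
  by apply: filter_forall => ab x _; rewrite Rmult_0_l.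
move=> x Hx.
have Hk0 : RtoC (Rpower x (- alpha) * exp (- x)) = gamma_integrand (- alpha) 0 psi x.
  rewrite /gamma_integrand RtoC_mult; congr Cmult.
  have -> : shiftp 0 psi x = polar x 0.
    by rewrite /shiftp /polar /Cplus /= cos_0 sin_0; congr pair; ring.
  rewrite cut_pow_polar //; last by have := PI_RGT_0; lra.
  by rewrite Rmult_0_r /polar cos_0 sin_0 /RtoC; congr pair; ring.
rewrite Hk0.
have -> : (gamma_integrand (- alpha) q psi x + RtoC (-1) * gamma_integrand (- alpha) 0 psi x)%C =
   (gamma_integrand (- alpha) q psi x - gamma_integrand (- alpha) 0 psi x)%C by rewrite (RtoC_opp 1); ring.
have Hxq : Rpower q ka * Rpower x (- (alpha + ka)) = Rpower (q / x) ka * Rpower x (- alpha).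
  rewrite /Rdiv -Rpower_mult_distr //; last exact: Rinv_0_lt_compat.
  have -> : Rpower (/ x) ka = Rpower x (- ka).
    by rewrite /Rpower ln_Rinv //; congr exp; ring.
  rewrite Rmult_assoc -Rpower_plus; congr (_ * Rpower x _); ring.
have -> : scal (2 * c * Rpower q ka) (Rpower x (- (alpha + ka)) * exp (- x)) =
   2 * c * (Rpower (q / x) ka) * (Rpower x (- alpha) * exp (- x)).
  rewrite /scal /= /mult /=.
  have -> : 2 * c * Rpower q ka * (Rpower x (- (alpha + ka)) * exp (- x)) =
   2 * c * (Rpower q ka * Rpower x (- (alpha + ka))) * exp (- x) by ring.
  rewrite Hxq; ring.
have Hxa := Rpower_pos x (- alpha).
have Hex := exp_pos (- x).
have Hxe : 0 < Rpower x (- alpha) * exp (- x) by nra.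
have Hka : 0 < ka < 1 by rewrite /ka; lra.
case: (Rle_dec x q) => Hqx.
  have H1 : 1 <= Rpower (q / x) ka.
    have {1}-> : 1 = Rpower 1 ka by rewrite /Rpower ln_1 Rmult_0_r exp_0.
    apply: Rpower_mono; last lra; split; first lra.
    apply/Rle_div_r => //; lra.
  apply: Rle_trans (Cmod_triangle _ _) _; rewrite Cmod_opp.
  have := gamma_integrand_le_x (- alpha) q psi x phi ltac:(lra) ltac:(lra) Hx ltac:(lra).
  have := gamma_integrand_le_x (- alpha) 0 psi x phi ltac:(lra) ltac:(lra) Hx ltac:(lra).
  move: (Rpower x (- alpha) * exp (- x)) Hxe => T HT.
  have H2 := Rmult_le_compat_r T _ _ (Rlt_le _ _ HT) Hcc.
  have H3 : 0 < c * T by exact: Rmult_lt_0_compat.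
  have H4 := Rmult_le_compat_l (c * T) _ _ (Rlt_le _ _ H3) H1.
  lra.
have H1 : q / x <= Rpower (q / x) ka.
  have Hqx0 : 0 < q / x by apply: Rdiv_lt_0_compat.
  have Hqx1 : q / x < 1 by apply/Rlt_div_l; lra.
  have {1}-> : q / x = Rpower (q / x) 1 by rewrite Rpower_1.
  rewrite /Rpower; apply: exp_le.
  have : ln (q / x) <= 0 by rewrite -ln_1; apply: ln_le; lra.
  nra.
apply: Rle_trans (_ : 2 * (c * (Rpower x (- alpha - 1) * exp (- x))) * Rabs (q - 0) <= _).
  apply: (C_mean_value (fun q => gamma_integrand (- alpha) q psi x)
    (fun q => RtoC (- alpha) * polar 1 psi * gamma_integrand (- alpha - 1) q psi x)%C) => y.
  rewrite Rmin_left ?Rmax_right; try lra; move=> Hy.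
  split; first by apply: derive_C_gamma_integrand_q; lra.
  rewrite Cmod_mult (Cmod_mult (RtoC _)) Cmod_polar; last lra.
  rewrite Cmod_R Rabs_Ropp (Rabs_pos_eq alpha); last lra.
  have H2 := gamma_integrand_le_x (- alpha - 1) y psi x phi ltac:(lra) ltac:(lra) Hx ltac:(lra).
  have H3 := Cmod_ge_0 (gamma_integrand (- alpha - 1) y psi x).
  rewrite -/c in H2; nra.
rewrite Rminus_0_r Rabs_pos_eq; last lra.
have -> : Rpower x (- alpha - 1) = Rpower x (- alpha) / x.
  rewrite /Rminus Rpower_plus (Rpower_Ropp x 1) Rpower_1 //.
have -> : 2 * (c * (Rpower x (- alpha) / x * exp (- x))) * q =
   2 * c * (q / x) * (Rpower x (- alpha) * exp (- x)) by field; lra.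
apply: Rmult_le_compat_r; first lra.
nra.
Qed.

(** * The sector and the resolvent *)
Lemma not_in_sectorP mu theta w : 0 < theta < PI / 2 ->
  ~ in_sector mu theta w <->
  w <> RtoC mu /\ mu - Re w <= cos theta * Cmod (w - mu)%C.
Proof.
move=> Hth; rewrite /in_sector /Carg.
have Em : Cmod (- (w - mu))%C = Cmod (w - mu)%C by rewrite Cmod_opp.
have Er : Re (- (w - mu))%C = mu - Re w by rewrite /Re /=; ring.
case: Ceq_dec => [E|E].
  have -> : w = RtoC mu.
    have -> : w = (RtoC mu + - - (w - mu))%C by ring.
    rewrite E; ring.
  rewrite Rabs_R0; split; [lra | by case].
have Hw : w <> RtoC mu by move=> Hw; apply: E; rewrite Hw; ring.
have Hp : 0 < Cmod (w - mu)%C by rewrite -Em; apply/Cmod_gt_0.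
suff H : ~ acos (Re (- (w - mu))%C / Cmod (- (w - mu))%C) < theta <->
    w <> RtoC mu /\ mu - Re w <= cos theta * Cmod (w - mu)%C.
  case: Rle_dec => _; rewrite ?Rabs_Ropp Rabs_pos_eq //; exact: (proj1 (acos_bound _)).
rewrite Em Er.
have Hv : -1 <= (mu - Re w) / Cmod (w - mu)%C <= 1.
  have := fst_le_Cmod (- (w - mu))%C; rewrite -/(Re _) Er Em => /Rabs_le_between H.
  split; [apply/Rle_div_r => //; lra | apply/Rle_div_l => //; lra].
have Hb := acos_bound ((mu - Re w) / Cmod (w - mu)%C).
have Hc := cos_acos _ Hv.
split=> [H|[_ H] Hlt].
  split=> //; apply: (Rmult_le_reg_r (/ Cmod (w - mu)%C)); first exact: Rinv_0_lt_compat.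
  have -> : cos theta * Cmod (w - mu)%C * / Cmod (w - mu)%C = cos theta by field; lra.
  rewrite -/(Rdiv _ _) -Hc; apply: cos_decr_1; lra.
have : cos theta < (mu - Re w) / Cmod (w - mu)%C.
  rewrite -Hc; apply: cos_decreasing_1; lra.
move/(Rmult_lt_compat_r _ _ _ Hp).
have -> : (mu - Re w) / Cmod (w - mu)%C * Cmod (w - mu)%C = mu - Re w by field; lra.
lra.
Qed.

(** The complement of the sector, in Cartesian coordinates and without [Carg]; here [k] is
    the cosine of the half-angle. *)
Definition off_sector (k mu x y : R) : Prop :=
  (x <> mu \/ y <> 0) /\ mu - x <= k * sqrt ((mu - x) ^ 2 + y ^ 2).

Lemma off_sectorP mu theta s psi : 0 < theta < PI / 2 ->
  ~ in_sector mu theta (polar s psi) <->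
  off_sector (cos theta) mu (s * cos psi) (s * sin psi).
Proof.
move=> Hth; rewrite not_in_sectorP // /off_sector.
have -> : Cmod (polar s psi - mu)%C =
  sqrt ((mu - s * cos psi) ^ 2 + (s * sin psi) ^ 2).
  rewrite /Cmod /polar /=; congr sqrt; ring.
rewrite /Re /=; split=> -[H1 H2]; split=> //.
  case: (Req_dec (s * cos psi) mu) => E1; last by left.
  case: (Req_dec (s * sin psi) 0) => E2; last by right.
  by case: H1; rewrite /polar E1 E2.
by move=> [E1 E2]; case: H1; rewrite ?E1 ?E2.
Qed.

Lemma off_sector_opp k mu x y : off_sector k mu x y -> off_sector k mu x (- y).
Proof.
move=> [H1 H2]; split; first by case: H1; [left | right; lra].
by have -> : (- y) ^ 2 = y ^ 2 by ring.
Qed.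

Lemma off_sector_right k mu x x' y : 0 < k < 1 -> x <= x' ->
  off_sector k mu x y -> off_sector k mu x' y.
Proof.
move=> Hk Hx [H1 H2].
have Hs t : 0 <= k * sqrt ((mu - t) ^ 2 + y ^ 2).
  apply: Rmult_le_pos; [lra | exact: sqrt_pos].
have Hsq t : sqrt ((mu - t) ^ 2 + y ^ 2) * sqrt ((mu - t) ^ 2 + y ^ 2) = (mu - t) ^ 2 + y ^ 2.
  by apply: sqrt_sqrt; have := pow2_ge_0 (mu - t); have := pow2_ge_0 y; lra.
case: (Rlt_dec (mu - x') 0) => Hn.
  by split; [left; lra | have := Hs x'; lra].
have H3 : (mu - x) ^ 2 <= k ^ 2 * ((mu - x) ^ 2 + y ^ 2).
  rewrite -Hsq; have := Hs x; move: H2 (Hsq x); move: (sqrt _) => m H2 Hm Hm0.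
  have -> : k ^ 2 * (m * m) = (k * m) ^ 2 by ring.
  apply: pow_incr; lra.
have H4 : (mu - x') ^ 2 <= (mu - x) ^ 2 by apply: pow_incr; lra.
have Hk2 : 0 < 1 - k ^ 2 by nra.
have H5 : (mu - x') ^ 2 <= k ^ 2 * ((mu - x') ^ 2 + y ^ 2).
  have := Rmult_le_compat_l (1 - k ^ 2) _ _ (Rlt_le _ _ Hk2) H4. nra.
split.
  case: (Req_dec y 0) => Hy; last by right.
  left=> E; case: H1 => // H1; apply: H1.
  have : (mu - x) ^ 2 * (1 - k ^ 2) <= 0 by rewrite Hy in H3; nra.
  have := pow2_ge_0 (mu - x) => H6 H7.
  have : (mu - x) ^ 2 = 0 by nra.
  nra.
apply: Rsqr_incr_0_var; last exact: Hs.
rewrite /Rsqr.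
have -> : k * sqrt ((mu - x') ^ 2 + y ^ 2) * (k * sqrt ((mu - x') ^ 2 + y ^ 2)) =
  k ^ 2 * (sqrt ((mu - x') ^ 2 + y ^ 2) * sqrt ((mu - x') ^ 2 + y ^ 2)) by ring.
rewrite Hsq; simpl in *; lra.
Qed.

(** If the image [rho e^(i eta)] of a point to the right of the path has ordinate at least
    [rho0 sin eta0], then the horizontal line through it meets the boundary ray to its left,
    otherwise it meets the boundary arc. *)
Lemma off_sector_region k mu rho0 eta0 : 0 < k < 1 -> 0 < rho0 -> 0 < eta0 < PI ->
  (forall rho, rho0 <= rho -> off_sector k mu (rho * cos eta0) (rho * sin eta0)) ->
  (forall eta, - eta0 <= eta <= eta0 ->
     off_sector k mu (rho0 * cos eta) (rho0 * sin eta)) ->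
  forall rho eta, rho0 <= rho -> Rabs eta <= eta0 ->
     off_sector k mu (rho * cos eta) (rho * sin eta).
Proof.
move=> Hk Hr He Hray Harc.
suff H : forall rho eta, rho0 <= rho -> 0 <= eta <= eta0 ->
     off_sector k mu (rho * cos eta) (rho * sin eta).
  move=> rho eta Hrho /Rabs_le_between Heta.
  case: (Rle_dec 0 eta) => H0; first by apply: H; lra.
  have := off_sector_opp _ _ _ _ (H rho (- eta) Hrho ltac:(lra)).
  by rewrite cos_neg sin_neg; have -> : - (rho * - sin eta) = rho * sin eta by ring.
move=> rho eta Hrho Heta.
have Hs0 : 0 < sin eta0 by apply: sin_gt_0; lra.
have Hs : 0 <= sin eta by apply: sin_ge_0; lra.
have Hd : 0 <= sin (eta0 - eta) by apply: sin_ge_0; lra.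
rewrite sin_minus in Hd.
(* high points: move left to the ray of angle [eta0] *)
case: (Rle_dec (rho0 * sin eta0) (rho * sin eta)) => Hy.
  apply: (off_sector_right _ _ (rho * sin eta / sin eta0 * cos eta0)) => //.
    have -> : rho * cos eta = rho * (cos eta * sin eta0) / sin eta0 by field; lra.
    have -> : rho * sin eta / sin eta0 * cos eta0 = rho * (sin eta * cos eta0) / sin eta0 by field; lra.
    apply: Rmult_le_compat_r; first by left; apply: Rinv_0_lt_compat.
    apply: Rmult_le_compat_l; lra.
  have {2}-> : rho * sin eta = rho * sin eta / sin eta0 * sin eta0 by field; lra.
  apply: Hray; apply/Rle_div_r => //.
case: (Rle_dec eta (PI / 2)) => Hh; last first.
  exfalso; apply: Hy.
  have H1 : sin eta0 <= sin eta by apply: sin_decr_1; lra.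
  apply: Rmult_le_compat; lra.
have Hc : 0 <= cos eta by apply: cos_ge_0; lra.
have Hs1 : sin eta0 <= 1 by have := SIN_bound eta0; lra.
have Hy0 : 0 <= rho * sin eta / rho0.
  apply: Rmult_le_pos; [nra | left; exact: Rinv_0_lt_compat].
have Hy1 : rho * sin eta / rho0 < sin eta0 by apply/Rlt_div_l => //; lra.
(* low points: move left to the arc of radius [rho0], where [cos eta] is nonnegative *)
set eta' := asin (rho * sin eta / rho0).
have Hse : sin eta' = rho * sin eta / rho0 by apply: sin_asin; lra.
have Hb := asin_bound (rho * sin eta / rho0); rewrite -/eta' in Hb.
have Hc' : 0 <= cos eta' by apply: cos_ge_0; lra.
have He'0 : 0 <= eta'.
  apply: Rnot_lt_le => Hn; have := sin_lt_0_var eta' ltac:(lra) Hn; lra.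
have He' : eta' <= eta0.
  case: (Rle_dec (PI / 2) eta0) => Hp; first lra.
  apply: Rnot_lt_le => Hn.
  have : sin eta0 < sin eta' by apply: sin_increasing_1; lra.
  lra.
have Eys : rho * sin eta = rho0 * sin eta' by rewrite Hse; field; lra.
apply: (off_sector_right _ _ (rho0 * cos eta')) => //.
  apply: Rsqr_incr_0_var; last nra.
  have E1 := sin2_cos2 eta; have E2 := sin2_cos2 eta'.
  have : (rho * sin eta)² = (rho0 * sin eta')² by rewrite Eys.
  rewrite /Rsqr in E1 E2 *; nra.
rewrite Eys; apply: Harc; lra.
Qed.

(** If [mu <= 0] then [|w - mu|] is comparable to [|w| + |mu|], because [w] stays away from
    the negative axis.  If [mu > 0] then [mu < rho0], because the half-line from [rho0] to the
    right is outside the sector. *)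
Lemma off_sector_dist k mu rho0 eta0 : 0 < k < 1 -> 0 < rho0 -> 0 < eta0 < PI ->
  off_sector k mu rho0 0 ->
  exists c, 0 < c /\ forall rho eta, rho0 <= rho -> Rabs eta <= eta0 ->
    c * rho <= Cmod (polar rho eta - mu)%C.
Proof.
move=> Hk Hr He [H1 H2].
case: (Rle_dec mu 0) => Hmu.
  exists (cos (eta0 / 2)); split; first by apply: cos_half_pos; lra.
  move=> rho eta Hrho Heta.
  have -> : (polar rho eta - mu)%C = shiftp rho eta (- mu).
    rewrite /shiftp RtoC_opp; ring.
  apply: Rle_trans (shiftp_bound rho eta (- mu) eta0 _ _ _); try lra.
  have := cos_half_pos eta0 ltac:(lra); nra.
have Hmr : mu < rho0.
  have -> : mu = rho0 + (mu - rho0) by ring.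
  move: H2; have -> : (mu - rho0) ^ 2 + 0 ^ 2 = (mu - rho0)² by rewrite /Rsqr; ring.
  rewrite sqrt_Rsqr_abs => H2.
  case: H1 => [H1|]; last by case.
  have : ~ (0 < mu - rho0).
    by move=> Hp; rewrite Rabs_pos_eq in H2; [nra | lra].
  lra.
exists (1 - mu / rho0); split.
  have : mu / rho0 < 1 by apply/Rlt_div_l; lra.
  lra.
move=> rho eta Hrho Heta.
apply: Rle_trans (_ : rho - mu <= _).
  have -> : (1 - mu / rho0) * rho = rho - mu * (rho / rho0) by field; lra.
  have : 1 <= rho / rho0 by apply/Rle_div_r; lra.
  nra.
have := Cmod_triangle (polar rho eta - mu)%C mu.
have -> : (polar rho eta - mu + mu)%C = polar rho eta by ring.
rewrite Cmod_polar ?Cmod_R ?Rabs_pos_eq; lra.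
Qed.

Notation Cscal := (@scal C_AbsRing _) (only parsing).

Section Resolvent.

Context {X : CompleteNormedModule C_AbsRing} (A : operator X).
Implicit Types (v w : C) (x y z : X).

Lemma resolvent_solves w y : in_resolvent_set A w -> solves A w y (resolvent A w y).
Proof. by move=> [H _]; apply: iota_correct. Qed.

Lemma resolvent_unique w x y : in_resolvent_set A w -> solves A w y x -> x = resolvent A w y.
Proof.
move=> Hw Hx; have [x0 [_ Hu]] := proj1 Hw y.
by rewrite -(Hu x Hx); apply: Hu; apply: resolvent_solves.
Qed.

Lemma resolvent_dom w y : in_resolvent_set A w -> dom A (resolvent A w y).
Proof. by move=> /(resolvent_solves w y) []. Qed.

Lemma app_resolvent w y : in_resolvent_set A w ->
  A (resolvent A w y) = minus (Cscal w (resolvent A w y)) y.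
Proof.
move=> /(resolvent_solves w y) [_ H]; rewrite -[X in _ = minus _ X]H.
by vlinC X.
Qed.

Lemma resolvent_app w x : in_resolvent_set A w -> dom A x ->
  resolvent A w (A x) = minus (Cscal w (resolvent A w x)) x.
Proof.
move=> Hw Hx; symmetry; apply: resolvent_unique => //.
have Hd := resolvent_dom w x Hw.
have Hm y : minus y x = plus y (Cscal (RtoC (-1)) x) by vlinC X.
rewrite Hm; split.
  by apply: dom_plus; apply: dom_scal.
rewrite app_plus; try by apply: dom_scal.
rewrite !app_scal // app_resolvent //.
by vlinC X.
Qed.

Lemma resolvent_plus w y z : in_resolvent_set A w ->
  resolvent A w (plus y z) = plus (resolvent A w y) (resolvent A w z).
Proof.
move=> Hw; symmetry; apply: resolvent_unique => //.
have [H1 H2] := resolvent_solves w y Hw; have [H3 H4] := resolvent_solves w z Hw.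
split; first exact: dom_plus.
rewrite app_plus // -[X in _ = plus X _]H2 -[X in _ = plus _ X]H4.
by vlinC X.
Qed.

Lemma resolvent_scal w (k : C) y : in_resolvent_set A w ->
  resolvent A w (Cscal k y) = Cscal k (resolvent A w y).
Proof.
move=> Hw; symmetry; apply: resolvent_unique => //.
have [H1 H2] := resolvent_solves w y Hw.
split; first exact: dom_scal.
rewrite app_scal // -[X in _ = scal _ X]H2.
by vlinC X.
Qed.

Lemma resolvent_identity v w y : in_resolvent_set A v -> in_resolvent_set A w ->
  minus (resolvent A w y) (resolvent A v y) =
  Cscal (v - w)%C (resolvent A w (resolvent A v y)).
Proof.
move=> Hv Hw; rewrite -resolvent_scal //.
have [H1 H2] := resolvent_solves v y Hv.
have Ex : resolvent A v y = resolvent A w (minus (Cscal w (resolvent A v y))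
   (A (resolvent A v y))) by apply: resolvent_unique.
have -> : minus (resolvent A w y) (resolvent A v y) =
  plus (resolvent A w y) (Cscal (RtoC (-1))
    (resolvent A w (minus (Cscal w (resolvent A v y)) (A (resolvent A v y))))).
  by rewrite -Ex; vlinC X.
rewrite -resolvent_scal // -resolvent_plus // app_resolvent //; congr resolvent.
by vlinC X.
Qed.

Lemma resolvent_comm v w y : in_resolvent_set A v -> in_resolvent_set A w ->
  resolvent A w (resolvent A v y) = resolvent A v (resolvent A w y).
Proof.
move=> Hv Hw.
case: (Ceq_dec v w) => [-> //|Hvw].
have H1 := resolvent_identity v w y Hv Hw.
have H2 := resolvent_identity w v y Hw Hv.
have Hn : (v - w)%C <> 0%C.
  move=> E; apply: Hvw; have -> : v = ((v - w) + w)%C by ring.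
  rewrite E; ring.
have E : Cscal (v - w)%C (resolvent A w (resolvent A v y)) =
  Cscal (v - w)%C (resolvent A v (resolvent A w y)).
  rewrite -H1.
  have -> : Cscal (v - w)%C (resolvent A v (resolvent A w y)) =
    opp (Cscal (w - v)%C (resolvent A v (resolvent A w y))).
    by vlinC X.
  by rewrite -H2 opp_minus.
have := f_equal (Cscal (/ (v - w))%C) E.
rewrite !scal_assoc.
have -> : mult (/ (v - w) : C_AbsRing)%C (v - w : C_AbsRing)%C = one.
  by rewrite /mult /one /=; field.
by rewrite !scal_one.
Qed.

End Resolvent.

(** * Integrals along the Hankel path *)
Definition Ccont_on (g : R -> C) (a b : R) := forall x, a <= x <= b -> forall eps, 0 < eps ->
  exists d, 0 < d /\ forall x', a <= x' <= b -> Rabs (x' - x) < d ->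
    Cmod (g x' - g x)%C < eps.

Lemma Ccont_on_derive_C g a b : (forall x, a <= x <= b -> exists l, is_derive_C g x l) -> Ccont_on g a b.
Proof.
move=> H x Hx eps Heps; have [l [H1 H2]] := H x Hx.
have He : 0 < eps / 2 by lra.
have [d1 Hd1] := proj1 (filterlim_locally _ _) (continuous_of_derive _ _ _ H1) (mkposreal _ He).
have [d2 Hd2] := proj1 (filterlim_locally _ _) (continuous_of_derive _ _ _ H2) (mkposreal _ He).
exists (Rmin d1 d2); split; first by apply: Rmin_pos; apply: cond_pos.
move=> x' _ Hd; apply: Rle_lt_trans (Cmod_le_sum _) _.
have h1 := Hd1 x' (Rlt_le_trans _ _ _ Hd (Rmin_l _ _)).
have h2 := Hd2 x' (Rlt_le_trans _ _ _ Hd (Rmin_r _ _)).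
have {}h1 : Rabs (fst (g x') - fst (g x)) < eps / 2 by exact: h1.
have {}h2 : Rabs (snd (g x') - snd (g x)) < eps / 2 by exact: h2.
rewrite /Cminus /Cplus /Copp /= -!/(Rminus _ _); lra.
Qed.

Lemma Ccont_on_lip g a b K : (forall x y, a <= x <= b -> a <= y <= b ->
   Cmod (g y - g x)%C <= K * Rabs (y - x)) -> Ccont_on g a b.
Proof.
move=> H x Hx eps Heps.
have HK : 0 < Rabs K + 1 by have := Rabs_pos K; lra.
exists (eps / (Rabs K + 1)); split; first exact: Rdiv_lt_0_compat.
move=> y Hy Hd; apply: Rle_lt_trans (H _ _ Hx Hy) _.
apply: Rle_lt_trans (_ : (Rabs K + 1) * Rabs (y - x) < _).
  apply: Rmult_le_compat_r; first exact: Rabs_pos.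
  have := Rle_abs K; lra.
rewrite Rmult_comm; apply/Rlt_div_r => //.
Qed.

Section Scalars.

Context {X : CompleteNormedModule C_AbsRing}.

Lemma norm_Cscal (c : C) (x : X) : norm (Cscal c x) <= Cmod c * norm x.
Proof. exact: (norm_scal (c : C_AbsRing) x). Qed.

Lemma cont_on_scal (g : R -> C) (U : R -> realify X) a b :
  Ccont_on g a b -> cont_on U a b ->
  cont_on (fun x => Cscal (g x) (U x : X) : realify X) a b.
Proof.
move=> Hg HU x Hx eps Heps.
have Hn := norm_ge_0 (U x). have Hm := Cmod_ge_0 (g x).
have H1 : 0 < Rmin 1 (eps / (2 * (norm (U x) + 1))).
  by apply: Rmin_pos; [lra | apply: Rdiv_lt_0_compat; lra].
have H2 : 0 < eps / (2 * (Cmod (g x) + 1)) by apply: Rdiv_lt_0_compat; lra.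
have [d1 [Hd1 h1]] := Hg x Hx _ H1; have [d2 [Hd2 h2]] := HU x Hx _ H2.
exists (Rmin d1 d2); split; first exact: Rmin_pos.
move=> y Hy Hd.
have {}h1 := h1 y Hy (Rlt_le_trans _ _ _ Hd (Rmin_l _ _)).
have {}h2 := h2 y Hy (Rlt_le_trans _ _ _ Hd (Rmin_r _ _)).
have h3 := Rlt_le_trans _ _ _ h1 (Rmin_l _ _).
have {}h1 := Rlt_le_trans _ _ _ h1 (Rmin_r _ _).
have -> : minus (Cscal (g y) (U y : X) : realify X) (Cscal (g x) (U x : X)) =
  plus (Cscal (g y) (minus (U y) (U x) : X) : realify X)
    (Cscal (g y - g x)%C (U x : X)).
  by vlinC X.
apply: Rle_lt_trans (norm_triangle _ _) _.
have k1 := norm_Cscal (g y) (minus (U y) (U x)).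
have k2 := norm_Cscal (g y - g x)%C (U x).
have k3 : Cmod (g y) < Cmod (g x) + 1.
  have := Cmod_triangle (g y - g x)%C (g x).
  have -> : (g y - g x + g x)%C = g y by ring.
  lra.
have k4 : Cmod (g y) * norm (minus (U y) (U x)) <= eps / 2.
  apply: Rle_trans (_ : (Cmod (g x) + 1) * (eps / (2 * (Cmod (g x) + 1))) <= _).
    apply: Rmult_le_compat; try lra; [exact: Cmod_ge_0 | exact: norm_ge_0].
  right; field; lra.
have k5 : Cmod (g y - g x)%C * norm (U x) < eps / 2.
  apply: Rle_lt_trans (_ : eps / (2 * (norm (U x) + 1)) * norm (U x) < _).
    apply: Rmult_le_compat_r; lra.
  have -> : eps / (2 * (norm (U x) + 1)) * norm (U x) = eps / 2 * (norm (U x) / (norm (U x) + 1)).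
    field; lra.
  have : norm (U x) / (norm (U x) + 1) < 1 by apply/Rlt_div_l; lra.
  nra.
apply: Rle_lt_trans (Rplus_le_compat _ _ _ _ k1 k2) _.
refine (Rlt_le_trans _ _ _ (Rplus_le_lt_compat _ _ _ _ k4 k5) _); lra.
Qed.

Lemma cont_on_const (x : realify X) a b : cont_on (fun _ => x) a b.
Proof.
move=> t Ht eps Heps; exists 1; split; first lra.
by move=> t' _ _; rewrite minus_eq_zero norm_zero.
Qed.

Definition complex_linear (L : X -> X) : Prop :=
  (forall x y, L (plus x y) = plus (L x) (L y)) /\
  (forall (k : C) x, L (Cscal k x) = Cscal k (L x)) /\
  (exists K, 0 < K /\ forall x, norm (L x) <= K * norm x).

Lemma complex_linear_real (L : X -> X) : complex_linear L ->
  is_linear (U := realify X) (V := realify X) L.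
Proof.
move=> [H1 [H2 H3]]; split=> //.
by move=> k x; exact: (H2 (RtoC k) x).
Qed.

Lemma complex_linear_scal (c : C) : complex_linear (fun x => Cscal c x).
Proof.
split; first by move=> x y; exact: (scal_distr_l (c : C_AbsRing) x y).
split; first by move=> k x; vlinC X.
exists (Cmod c + 1); split; first by have := Cmod_ge_0 c; lra.
move=> x; apply: Rle_trans (norm_Cscal _ _) _.
apply: Rmult_le_compat_r; [exact: norm_ge_0 | lra].
Qed.

Lemma is_derive_scal_C (g : R -> C) p l (x : X) : is_derive_C g p l ->
  is_derive (V := realify X) (fun q => Cscal (g q) x) p (Cscal l x).
Proof.
move=> [H1 H2].
have E c : Cscal c x = plus (scal (fst c) (x : realify X))
    (scal (snd c) (Cscal Ci x : realify X)).
  have -> : plus (scal (fst c) (x : realify X)) (scal (snd c) (Cscal Ci x : realify X)) =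
     plus (Cscal (RtoC (fst c)) x) (Cscal (RtoC (snd c)) (Cscal Ci x)).
    by [].
  rewrite scal_assoc -(scal_distr_r (RtoC (fst c) : C_AbsRing)).
  congr (scal _ _); rewrite /plus /mult /=.
  by case: c => a b; rewrite /Cplus /Cmult /=; congr pair; ring.
rewrite E.
apply: (is_derive_ext (V := realify X) (fun q => plus (scal (fst (g q)) (x : realify X))
    (scal (snd (g q)) (Cscal Ci x : realify X)))).
  by move=> q; symmetry; exact: E.
by apply: (is_derive_plus (V := realify X)); apply: (is_derive_scal_l (V := realify X)).
Qed.

Lemma is_RInt_scal_C (g g' : R -> C) a b (x : X) : a <= b ->
  (forall q, a <= q <= b -> is_derive_C g q (g' q) /\ exists l, is_derive_C g' q l) ->
  is_RInt (V := realify X) (fun q => Cscal (g' q) x) a b (minus (Cscal (g b) x) (Cscal (g a) x)).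
Proof.
move=> Hab H.
apply: (is_RInt_derive (V := realify X) (fun q => Cscal (g q) x)) => q;
  rewrite Rmin_left ?Rmax_right // => /H [H1 [l H2]]; first exact: is_derive_scal_C.
apply: (ex_derive_continuous (V := realify X)); eexists; exact: is_derive_scal_C H2.
Qed.

Lemma is_derive_complex_linear (L : X -> X) (f : R -> X) p l : complex_linear L ->
  is_derive (V := realify X) f p l -> is_derive (V := realify X) (fun q => L (f q)) p (L l).
Proof.
move=> HL Hf; have HR := complex_linear_real L HL.
have H := filterdiff_comp' (K := R_AbsRing) (U := R_NormedModule) (V := realify X) (W := realify X)
  f L p (fun q => scal q (l : realify X)) L Hf
  (@filterdiff_linear R_AbsRing (realify X) (realify X) _ L HR).
refine (@filterdiff_ext_lin R_AbsRing R_NormedModule (realify X) _ _ _ _ _ H _).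
by move=> q; exact: (@linear_scal R_AbsRing (realify X) (realify X) L HR q l).
Qed.

Definition ray_integral (rho psi : R) (F : R -> R -> X) (l : X) : Prop :=
  is_RInt_gen (V := realify X) (fun s => Cscal (polar 1 psi) (F s psi) : realify X)
    (at_point rho) (Rbar_locally p_infty) l.

Definition arc_integral (rho phi : R) (F : R -> R -> X) (l : X) : Prop :=
  is_RInt (V := realify X) (fun psi => Cscal (Ci * polar rho psi)%C (F rho psi) : realify X)
    (- phi) phi l.

(** The integral of [F] along the Hankel path, for [F] given in polar coordinates.  It is a
    relation, so that linearity needs no separate proofs of convergence. *)
Definition is_hankel (rho phi : R) (F : R -> R -> X) (l : X) : Prop :=
  exists l1 l2 l3, ray_integral rho phi F l1 /\ ray_integral rho (- phi) F l2 /\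
    arc_integral rho phi F l3 /\ l = plus (minus l1 l2) l3.

Lemma is_hankel_unique rho phi F k l :
  is_hankel rho phi F k -> is_hankel rho phi F l -> k = l.
Proof.
move=> [k1 [k2 [k3 [h1 [h2 [h3 ->]]]]]] [l1 [l2 [l3 [g1 [g2 [g3 ->]]]]]].
have E1 := is_RInt_gen_unique (V := realify X) _ _ h1.
have E2 := is_RInt_gen_unique (V := realify X) _ _ h2.
have E3 := is_RInt_unique (V := realify X) _ _ _ _ h3.
have F1 := is_RInt_gen_unique (V := realify X) _ _ g1.
have F2 := is_RInt_gen_unique (V := realify X) _ _ g2.
have F3 := is_RInt_unique (V := realify X) _ _ _ _ g3.
by rewrite -E1 -E2 -E3 -F1 -F2 -F3.
Qed.

Lemma at_point_eventually (rho : R) (P : R * R -> Prop) :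
  (forall b, rho <= b -> P (rho, b)) ->
  filter_prod (at_point rho) (Rbar_locally p_infty) P.
Proof.
move=> H; exists (fun x => x = rho) (fun x => rho < x) => //.
  by exists rho.
by move=> x y -> Hy; apply: H; lra.
Qed.

Lemma is_hankel_ext rho phi F G l : 0 <= phi ->
  (forall s psi, rho <= s -> Rabs psi <= phi -> F s psi = G s psi) ->
  is_hankel rho phi F l -> is_hankel rho phi G l.
Proof.
move=> Hphi E [l1 [l2 [l3 [h1 [h2 [h3 ->]]]]]]; exists l1, l2, l3; split; last split; last split=> //.
- apply: is_RInt_gen_ext h1; apply: at_point_eventually => b /= Hb x.
  rewrite Rmin_left // => Hx; rewrite E // ?Rabs_pos_eq; lra.
- apply: is_RInt_gen_ext h2; apply: at_point_eventually => b /= Hb x.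
  rewrite Rmin_left // => Hx; rewrite E // ?Rabs_Ropp ?Rabs_pos_eq; lra.
- apply: is_RInt_ext h3 => x; rewrite Rmin_left ?Rmax_right; try lra.
  move=> Hx; rewrite E //; first lra.
  by apply/Rabs_le_between; lra.
Qed.

Lemma is_hankel_plus rho phi F G k l : is_hankel rho phi F k -> is_hankel rho phi G l ->
  is_hankel rho phi (fun s psi => plus (F s psi) (G s psi)) (plus k l).
Proof.
move=> [k1 [k2 [k3 [h1 [h2 [h3 ->]]]]]] [l1 [l2 [l3 [g1 [g2 [g3 ->]]]]]].
exists (plus k1 l1), (plus k2 l2), (plus k3 l3); split; last split; last split.
- apply: is_RInt_gen_ext (is_RInt_gen_plus _ _ _ _ h1 g1).
  apply: filter_forall => ab x _; by vlinC X.
- apply: is_RInt_gen_ext (is_RInt_gen_plus _ _ _ _ h2 g2).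
  apply: filter_forall => ab x _; by vlinC X.
- apply: is_RInt_ext (is_RInt_plus _ _ _ _ _ _ h3 g3).
  move=> x _; by vlinC X.
- by vlinC X.
Qed.

Lemma is_hankel_linear (L : X -> X) rho phi F l : complex_linear L ->
  is_hankel rho phi F l -> is_hankel rho phi (fun s psi => L (F s psi)) (L l).
Proof.
move=> HL [l1 [l2 [l3 [h1 [h2 [h3 ->]]]]]].
have HR := complex_linear_real L HL.
have HS : forall (k : C) x, L (Cscal k x) = Cscal k (L x) by case: HL => _ [].
exists (L l1), (L l2), (L l3); split; last split; last split.
- refine (is_RInt_gen_ext (V := realify X) _ _ _ _
    (is_RInt_gen_linear (V := realify X) (W := realify X) L HR _ _ _ _ _ _ h1)).
  by apply: filter_forall => ab x _.
- refine (is_RInt_gen_ext (V := realify X) _ _ _ _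
    (is_RInt_gen_linear (V := realify X) (W := realify X) L HR _ _ _ _ _ _ h2)).
  by apply: filter_forall => ab x _.
- refine (is_RInt_ext (V := realify X) _ _ _ _ _ _
    (is_RInt_linear (V := realify X) (W := realify X) L HR _ _ _ _ h3)).
  by move=> x _.
- have Hm x y : L (minus x y) = minus (L x) (L y).
    have -> : minus x y = plus x (Cscal (RtoC (-1)) y) by vlinC X.
    by rewrite (proj1 HL) HS; vlinC X.
  by rewrite (proj1 HL) Hm.
Qed.

Lemma is_hankel_scal (c : C) rho phi F l : is_hankel rho phi F l ->
  is_hankel rho phi (fun s psi => Cscal c (F s psi)) (Cscal c l).
Proof. exact: is_hankel_linear (complex_linear_scal c). Qed.

Lemma is_hankel_minus rho phi F G k l : is_hankel rho phi F k -> is_hankel rho phi G l ->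
  is_hankel rho phi (fun s psi => minus (F s psi) (G s psi)) (minus k l).
Proof.
move=> Hk Hl.
have H := is_hankel_plus _ _ _ _ _ _ Hk (is_hankel_scal (RtoC (-1)) _ _ _ _ Hl).
have -> : minus k l = plus k (Cscal (RtoC (-1)) l) by vlinC X.
move: H => [l1 [l2 [l3 [h1 [h2 [h3 E]]]]]]; exists l1, l2, l3; split; last split; last split=> //.
- apply: is_RInt_gen_ext h1; apply: filter_forall => ab x _; by vlinC X.
- apply: is_RInt_gen_ext h2; apply: filter_forall => ab x _; by vlinC X.
- apply: is_RInt_ext h3 => x _; by vlinC X.
Qed.

Lemma norm_polar1 psi (x : X) : norm (Cscal (polar 1 psi) x) <= norm x.
Proof.
apply: Rle_trans (norm_Cscal _ _) _; rewrite Cmod_polar; lra.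
Qed.

Lemma Cmod_Ci : Cmod Ci = 1.
Proof.
rewrite /Cmod /Ci /=; have -> : 0 * (0 * 1) + 1 * (1 * 1) = 1 by ring. exact: sqrt_1.
Qed.

Lemma is_hankel_norm rho phi F l K k K2 : 0 <= rho -> 0 <= phi -> 0 < k ->
  is_hankel rho phi F l ->
  (forall s, rho <= s -> norm (F s phi) <= K * exp (- (k * s))) ->
  (forall s, rho <= s -> norm (F s (- phi)) <= K * exp (- (k * s))) ->
  (forall psi, Rabs psi <= phi -> norm (F rho psi) <= K2) ->
  norm l <= 2 * (K / k * exp (- (k * rho))) + 2 * phi * (rho * K2).
Proof.
move=> Hrho Hphi Hk [l1 [l2 [l3 [h1 [h2 [h3 ->]]]]]] Hp Hm Ha.
have H1 : norm (l1 : realify X) <= K / k * exp (- (k * rho)).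
  refine (RInt_gen_norm (V := realify X) _ _ _ _ _ _ h1 (is_RInt_gen_exp_decay K k rho Hk)).
    by apply: at_point_eventually.
  apply: at_point_eventually => b /= Hb x Hx; apply: Rle_trans (norm_polar1 _ _) _; apply: Hp; lra.
have H2 : norm (l2 : realify X) <= K / k * exp (- (k * rho)).
  refine (RInt_gen_norm (V := realify X) _ _ _ _ _ _ h2 (is_RInt_gen_exp_decay K k rho Hk)).
    by apply: at_point_eventually.
  apply: at_point_eventually => b /= Hb x Hx; apply: Rle_trans (norm_polar1 _ _) _; apply: Hm; lra.
have H3 : norm (l3 : realify X) <= (phi - - phi) * (rho * K2).
  refine (norm_RInt_le_const (V := realify X) _ _ _ _ _ _ _ h3); first lra.
  move=> psi Hpsi; apply: Rle_trans (norm_Cscal _ _) _.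
  rewrite Cmod_mult Cmod_Ci Cmod_polar // Rmult_1_l.
  apply: Rmult_le_compat_l => //; apply: Ha; by apply/Rabs_le_between; lra.
have H1' : norm l1 <= K / k * exp (- (k * rho)) by exact: H1.
have H2' : norm l2 <= K / k * exp (- (k * rho)) by exact: H2.
have H3' : norm l3 <= (phi - - phi) * (rho * K2) by exact: H3.
have T1 : norm (plus (minus l1 l2) l3) <= norm (minus l1 l2) + norm l3 := norm_triangle _ _.
have T2 : norm (minus l1 l2) <= norm l1 + norm l2.
  rewrite -(norm_opp l2); exact: norm_triangle.
lra.
Qed.

Definition ray_cont (r psi : R) (U : R -> R -> X) : Prop :=
  forall N, cont_on (V := realify X) (fun s => U s psi) r N.

Lemma is_hankel_exists rho phi (k : R -> R -> C) (U : R -> R -> X) K c :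
  0 < rho -> 0 <= phi -> 0 < c ->
  (forall N, Ccont_on (fun s => k s phi) rho N) ->
  (forall N, Ccont_on (fun s => k s (- phi)) rho N) ->
  Ccont_on (k rho) (- phi) phi ->
  ray_cont rho phi U -> ray_cont rho (- phi) U ->
  cont_on (V := realify X) (U rho) (- phi) phi ->
  (forall s, rho <= s -> Cmod (k s phi) * norm (U s phi) <= K * exp (- (c * s))) ->
  (forall s, rho <= s -> Cmod (k s (- phi)) * norm (U s (- phi)) <= K * exp (- (c * s))) ->
  exists l, is_hankel rho phi (fun s psi => Cscal (k s psi) (U s psi)) l.
Proof.
move=> Hrho Hphi Hc k1 k2 k3 U1 U2 U3 b1 b2.
have ray psi : (forall N, Ccont_on (fun s => k s psi) rho N) -> ray_cont rho psi U ->
   (forall s, rho <= s -> Cmod (k s psi) * norm (U s psi) <= K * exp (- (c * s))) ->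
   exists l, ray_integral rho psi (fun s psi => Cscal (k s psi) (U s psi)) l.
  move=> h1 h2 h3.
  apply: (ex_RInt_gen_dominated (V := realify X) _ (fun s => K * exp (- (c * s))) _ _
    (K / c * exp (- (c * rho)))).
  - by apply: at_point_eventually.
  - apply: at_point_eventually => b /= Hb; split.
      apply: (ex_RInt_cont_on (V := realify X)) => //.
      apply: (cont_on_scal (fun _ => polar 1 psi)).
        by apply: Ccont_on_derive_C => x _; exists 0%C; apply: derive_C_const.
      exact: cont_on_scal (h1 b) (h2 b).
    move=> s Hs; apply: Rle_trans (norm_polar1 _ _) _.
    apply: Rle_trans (norm_Cscal _ _) _; apply: h3; lra.
  - exact: is_RInt_gen_exp_decay.
have [l1 Hl1] := ray phi k1 U1 b1.
have [l2 Hl2] := ray (- phi) k2 U2 b2.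
have [l3 Hl3] : exists l, arc_integral rho phi (fun s psi => Cscal (k s psi) (U s psi)) l.
  apply: (ex_RInt_cont_on (V := realify X)); first lra.
  apply: (cont_on_scal (fun psi => Ci * polar rho psi)%C).
    apply: Ccont_on_derive_C => x _; eexists.
    apply: derive_C_mult; first exact: derive_C_const.
    by apply: derive_C_pair; auto_derive.
  exact: cont_on_scal k3 U3.
by exists (plus (minus l1 l2) l3), l1, l2, l3.
Qed.

(** If the difference quotients converge at a rate [O((q - p)^2)] dominated along the path, so
    do the integrals. *)
Lemma is_hankel_derive rho phi (F : R -> R -> R -> X) (F' : R -> R -> X) (I : R -> X) I' p d K c K2 :
  0 <= rho -> 0 <= phi -> 0 < c -> 0 < d ->
  (forall q, Rabs (q - p) < d -> is_hankel rho phi (F q) (I q)) ->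
  is_hankel rho phi F' I' ->
  (forall q, Rabs (q - p) < d -> forall s psi, rho <= s -> (psi = phi \/ psi = - phi) ->
     norm (minus (minus (F q s psi) (F p s psi)) (Cscal (RtoC (q - p)) (F' s psi)))
       <= K * (q - p) ^ 2 * exp (- (c * s))) ->
  (forall q, Rabs (q - p) < d -> forall psi, Rabs psi <= phi ->
     norm (minus (minus (F q rho psi) (F p rho psi)) (Cscal (RtoC (q - p)) (F' rho psi)))
       <= K2 * (q - p) ^ 2) ->
  is_derive (V := realify X) I p I'.
Proof.
move=> Hrho Hphi Hc Hd HI HI' Hray Harc.
apply: (is_derive_quad (V := realify X) I p I' (2 * (K / c * exp (- (c * rho))) + 2 * phi * (rho * K2)) d Hd).
move=> q Hq.
have Hp : Rabs (p - p) < d by rewrite Rminus_diag Rabs_R0.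
have H := is_hankel_minus _ _ _ _ _ _ (is_hankel_minus _ _ _ _ _ _ (HI q Hq) (HI p Hp))
   (is_hankel_scal (RtoC (q - p)) _ _ _ _ HI').
have -> : (2 * (K / c * exp (- (c * rho))) + 2 * phi * (rho * K2)) * (q - p) ^ 2 =
  2 * ((K * (q - p) ^ 2) / c * exp (- (c * rho))) + 2 * phi * (rho * (K2 * (q - p) ^ 2)).
  field; lra.
apply: (is_hankel_norm rho phi _ _ _ c _ Hrho Hphi Hc H).
- by move=> s Hs; apply: Hray => //; left.
- by move=> s Hs; apply: Hray => //; right.
- exact: Harc.
Qed.

End Scalars.

(** * Exponential kernels *)
(** [e^(h lambda) lambda^beta] at [lambda = s e^(i psi)]. *)
Definition exp_kernel (h beta s psi : R) : C :=
  Cexp (RtoC h * polar s psi + RtoC beta * (ln s, psi))%C.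

Lemma Cmod_exp_kernel h beta s psi :
  Cmod (exp_kernel h beta s psi) = exp (h * (s * cos psi)) * Rpower s beta.
Proof.
rewrite /exp_kernel Cmod_Cexp /Rpower -exp_plus; congr exp.
by rewrite /Re /Cplus /Cmult /polar /=; ring.
Qed.

Lemma exp_kernel_mult_polar h beta s psi : 0 < s ->
  (polar s psi * exp_kernel h beta s psi)%C = exp_kernel h (beta + 1) s psi.
Proof.
move=> Hs; rewrite -{1}(Cexp_polar s psi Hs) /exp_kernel -Cexp_plus; congr Cexp.
rewrite RtoC_plus; ring.
Qed.

Lemma exp_kernel_mult_pow h beta a s psi : 0 < s ->
  (polar (Rpower s a) (a * psi) * exp_kernel h beta s psi)%C = exp_kernel h (beta + a) s psi.
Proof.
move=> Hs; rewrite -(Cexp_polar _ (a * psi) (Rpower_pos s a)) /exp_kernel -Cexp_plus; congr Cexp.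
have -> : (ln (Rpower s a), a * psi) = (RtoC a * (ln s, psi))%C.
  by rewrite /Rpower ln_exp /Cmult /=; congr pair; ring.
rewrite RtoC_plus; ring.
Qed.

Lemma derive_C_exp_kernel_h h beta s psi : 0 < s ->
  is_derive_C (fun h => exp_kernel h beta s psi) h (exp_kernel h (beta + 1) s psi).
Proof.
move=> Hs; rewrite -exp_kernel_mult_polar // /exp_kernel.
apply: derive_C_Cexp.
apply: (derive_C_eq _ _ ((1 * polar s psi + RtoC h * 0) + 0)%C); first ring.
apply: derive_C_plus; last exact: derive_C_const.
apply: derive_C_mult; last exact: derive_C_const.
apply: derive_C_RtoC; exact: is_derive_id.
Qed.

Lemma derive_C_polar_s s psi : is_derive_C (fun s => polar s psi) s (polar 1 psi).
Proof. by apply: derive_C_pair; auto_derive. Qed.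

Lemma derive_C_polar_psi s psi : is_derive_C (fun psi => polar s psi) psi (Ci * polar s psi)%C.
Proof.
have -> : (Ci * polar s psi)%C = ((- (s * sin psi))%R, (s * cos psi)%R).
  by rewrite /polar /Ci /Cmult /=; congr pair; ring.
by apply: derive_C_pair; auto_derive => //; ring.
Qed.

Lemma derive_C_exp_kernel_s h beta s psi : 0 < s ->
  is_derive_C (fun s => exp_kernel h beta s psi) s
    ((RtoC h * polar 1 psi + RtoC beta * RtoC (/ s)) * exp_kernel h beta s psi)%C.
Proof.
move=> Hs; apply: derive_C_Cexp.
apply: (derive_C_eq _ _ ((0 * polar s psi + RtoC h * polar 1 psi) +
  (0 * (ln s, psi) + RtoC beta * RtoC (/ s)))%C); first ring.
apply: derive_C_plus.
  apply: derive_C_mult; [exact: derive_C_const | exact: derive_C_polar_s].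
apply: derive_C_mult; first exact: derive_C_const.
apply: (derive_C_pair ln (fun _ => psi) s (/ s) 0); last exact: is_derive_const.
auto_derive; lra.
Qed.

Lemma derive_C_exp_kernel_psi h beta s psi :
  is_derive_C (exp_kernel h beta s) psi
    ((RtoC h * (Ci * polar s psi) + RtoC beta * Ci) * exp_kernel h beta s psi)%C.
Proof.
apply: derive_C_Cexp.
apply: (derive_C_eq _ _ ((0 * polar s psi + RtoC h * (Ci * polar s psi)) +
  (0 * (ln s, psi) + RtoC beta * Ci))%C); first ring.
apply: derive_C_plus.
  apply: derive_C_mult; [exact: derive_C_const | exact: derive_C_polar_psi].
apply: derive_C_mult; first exact: derive_C_const.
apply: (derive_C_pair (fun _ => ln s) (fun psi => psi) psi 0 1); first exact: is_derive_const.
exact: is_derive_id.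
Qed.

Lemma exp_kernel_s_cont h beta psi a b : 0 < a -> Ccont_on (fun s => exp_kernel h beta s psi) a b.
Proof.
move=> Ha; apply: Ccont_on_derive_C => s Hs.
eexists; apply: derive_C_exp_kernel_s; lra.
Qed.

Lemma exp_kernel_psi_cont h beta s a b : Ccont_on (exp_kernel h beta s) a b.
Proof. by apply: Ccont_on_derive_C => psi _; eexists; apply: derive_C_exp_kernel_psi. Qed.

Lemma Ccont_on_mult f g a b : Ccont_on f a b -> Ccont_on g a b ->
  Ccont_on (fun x => f x * g x)%C a b.
Proof.
move=> Hf Hg.
exact: (cont_on_scal (X := C_CompleteNormedModule) f g a b Hf Hg).
Qed.

Lemma Rpower_exp_dom r beta e : 0 < r -> 0 < e ->
  exists K, 0 < K /\ forall s, r <= s -> Rpower s beta <= K * exp (e * s).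
Proof.
move=> Hr He.
case: (Rle_dec beta 0) => Hb.
  exists (Rpower r beta); split; first exact: Rpower_pos.
  move=> s Hs.
  have H1 : Rpower s beta <= Rpower r beta by apply: Rpower_anti.
  have H2 : 1 <= exp (e * s) by have := exp_ineq1_le (e * s); nra.
  have := Rpower_pos r beta; nra.
exists (exp (beta * (ln (beta / e)))); split; first exact: exp_pos.
move=> s Hs; rewrite -exp_plus /Rpower; apply: exp_le.
have Hs0 : 0 < s by lra.
have Hbe : 0 < beta / e by apply: Rdiv_lt_0_compat; lra.
have Hx : 0 < e * s / beta by apply: Rdiv_lt_0_compat; nra.
have E : ln s = ln (beta / e) + ln (e * s / beta).
  rewrite -ln_mult //; congr ln; field; lra.
have : ln (e * s / beta) <= e * s / beta.
  have := exp_ineq1_le (ln (e * s / beta)); rewrite exp_ln //; lra.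
move=> H; have := Rmult_le_compat_l beta _ _ ltac:(lra) H.
have -> : beta * (e * s / beta) = e * s by field; lra.
rewrite E; lra.
Qed.

Section Contour.

Context {X : CompleteNormedModule C_AbsRing} (r phi : R).
Hypothesis Hr : 0 < r.
Hypothesis Hphi : PI / 2 < phi < PI.

Let phi_pos : 0 < phi.
Proof. have := PI_RGT_0; lra. Qed.

Let Hcos : 0 < - cos phi.
Proof. have := cos_lt_0 phi ltac:(lra) ltac:(have := PI_RGT_0; lra); lra. Qed.

Lemma cos_ray psi : psi = phi \/ psi = - phi -> cos psi = cos phi.
Proof. by case=> ->; rewrite ?cos_neg. Qed.

(** On the rays [Re lambda = s cos phi < 0]; half of the exponential absorbs the power. *)
Lemma exp_kernel_ray_le h0 beta : 0 < h0 -> exists K, 0 < K /\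
  forall h s psi, h0 <= h -> r <= s -> psi = phi \/ psi = - phi ->
    Cmod (exp_kernel h beta s psi) <= K * exp (- (h0 * - cos phi / 2 * s)).
Proof.
move=> Hh0.
have He : 0 < h0 * - cos phi / 2 by nra.
have [K [HK Hs]] := Rpower_exp_dom r beta _ Hr He.
exists K; split=> // h s psi Hh Hrs Hpsi.
rewrite Cmod_exp_kernel (cos_ray _ Hpsi).
have H1 : exp (h * (s * cos phi)) <= exp (- (h0 * - cos phi * s)).
  apply: exp_le; have : 0 < s * - cos phi by nra. nra.
apply: Rle_trans (_ : exp (- (h0 * - cos phi * s)) * (K * exp (h0 * - cos phi / 2 * s)) <= _).
  apply: Rmult_le_compat => //; try (left; exact: exp_pos); exact: Hs.
have -> : exp (- (h0 * - cos phi * s)) * (K * exp (h0 * - cos phi / 2 * s)) =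
  K * (exp (- (h0 * - cos phi * s)) * exp (h0 * - cos phi / 2 * s)) by ring.
rewrite -exp_plus; right; congr (_ * exp _); field.
Qed.

Lemma exp_kernel_arc_le h1 beta rho h psi : 0 < rho -> 0 <= h <= h1 ->
  Cmod (exp_kernel h beta rho psi) <= exp (h1 * rho) * Rpower rho beta.
Proof.
move=> Hrho Hh; rewrite Cmod_exp_kernel.
apply: Rmult_le_compat_r; first by left; apply: Rpower_pos.
apply: exp_le; have := COS_bound psi => Hc.
apply: Rle_trans (_ : h * (rho * 1) <= _); last by nra.
apply: Rmult_le_compat_l; first lra.
apply: Rmult_le_compat_l; lra.
Qed.

(** The vector-valued factors of the integrands: bounded, and continuous along rays and arcs
    within the closed region to the right of the path.  Bounds and continuity are only asked
    there, since the resolvent is not controlled beyond the rays. *)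
Definition good_field (U : R -> R -> X) (B : R) : Prop :=
  (forall s psi, r <= s -> Rabs psi <= phi -> norm (U s psi) <= B) /\
  (forall psi, Rabs psi <= phi -> ray_cont r psi U) /\
  (forall s, r <= s -> cont_on (V := realify X) (U s) (- phi) phi).

Lemma good_field_const (x : X) : good_field (fun _ _ => x) (norm x).
Proof.
split; first by move=> *; apply: Rle_refl.
by split; [move=> psi _ N | move=> s _]; apply: cont_on_const.
Qed.

Definition kernel_ok (rho : R) (k : R -> R -> C) : Prop :=
  (forall psi N, psi = phi \/ psi = - phi -> Ccont_on (fun s => k s psi) rho N) /\
  Ccont_on (k rho) (- phi) phi /\
  exists K c, 0 < c /\ forall s psi, rho <= s -> psi = phi \/ psi = - phi ->
    Cmod (k s psi) <= K * exp (- (c * s)).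

Definition hankel (rho : R) (k : R -> R -> C) (U : R -> R -> X) : X :=
  let F s psi := Cscal (k s psi) (U s psi) in
  plus
    (minus
       (RInt_gen (V := realify X) (fun s => Cscal (polar 1 phi) (F s phi))
          (at_point rho) (Rbar_locally p_infty))
       (RInt_gen (V := realify X) (fun s => Cscal (polar 1 (- phi)) (F s (- phi)))
          (at_point rho) (Rbar_locally p_infty)))
    (RInt (V := realify X) (fun psi => Cscal (Ci * polar rho psi)%C (F rho psi))
       (- phi) phi).

Lemma abs_ray psi : psi = phi \/ psi = - phi -> Rabs psi <= phi.
Proof. by case=> ->; rewrite ?Rabs_Ropp Rabs_pos_eq; lra. Qed.

Lemma hankel_correct rho k U B : r <= rho -> kernel_ok rho k -> good_field U B ->
  is_hankel rho phi (fun s psi => Cscal (k s psi) (U s psi)) (hankel rho k U).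
Proof.
move=> Hrho [k1 [k2 [K [c [Hc Hk]]]]] [U1 [U2 U3]].
have HB : 0 <= B.
  apply: Rle_trans (norm_ge_0 (U r 0)) (U1 r 0 (Rle_refl _) _); rewrite Rabs_R0; lra.
have Hp : phi = phi \/ phi = - phi by left.
have Hm : - phi = phi \/ - phi = - phi by right.
have Hbd psi s : psi = phi \/ psi = - phi -> rho <= s ->
   Cmod (k s psi) * norm (U s psi) <= K * B * exp (- (c * s)).
  move=> Hpsi Hs; have -> : K * B * exp (- (c * s)) = K * exp (- (c * s)) * B by ring.
  apply: Rmult_le_compat; [exact: Cmod_ge_0 | exact: norm_ge_0 | exact: Hk | apply: U1].
    lra.
  exact: abs_ray.
have Hrc psi : psi = phi \/ psi = - phi -> ray_cont rho psi U.
  move=> Hpsi N x Hx eps Heps.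
  have [d [Hd H]] := U2 psi (abs_ray _ Hpsi) N x ltac:(lra) eps Heps.
  exists d; split=> // x' Hx'; apply: H; lra.
have [|||||||||||l Hl] := is_hankel_exists rho phi k U (K * B) c => //; try lra.
- by move=> N; apply: k1.
- by move=> N; apply: k1.
- exact: Hrc.
- exact: Hrc.
- exact: U3.
- by move=> s; apply: Hbd.
- by move=> s; apply: Hbd.
have -> : hankel rho k U = l => //.
move: Hl => [l1 [l2 [l3 [h1 [h2 [h3 ->]]]]]].
rewrite /hankel (is_RInt_gen_unique (V := realify X) _ _ h1)
  (is_RInt_gen_unique (V := realify X) _ _ h2)
  (is_RInt_unique (V := realify X) _ _ _ _ h3) //.
Qed.

Lemma hankel_norm rho k U B K c K2 : r <= rho -> kernel_ok rho k -> good_field U B -> 0 < c ->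
  (forall s psi, rho <= s -> psi = phi \/ psi = - phi ->
     Cmod (k s psi) * norm (U s psi) <= K * exp (- (c * s))) ->
  (forall psi, Rabs psi <= phi -> Cmod (k rho psi) * norm (U rho psi) <= K2) ->
  norm (hankel rho k U) <= 2 * (K / c * exp (- (c * rho))) + 2 * phi * (rho * K2).
Proof.
move=> Hrho Hk HU Hc H1 H2.
apply: (is_hankel_norm _ _ _ _ _ _ _ _ _ _ (hankel_correct rho k U B Hrho Hk HU)); try lra.
- by move=> s Hs; apply: Rle_trans (norm_Cscal _ _) _; apply: H1 => //; left.
- by move=> s Hs; apply: Rle_trans (norm_Cscal _ _) _; apply: H1 => //; right.
- by move=> psi Hpsi; apply: Rle_trans (norm_Cscal _ _) _; apply: H2.
Qed.

Lemma kernel_ok_mult rho k g G : kernel_ok rho k ->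
  (forall psi N, psi = phi \/ psi = - phi -> Ccont_on (fun s => g s psi) rho N) ->
  Ccont_on (g rho) (- phi) phi ->
  (forall s psi, rho <= s -> psi = phi \/ psi = - phi -> Cmod (g s psi) <= G) ->
  kernel_ok rho (fun s psi => k s psi * g s psi)%C.
Proof.
move=> [k1 [k2 [K [c [Hc k3]]]]] g1 g2 g3; split; last split.
- by move=> psi N Hpsi; apply: Ccont_on_mult; [apply: k1 | apply: g1].
- exact: Ccont_on_mult.
- exists (K * G), c; split=> // s psi Hs Hpsi; rewrite Cmod_mult.
  have -> : K * G * exp (- (c * s)) = K * exp (- (c * s)) * G by ring.
  apply: Rmult_le_compat; try exact: Cmod_ge_0; [exact: k3 | exact: g3].
Qed.

Lemma kernel_ok_exp rho h beta : r <= rho -> 0 < h -> kernel_ok rho (exp_kernel h beta).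
Proof.
move=> Hrho Hh; split; last split.
- move=> psi N _; apply: exp_kernel_s_cont; lra.
- exact: exp_kernel_psi_cont.
- have [K [HK H]] := exp_kernel_ray_le h beta Hh.
  exists K, (h * - cos phi / 2); split; first nra.
  move=> s psi Hs Hpsi; apply: H; lra.
Qed.

Lemma hankel_derive rho (k k' k'' : R -> R -> R -> C) U B p d K c K2 :
  r <= rho -> 0 < d -> 0 < c -> good_field U B ->
  (forall q, Rabs (q - p) < d -> kernel_ok rho (k q)) -> kernel_ok rho (k' p) ->
  (forall q s psi, Rabs (q - p) < d -> rho <= s -> Rabs psi <= phi ->
     is_derive_C (fun q => k q s psi) q (k' q s psi) /\ is_derive_C (fun q => k' q s psi) q (k'' q s psi)) ->
  (forall q s psi, Rabs (q - p) < d -> rho <= s -> psi = phi \/ psi = - phi ->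
     Cmod (k'' q s psi) <= K * exp (- (c * s))) ->
  (forall q psi, Rabs (q - p) < d -> Rabs psi <= phi -> Cmod (k'' q rho psi) <= K2) ->
  is_derive (V := realify X) (fun q => hankel rho (k q) U) p (hankel rho (k' p) U).
Proof.
move=> Hrho Hd Hc HU Hk Hk' HD HK HK2.
have HB : 0 <= B.
  case: HU => U1 _.
  apply: Rle_trans (norm_ge_0 (U r 0)) (U1 r 0 (Rle_refl _) _); rewrite Rabs_R0; lra.
have Hbet q x : Rabs (q - p) < d -> Rmin p q <= x <= Rmax p q -> Rabs (x - p) < d.
  move=> /Rabs_def2 Hq; rewrite /Rmin /Rmax; case: Rle_dec => _ Hx; apply: Rabs_def1; lra.
have main q s psi M : Rabs (q - p) < d -> rho <= s -> Rabs psi <= phi ->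
   (forall x, Rabs (x - p) < d -> Cmod (k'' x s psi) <= M) ->
   norm (minus (minus (Cscal (k q s psi) (U s psi)) (Cscal (k p s psi) (U s psi)))
     (Cscal (RtoC (q - p)) (Cscal (k' p s psi) (U s psi)))) <=
   2 * M * (q - p) ^ 2 * B.
  move=> Hq Hs Hpsi HM.
  have -> : minus (minus (Cscal (k q s psi) (U s psi)) (Cscal (k p s psi) (U s psi)))
     (Cscal (RtoC (q - p)) (Cscal (k' p s psi) (U s psi))) =
     Cscal (k q s psi - k p s psi - RtoC (q - p) * k' p s psi)%C (U s psi).
    by vlinC X.
  apply: Rle_trans (norm_Cscal _ _) _.
  apply: Rmult_le_compat; [exact: Cmod_ge_0 | exact: norm_ge_0 | | apply: (proj1 HU) => //; lra].
  apply: (C_taylor (fun q => k q s psi) (fun q => k' q s psi) (fun q => k'' q s psi)) => x Hx.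
  have Hx' := Hbet q x Hq Hx.
  have [h1 h2] := HD x s psi Hx' Hs Hpsi; split=> //; split=> //.
  exact: HM x Hx'.
apply: (is_hankel_derive rho phi (fun q s psi => Cscal (k q s psi) (U s psi))
  (fun s psi => Cscal (k' p s psi) (U s psi)) _ _ p d (2 * K * B) c (2 * K2 * B)); try lra.
- by move=> q Hq; apply: hankel_correct HU => //; apply: Hk.
- exact: hankel_correct HU.
- move=> q Hq s psi Hs Hpsi.
  have -> : 2 * K * B * (q - p) ^ 2 * exp (- (c * s)) =
    2 * (K * exp (- (c * s))) * (q - p) ^ 2 * B by ring.
  apply: main => //; first exact: abs_ray.
  by move=> x Hx; apply: HK.
- move=> q Hq psi Hpsi.
  have -> : 2 * K2 * B * (q - p) ^ 2 = 2 * K2 * (q - p) ^ 2 * B by ring.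
  apply: main => //; first lra.
  by move=> x Hx; apply: HK2.
Qed.

Lemma hankel_exp_derive rho beta U B h : r <= rho -> 0 < h -> good_field U B ->
  is_derive (V := realify X) (fun q => hankel rho (exp_kernel q beta) U) h (hankel rho (exp_kernel h (beta + 1)) U).
Proof.
move=> Hrho Hh HU.
have Hh2 : 0 < h / 2 by lra.
have [K [HK HKs]] := exp_kernel_ray_le (h / 2) (beta + 1 + 1) Hh2.
apply: (hankel_derive rho (fun q => exp_kernel q beta) (fun q => exp_kernel q (beta + 1))
   (fun q => exp_kernel q (beta + 1 + 1)) U B h (h / 2) K (h / 2 * - cos phi / 2)
   (exp (3 * h / 2 * rho) * Rpower rho (beta + 1 + 1)) Hrho Hh2 _ HU).
- nra.
- move=> q /Rabs_def2 Hq; apply: kernel_ok_exp; lra.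
- exact: kernel_ok_exp.
- move=> q s psi _ Hs _; split; apply: derive_C_exp_kernel_h; lra.
- move=> q s psi /Rabs_def2 Hq Hs Hpsi; apply: HKs => //; lra.
- move=> q psi /Rabs_def2 Hq _; apply: exp_kernel_arc_le; lra.
Qed.

(** * The resolvent along the path *)

Context (A : operator X) (alpha C0 : R).
Hypothesis Hal : 0 < alpha < 1.
Hypothesis HC0 : 0 < C0.

Definition lambda_pow (s psi : R) : C := polar (Rpower s alpha) (alpha * psi).

Hypothesis Hres : forall s psi, r <= s -> Rabs psi <= phi -> in_resolvent_set A (lambda_pow s psi).
Hypothesis Hbound : forall s psi y, r <= s -> Rabs psi <= phi ->
  norm (resolvent A (lambda_pow s psi) y) <= C0 * Rpower s (- alpha) * norm y.

Definition resolvent_field (z : X) (s psi : R) : X := resolvent A (lambda_pow s psi) z.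

Definition field_bound := C0 * Rpower r (- alpha).

Lemma field_bound_pos : 0 < field_bound.
Proof. by apply: Rmult_lt_0_compat => //; exact: Rpower_pos. Qed.

Lemma resolvent_field_le z s psi : r <= s -> Rabs psi <= phi -> norm (resolvent_field z s psi) <= field_bound * norm z.
Proof.
move=> Hs Hpsi; apply: Rle_trans (Hbound _ _ _ Hs Hpsi) _.
apply: Rmult_le_compat_r; first exact: norm_ge_0.
apply: Rmult_le_compat_l; first lra.
apply: Rpower_anti; lra.
Qed.

Lemma resolvent_field_diff z s psi s' psi' : r <= s -> Rabs psi <= phi -> r <= s' -> Rabs psi' <= phi ->
  minus (resolvent_field z s' psi') (resolvent_field z s psi) =
  Cscal (lambda_pow s psi - lambda_pow s' psi')%C (resolvent_field (resolvent_field z s psi) s' psi').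
Proof. by move=> *; apply: resolvent_identity; apply: Hres. Qed.

Lemma resolvent_field_diff_le z s psi s' psi' : r <= s -> Rabs psi <= phi -> r <= s' -> Rabs psi' <= phi ->
  norm (minus (resolvent_field z s' psi') (resolvent_field z s psi)) <=
  Cmod (lambda_pow s' psi' - lambda_pow s psi)%C * (field_bound * (field_bound * norm z)).
Proof.
move=> *; rewrite resolvent_field_diff //.
apply: Rle_trans (norm_Cscal _ _) _.
have -> : Cmod (lambda_pow s psi - lambda_pow s' psi')%C = Cmod (lambda_pow s' psi' - lambda_pow s psi)%C.
  rewrite -Cmod_opp; congr Cmod; ring.
apply: Rmult_le_compat_l; first exact: Cmod_ge_0.
apply: Rle_trans (resolvent_field_le _ _ _ _ _) _ => //.
apply: Rmult_le_compat_l; first by left; exact: field_bound_pos.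
exact: resolvent_field_le.
Qed.

Lemma resolvent_field_cont z (s psi : R -> R) a b :
  (forall p, a <= p <= b -> r <= s p /\ Rabs (psi p) <= phi) ->
  Ccont_on (fun p => lambda_pow (s p) (psi p)) a b ->
  cont_on (V := realify X) (fun p => resolvent_field z (s p) (psi p)) a b.
Proof.
move=> Hreg Hc p Hp eps Heps.
set T := field_bound * (field_bound * norm z).
have HT : 0 <= T by rewrite /T; have := field_bound_pos; have := norm_ge_0 z; nra.
have [d [Hd H]] := Hc p Hp (eps / (T + 1)) ltac:(apply: Rdiv_lt_0_compat; lra).
exists d; split=> // q Hq Hqp.
have [h1 h2] := Hreg p Hp; have [h3 h4] := Hreg q Hq.
apply: Rle_lt_trans (resolvent_field_diff_le z _ _ _ _ h1 h2 h3 h4) _; rewrite -/T.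
have Hlt := H q Hq Hqp.
have Hc0 := Cmod_ge_0 (lambda_pow (s q) (psi q) - lambda_pow (s p) (psi p))%C.
apply: Rle_lt_trans (_ : Cmod (lambda_pow (s q) (psi q) - lambda_pow (s p) (psi p))%C * (T + 1) < _); first nra.
by apply/Rlt_div_r => //; lra.
Qed.

Lemma good_field_resolvent z : good_field (resolvent_field z) (field_bound * norm z).
Proof.
split; first by move=> s psi; exact: resolvent_field_le.
have E s psi : 0 < s -> lambda_pow s psi = exp_kernel 0 alpha s psi.
  move=> Hs; rewrite /lambda_pow -(Cexp_polar _ _ (Rpower_pos s alpha)) /exp_kernel; congr Cexp.
  by rewrite /Rpower ln_exp /polar /Cplus /Cmult /=; congr pair; ring.
split.
  move=> psi Hpsi N.
  apply: (resolvent_field_cont z (fun s => s) (fun _ => psi)); first by move=> p Hp; split=> //; lra.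
  move=> x Hx eps Heps.
  have [d [Hd H]] := exp_kernel_s_cont 0 alpha psi r N Hr x Hx eps Heps.
  exists d; split=> // x' Hx' Hd'; rewrite !E; try lra; exact: H.
move=> s Hs; apply: (resolvent_field_cont z (fun _ => s) (fun psi => psi)).
  by move=> p Hp; split=> //; apply/Rabs_le_between.
move=> x Hx eps Heps.
have [d [Hd H]] := exp_kernel_psi_cont 0 alpha s (- phi) phi x Hx eps Heps.
exists d; split=> // x' Hx' Hd'; rewrite !E; try lra; exact: H.
Qed.

(** In the coordinate [z = ln lambda] the kernels become [gz], entire functions whose first
    two derivatives are [gz1] and [gz2]. *)
Definition gz (h b : R) (z : C) : C := Cexp (RtoC h * Cexp z + RtoC b * z)%C.
Definition gz1 (h b : R) (z : C) : C := ((RtoC h * Cexp z + RtoC b) * gz h b z)%C.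
Definition gz2 (h b : R) (z : C) : C :=
  ((RtoC h * Cexp z) * gz h b z + (RtoC h * Cexp z + RtoC b) * gz1 h b z)%C.

Lemma derive_C_gz h b z k p :
  is_derive_C (fun p => gz h b (z + RtoC p * k)%C) p (k * gz1 h b (z + RtoC p * k)%C)%C.
Proof.
rewrite /gz1 Cmult_assoc; apply: derive_C_Cexp.
apply: (derive_C_eq _ _ (((0 * Cexp (z + RtoC p * k) + RtoC h * (k * Cexp (z + RtoC p * k)))) +
  (0 * (z + RtoC p * k) + RtoC b * k))%C); first ring.
apply: derive_C_plus; apply: derive_C_mult; try exact: derive_C_const; [exact: derive_C_Cexp_line | exact: derive_C_line].
Qed.

Lemma derive_C_gz1 h b z k p :
  is_derive_C (fun p => k * gz1 h b (z + RtoC p * k)%C)%C p (k * (k * gz2 h b (z + RtoC p * k)%C))%C.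
Proof.
apply: (derive_C_eq _ _ (0 * gz1 h b (z + RtoC p * k)%C + k *
  (((0 * Cexp (z + RtoC p * k) + RtoC h * (k * Cexp (z + RtoC p * k))) + 0) * gz h b (z + RtoC p * k)%C
  + (RtoC h * Cexp (z + RtoC p * k) + RtoC b) * (k * gz1 h b (z + RtoC p * k)%C)))%C).
  rewrite /gz2; ring.
apply: derive_C_mult; first exact: derive_C_const.
rewrite /gz1.
apply: derive_C_mult; last exact: derive_C_gz.
apply: derive_C_plus; last exact: derive_C_const.
apply: derive_C_mult; [exact: derive_C_const | exact: derive_C_Cexp_line].
Qed.

(** In the logarithmic coordinate the part of the region with [|lambda| <= e^N] is a
    rectangle, hence convex. *)
Definition in_rect (N : R) (z : C) : Prop :=
  (ln r <= fst z <= N) /\ Rabs (snd z) <= phi.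

Lemma in_rect_segment N z z' p : in_rect N z -> in_rect N z' -> 0 <= p <= 1 ->
  in_rect N (z + RtoC p * (z' - z))%C.
Proof.
move=> [h1 h2] [h3 h4] Hp; move: h2 h4 => /Rabs_le_between h2 /Rabs_le_between h4.
rewrite /in_rect /Cplus /Cmult /Cminus /Copp /=; split; first by split; nra.
apply/Rabs_le_between; split; nra.
Qed.

Lemma Cmod_Cexp_le N z : in_rect N z -> Cmod (Cexp z) <= exp N.
Proof. by move=> [h _]; rewrite Cmod_Cexp; apply: exp_le; rewrite /Re; lra. Qed.

Lemma gz_bounds h b N : exists K, 0 < K /\ forall z, in_rect N z ->
  Cmod (gz h b z) <= K /\ Cmod (gz1 h b z) <= K /\ Cmod (gz2 h b z) <= K.
Proof.
set P := Rabs h * exp N.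
set L := Rabs (ln r) + Rabs N.
set G := exp (P + Rabs b * L).
have HP : 0 <= P by apply: Rmult_le_pos; [exact: Rabs_pos | left; exact: exp_pos].
have HL : 0 <= L by rewrite /L; have := Rabs_pos (ln r); have := Rabs_pos N; lra.
have HG : 0 < G by exact: exp_pos.
have Hb := Rabs_pos b.
exists (G + (P + Rabs b) * G + (P * G + (P + Rabs b) * ((P + Rabs b) * G))).
have h1 : 0 <= (P + Rabs b) * G by apply: Rmult_le_pos; lra.
have h2 : 0 <= P * G by apply: Rmult_le_pos; lra.
have h3 : 0 <= (P + Rabs b) * ((P + Rabs b) * G) by apply: Rmult_le_pos; lra.
split; first lra.
move=> z Hz.
have He := Cmod_Cexp_le N z Hz.
have E1 : Cmod (RtoC h * Cexp z)%C <= P.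
  by rewrite Cmod_mult Cmod_R; apply: Rmult_le_compat_l; [exact: Rabs_pos |].
have E2 : Cmod (RtoC h * Cexp z + RtoC b)%C <= P + Rabs b.
  apply: Rle_trans (Cmod_triangle _ _) _; rewrite (Cmod_R b); lra.
have E3 : Cmod (gz h b z) <= G.
  rewrite /gz Cmod_Cexp; apply: exp_le.
  have -> : Re (RtoC h * Cexp z + RtoC b * z)%C = fst (RtoC h * Cexp z)%C + b * fst z.
    by rewrite /Re /Cplus /Cmult /=; ring.
  have h4 := fst_le_Cmod (RtoC h * Cexp z)%C.
  have h5 := Rle_abs (fst (RtoC h * Cexp z)%C).
  have h6 : b * fst z <= Rabs b * L.
    apply: Rle_trans (Rle_abs _) _; rewrite Rabs_mult.
    apply: Rmult_le_compat_l => //.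
    case: Hz => [[h6 h7] _]; rewrite /L.
    have := Rle_abs N; have := Rabs_pos N; have := Rabs_pos (ln r).
    have := Rle_abs (- ln r); rewrite Rabs_Ropp.
    by move=> ????; apply/Rabs_le_between; lra.
  lra.
have E4 : Cmod (gz1 h b z) <= (P + Rabs b) * G.
  rewrite /gz1 Cmod_mult; apply: Rmult_le_compat => //; exact: Cmod_ge_0.
have E5 : Cmod (gz2 h b z) <= P * G + (P + Rabs b) * ((P + Rabs b) * G).
  apply: Rle_trans (Cmod_triangle _ _) _; rewrite (Cmod_mult (RtoC h * _)) (Cmod_mult (_ + _)).
  by apply: Rplus_le_compat; apply: Rmult_le_compat => //; exact: Cmod_ge_0.
by do !split; lra.
Qed.

Lemma gz_taylor h b N : exists K, 0 < K /\ forall z z', in_rect N z -> in_rect N z' ->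
  Cmod (gz h b z) <= K /\ Cmod (gz1 h b z) <= K /\
  Cmod (gz h b z' - gz h b z)%C <= K * Cmod (z' - z)%C /\
  Cmod (gz h b z' - gz h b z - (z' - z) * gz1 h b z)%C <= K * Cmod (z' - z)%C ^ 2.
Proof.
have [K [HK HB]] := gz_bounds h b N.
exists (2 * K); split; first lra.
move=> z z' Hz Hz'.
have [B1 [B2 B3]] := HB z Hz.
have Hseg p : 0 <= p <= 1 -> in_rect N (z + RtoC p * (z' - z))%C.
  exact: in_rect_segment.
have E1 : z' = (z + RtoC 1 * (z' - z))%C by ring.
have E0 : z = (z + RtoC 0 * (z' - z))%C by ring.
split; first lra.
split; first lra.
split.
  have -> : 2 * K * Cmod (z' - z)%C = 2 * (Cmod (z' - z)%C * K) * Rabs (1 - 0).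
    rewrite Rminus_0_r Rabs_R1; ring.
  rewrite {1}E1 {3}E0.
  apply: (C_mean_value (fun p => gz h b (z + RtoC p * (z' - z))%C)
    (fun p => (z' - z) * gz1 h b (z + RtoC p * (z' - z)))%C) => p.
  rewrite Rmin_left ?Rmax_right; try lra; move=> Hp.
  split; first exact: derive_C_gz.
  rewrite Cmod_mult; apply: Rmult_le_compat_l; first exact: Cmod_ge_0.
  by case: (HB _ (Hseg p Hp)) => _ [].
have -> : 2 * K * Cmod (z' - z)%C ^ 2 = 2 * (Cmod (z' - z)%C * (Cmod (z' - z)%C * K)) * (1 - 0) ^ 2.
  ring.
have := C_taylor (fun p => gz h b (z + RtoC p * (z' - z))%C)
    (fun p => (z' - z) * gz1 h b (z + RtoC p * (z' - z)))%C
    (fun p => (z' - z) * ((z' - z) * gz2 h b (z + RtoC p * (z' - z))))%C 0 1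
    (Cmod (z' - z)%C * (Cmod (z' - z)%C * K)).
rewrite -E1 -E0 => H.
have -> : (gz h b z' - gz h b z - (z' - z) * gz1 h b z)%C =
  (gz h b z' - gz h b z - RtoC (1 - 0) * ((z' - z) * gz1 h b z))%C.
  have -> : 1 - 0 = 1 by ring.
  ring.
apply: H => p; rewrite Rmin_left ?Rmax_right; try lra; move=> Hp.
split; first exact: derive_C_gz.
split; first exact: derive_C_gz1.
rewrite !Cmod_mult; apply: Rmult_le_compat_l; first exact: Cmod_ge_0.
apply: Rmult_le_compat_l; first exact: Cmod_ge_0.
by case: (HB _ (Hseg p Hp)) => _ [].
Qed.

Lemma lambda_pow_gz z : lambda_pow (exp (fst z)) (snd z) = gz 0 alpha z.
Proof.
rewrite /lambda_pow -Cexp_polar; last exact: Rpower_pos.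
rewrite /gz /Rpower ln_exp ln_exp; congr Cexp.
by rewrite /Cplus /Cmult /=; congr pair; ring.
Qed.

Definition Rz (y : X) (z : C) : X := resolvent_field y (exp (fst z)) (snd z).

Lemma in_rect_region N z : in_rect N z -> r <= exp (fst z) /\ Rabs (snd z) <= phi.
Proof.
move=> [h1 h2]; split=> //.
rewrite -(exp_ln r) //; apply: exp_le; lra.
Qed.

(** [lambda] times the integrand, in the coordinate [z = ln lambda]. *)
Definition Qz (h b : R) (y : X) (z : C) : X := Cscal (gz h b z) (Rz y z).
(** The complex derivative of [Qz], since [R(w)] has the derivative [- R(w)^2]. *)
Definition Qz1 (h b : R) (y : X) (z : C) : X :=
  minus (Cscal (gz1 h b z) (Rz y z))
        (Cscal (gz h b z * gz1 0 alpha z)%C (Rz (Rz y z) z)).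

(** For two points [w], [w'] of the resolvent set, the resolvent identity gives
    [R(w') - R(w) = - (w' - w) R(w)^2 + (w' - w)^2 R(w') R(w)^2], with the remainder explicit.
    The constant is uniform up to the boundary of the region. *)
Lemma Qz_taylor h b y N : exists K, 0 < K /\ forall z z', in_rect N z -> in_rect N z' ->
  norm (minus (Qz h b y z') (Qz h b y z)) <= K * Cmod (z' - z)%C /\
  norm (minus (minus (Qz h b y z') (Qz h b y z)) (Cscal (z' - z)%C (Qz1 h b y z)))
    <= K * Cmod (z' - z)%C ^ 2.
Proof.
have [K [HK HB]] := gz_taylor h b N.
have [J [HJ HA]] := gz_taylor 0 alpha N.
set n1 := field_bound * norm y; set n2 := field_bound * n1; set n3 := field_bound * n2.
have Hc := field_bound_pos.
have p1 : 0 <= n1 by rewrite /n1; have := norm_ge_0 y; nra.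
have p2 : 0 <= n2 by rewrite /n2; nra.
have p3 : 0 <= n3 by rewrite /n3; nra.
exists (1 + (K * n1 + K * J * n2) + (K * n1 + K * (J * n2) + K * (J * n2 + J * J * n3))).
have q1 : 0 <= K * n1 by nra.
have q2 : 0 <= K * (J * n2) by apply: Rmult_le_pos; nra.
have q3 : 0 <= K * (J * n2 + J * J * n3).
  apply: Rmult_le_pos; first lra.
  apply: Rplus_le_le_0_compat; first nra.
  apply: Rmult_le_pos => //; nra.
have q4 : K * J * n2 = K * (J * n2) by ring.
split; first lra.
move=> z z' Hz Hz'.
have [R1 R2] := in_rect_region N z Hz; have [R3 R4] := in_rect_region N z' Hz'.
have [B1 [B2 [B3 B4]]] := HB z z' Hz Hz'.
have [A1 [A2 [A3 A4]]] := HA z z' Hz Hz'.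
have [B1' _] := HB z' z Hz' Hz.
have c0 := Cmod_ge_0 (z' - z)%C.
have m1 : norm (Rz y z) <= n1 by exact: resolvent_field_le.
have m1' : norm (Rz y z') <= n1 by exact: resolvent_field_le.
have m2 : norm (Rz (Rz y z) z) <= n2.
  apply: Rle_trans (resolvent_field_le _ _ _ R1 R2) _; rewrite /n2; nra.
have m2' : norm (Rz (Rz y z) z') <= n2.
  apply: Rle_trans (resolvent_field_le _ _ _ R3 R4) _; rewrite /n2; nra.
have m3 : norm (Rz (Rz (Rz y z) z) z') <= n3.
  apply: Rle_trans (resolvent_field_le _ _ _ R3 R4) _; rewrite /n3; nra.
have D1 : minus (Rz y z') (Rz y z) = Cscal (gz 0 alpha z - gz 0 alpha z')%C (Rz (Rz y z) z').
  by rewrite -!lambda_pow_gz; exact: resolvent_field_diff.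
have D2 : minus (Rz (Rz y z) z') (Rz (Rz y z) z) =
   Cscal (gz 0 alpha z - gz 0 alpha z')%C (Rz (Rz (Rz y z) z) z').
  by rewrite -!lambda_pow_gz; exact: resolvent_field_diff.
have Em : Cmod (gz 0 alpha z - gz 0 alpha z')%C = Cmod (gz 0 alpha z' - gz 0 alpha z)%C.
  rewrite -Cmod_opp; congr Cmod; ring.
have d1 : norm (minus (Rz y z') (Rz y z)) <= J * Cmod (z' - z)%C * n2.
  rewrite D1; apply: Rle_trans (norm_Cscal _ _) _; rewrite Em.
  apply: Rmult_le_compat => //; [exact: Cmod_ge_0 | exact: norm_ge_0].
split.
  have -> : minus (Qz h b y z') (Qz h b y z) =
    plus (Cscal (gz h b z' - gz h b z)%C (Rz y z'))
      (Cscal (gz h b z) (minus (Rz y z') (Rz y z))).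
    by rewrite /Qz; vlinC X.
  apply: Rle_trans (norm_triangle _ _) _.
  apply: Rle_trans (Rplus_le_compat _ _ _ _ (norm_Cscal _ _) (norm_Cscal _ _)) _.
  have e1 : Cmod (gz h b z' - gz h b z)%C * norm (Rz y z') <= K * Cmod (z' - z)%C * n1.
    by apply: Rmult_le_compat => //; [exact: Cmod_ge_0 | exact: norm_ge_0].
  have e2 : Cmod (gz h b z) * norm (minus (Rz y z') (Rz y z)) <= K * (J * Cmod (z' - z)%C * n2).
    by apply: Rmult_le_compat => //; [exact: Cmod_ge_0 | exact: norm_ge_0].
  apply: Rle_trans (Rplus_le_compat _ _ _ _ e1 e2) _.
  have -> : K * Cmod (z' - z)%C * n1 + K * (J * Cmod (z' - z)%C * n2) =
    (K * n1 + K * J * n2) * Cmod (z' - z)%C by ring.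
  by apply: Rmult_le_compat_r => //; lra.
set w := (z' - z)%C; set o := gz 0 alpha z; set o' := gz 0 alpha z'.
have -> : minus (minus (Qz h b y z') (Qz h b y z)) (Cscal w (Qz1 h b y z)) =
  plus (plus (Cscal (gz h b z' - gz h b z - w * gz1 h b z)%C (Rz y z'))
     (Cscal (w * gz1 h b z)%C (minus (Rz y z') (Rz y z))))
     (Cscal (gz h b z)
       (plus (Cscal (- (o' - o - w * gz1 0 alpha z))%C (Rz (Rz y z) z))
             (Cscal ((o' - o) * (o' - o))%C (Rz (Rz (Rz y z) z) z')))).
  have F1 : Rz y z' = plus (Rz y z) (Cscal (o - o')%C (Rz (Rz y z) z')).
    by rewrite -D1; vlinC X.
  have F2 : Rz (Rz y z) z' = plus (Rz (Rz y z) z) (Cscal (o - o')%C (Rz (Rz (Rz y z) z) z')).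
    by rewrite -D2; vlinC X.
  rewrite /Qz /Qz1 F1 F2; by vlinC X.
apply: Rle_trans (norm_triangle _ _) _.
have e1 : norm (Cscal (gz h b z' - gz h b z - w * gz1 h b z)%C (Rz y z')) <= K * Cmod w ^ 2 * n1.
  apply: Rle_trans (norm_Cscal _ _) _.
  by apply: Rmult_le_compat => //; [exact: Cmod_ge_0 | exact: norm_ge_0].
have e2 : norm (Cscal (w * gz1 h b z)%C (minus (Rz y z') (Rz y z))) <= Cmod w * K * (J * Cmod w * n2).
  apply: Rle_trans (norm_Cscal _ _) _; rewrite Cmod_mult.
  apply: Rmult_le_compat => //; try exact: norm_ge_0.
    by apply: Rmult_le_pos; exact: Cmod_ge_0.
  by apply: Rmult_le_compat_l => //; exact: Cmod_ge_0.
have e3 : norm (Cscal (- (o' - o - w * gz1 0 alpha z))%C (Rz (Rz y z) z)) <= J * Cmod w ^ 2 * n2.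
  apply: Rle_trans (norm_Cscal _ _) _; rewrite Cmod_opp.
  by apply: Rmult_le_compat => //; [exact: Cmod_ge_0 | exact: norm_ge_0].
have e4 : norm (Cscal ((o' - o) * (o' - o))%C (Rz (Rz (Rz y z) z) z')) <=
    (J * Cmod w) * (J * Cmod w) * n3.
  apply: Rle_trans (norm_Cscal _ _) _; rewrite Cmod_mult.
  apply: Rmult_le_compat => //; try exact: norm_ge_0.
    by apply: Rmult_le_pos; exact: Cmod_ge_0.
  by apply: Rmult_le_compat => //; exact: Cmod_ge_0.
have e5 : norm (Cscal (gz h b z)
       (plus (Cscal (- (o' - o - w * gz1 0 alpha z))%C (Rz (Rz y z) z))
             (Cscal ((o' - o) * (o' - o))%C (Rz (Rz (Rz y z) z) z')))) <=
     K * (J * Cmod w ^ 2 * n2 + (J * Cmod w) * (J * Cmod w) * n3).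
  apply: Rle_trans (norm_Cscal _ _) _.
  apply: Rmult_le_compat => //; [exact: Cmod_ge_0 | exact: norm_ge_0 |].
  apply: Rle_trans (norm_triangle _ _) _; lra.
apply: Rle_trans (Rplus_le_compat _ _ _ _ (norm_triangle _ _) e5) _.
apply: Rle_trans (Rplus_le_compat_r _ _ _ (Rplus_le_compat _ _ _ _ e1 e2)) _.
have -> : K * Cmod w ^ 2 * n1 + Cmod w * K * (J * Cmod w * n2) +
  K * (J * Cmod w ^ 2 * n2 + J * Cmod w * (J * Cmod w) * n3) =
  (K * n1 + K * (J * n2) + K * (J * n2 + J * J * n3)) * Cmod w ^ 2 by ring.
by apply: Rmult_le_compat_r; [apply: pow2_ge_0 | lra].
Qed.

Lemma exp_kernel_gz h b xi psi : exp_kernel h b (exp xi) psi = gz h b (xi, psi).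
Proof. by rewrite /exp_kernel /gz -(Cexp_polar (exp xi) psi (exp_pos xi)) ln_exp. Qed.

Notation hankel_res rho h beta y := (hankel rho (exp_kernel h beta) (resolvent_field y)).

Lemma is_hankel_res rho k y : r <= rho -> kernel_ok rho k ->
  is_hankel rho phi (fun s psi => Cscal (k s psi) (resolvent_field y s psi))
    (hankel rho k (resolvent_field y)).
Proof. by move=> Hrho Hk; apply: hankel_correct (good_field_resolvent y). Qed.

Lemma ray_integrand h beta y s psi : 0 < s ->
  Cscal (polar 1 psi) (Cscal (exp_kernel h beta s psi) (resolvent_field y s psi)) =
  Cscal (RtoC (/ s)) (Qz h (beta + 1) y (ln s, psi)).
Proof.
move=> Hs; rewrite /Qz /Rz -exp_kernel_gz /= exp_ln // -exp_kernel_mult_polar //.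
rewrite !scal_assoc; congr (scal _ _).
have -> : polar s psi = (RtoC s * polar 1 psi)%C.
  by rewrite /polar /Cmult /=; congr pair; ring.
rewrite /mult /= !Cmult_assoc -RtoC_mult Rinv_l; last lra.
by rewrite Cmult_1_l.
Qed.

Lemma arc_integrand h beta y s psi : 0 < s ->
  Cscal (Ci * polar s psi)%C (Cscal (exp_kernel h beta s psi) (resolvent_field y s psi)) =
  Cscal Ci (Qz h (beta + 1) y (ln s, psi)).
Proof.
move=> Hs; rewrite /Qz /Rz -exp_kernel_gz /= exp_ln // -exp_kernel_mult_polar //.
rewrite !scal_assoc; congr (scal _ _).
by rewrite /mult /= Cmult_assoc.
Qed.

Lemma is_RInt_inv rho rho' (Q : realify X) : 0 < rho <= rho' ->
  is_RInt (V := realify X) (fun s => scal (/ s) Q) rho rho' (scal (ln rho' - ln rho) Q).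
Proof.
move=> Hrho.
have -> : scal (ln rho' - ln rho) Q = minus (scal (ln rho') Q) (scal (ln rho) Q) by vlin (realify X).
have Hd s : 0 < s -> is_derive ln s (/ s) by move=> Hs; auto_derive => //; field; lra.
apply: (is_RInt_derive (V := realify X) (fun s => scal (ln s) Q)) => s; rewrite Rmin_left; try lra; move=> Hs.
  apply: is_derive_scal_l; apply: Hd; lra.
apply: continuous_scal_l.
apply: (ex_derive_continuous (fun s => / s)); auto_derive; lra.
Qed.

(** With [s = e^x], the integral of the ray between two radii is that of [Qz] over
    [[xi, xi']]. *)
Lemma ray_shift h beta y N psi K : 0 <= K -> psi = phi \/ psi = - phi ->
  (forall z z', in_rect N z -> in_rect N z' ->
    norm (minus (Qz h (beta + 1) y z') (Qz h (beta + 1) y z)) <= K * Cmod (z' - z)%C) ->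
  forall xi xi' l l', ln r <= xi <= xi' -> xi' <= N ->
  ray_integral (exp xi) psi (fun s psi => Cscal (exp_kernel h beta s psi) (resolvent_field y s psi)) l ->
  ray_integral (exp xi') psi (fun s psi => Cscal (exp_kernel h beta s psi) (resolvent_field y s psi)) l' ->
  norm (minus (minus l l') (Cscal (RtoC (xi' - xi)) (Qz h (beta + 1) y (xi, psi))))
    <= K * (xi' - xi) ^ 2.
Proof.
move=> HK0 Hpsi HK xi xi' l l' Hxi HxiN Hl Hl'.
have Hpa := abs_ray psi Hpsi.
have Hrx : r <= exp xi by rewrite -{1}(exp_ln r) //; apply: exp_le; lra.
have Hexp : exp xi <= exp xi' by apply: exp_le; lra.
pose f s : realify X := Cscal (polar 1 psi) (Cscal (exp_kernel h beta s psi) (resolvent_field y s psi)).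
have [m Hm] : ex_RInt (V := realify X) f (exp xi) (exp xi').
  apply: (ex_RInt_cont_on (V := realify X)) => //.
  apply: (cont_on_scal (fun _ => polar 1 psi)).
    by apply: Ccont_on_derive_C => x _; exists 0%C; apply: derive_C_const.
  apply: (cont_on_scal (fun s => exp_kernel h beta s psi)).
    apply: exp_kernel_s_cont; exact: exp_pos.
  have [_ [U2 _]] := good_field_resolvent y.
  move=> x Hx eps Heps.
  have [d [Hd H]] := U2 psi Hpa (exp xi') x ltac:(lra) eps Heps.
  exists d; split=> // x' Hx'; apply: H; lra.
have El : l = plus (m : realify X) l'.
  have H1 := proj2 (is_RInt_gen_at_point (V := realify X) _ _ _ _) Hm.
  have H2 : is_RInt_gen (V := realify X) f (at_point (exp xi)) (Rbar_locally p_infty)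
     (plus (m : realify X) l') by exact: is_RInt_gen_Chasles H1 Hl'.
  rewrite -(is_RInt_gen_unique (V := realify X) _ _ H2).
  by rewrite -(is_RInt_gen_unique (V := realify X) _ _ Hl).
have Hi := is_RInt_inv (exp xi) (exp xi') (Qz h (beta + 1) y (xi, psi)) (conj (exp_pos xi) Hexp).
rewrite !ln_exp in Hi.
have Hi1 : is_RInt (fun s => K * (xi' - xi) * / s) (exp xi) (exp xi') (K * (xi' - xi) * (xi' - xi)).
  have -> : K * (xi' - xi) * (xi' - xi) = minus (K * (xi' - xi) * ln (exp xi')) (K * (xi' - xi) * ln (exp xi)).
    rewrite !ln_exp /minus /plus /opp /=; ring.
  have He := exp_pos xi.
  apply: (is_RInt_derive (V := R_CompleteNormedModule) (fun s => K * (xi' - xi) * ln s)) => s;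
    rewrite Rmin_left; try lra; move=> Hs.
    auto_derive; first lra. field; lra.
  apply: (ex_derive_continuous (fun s => K * (xi' - xi) * / s)); auto_derive; lra.
have -> : K * (xi' - xi) ^ 2 = K * (xi' - xi) * (xi' - xi) by ring.
have -> : minus (minus l l') (Cscal (RtoC (xi' - xi)) (Qz h (beta + 1) y (xi, psi))) =
   minus (m : X) (Cscal (RtoC (xi' - xi)) (Qz h (beta + 1) y (xi, psi))).
  by rewrite El; vlinC X.
refine (norm_RInt_le (V := realify X) _ _ _ _ _ _ Hexp _ (is_RInt_minus _ _ _ _ _ _ Hm Hi) Hi1).
move=> s Hs; have Hs0 : 0 < s by have := exp_pos xi; lra.
have Hls : xi <= ln s <= xi'.
  rewrite -(ln_exp xi) -(ln_exp xi'); split; apply: ln_le; lra || (have := exp_pos xi; lra).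
rewrite /f ray_integrand //.
have E : minus (Cscal (RtoC (/ s)) (Qz h (beta + 1) y (ln s, psi)) : realify X)
   (scal (/ s) (Qz h (beta + 1) y (xi, psi) : realify X)) =
   Cscal (RtoC (/ s)) (minus (Qz h (beta + 1) y (ln s, psi)) (Qz h (beta + 1) y (xi, psi))).
  symmetry; exact: (scal_minus_distr_l (RtoC (/ s) : C_AbsRing) _ _).
have Hinv : 0 < / s by exact: Rinv_0_lt_compat.
apply: Rle_trans (_ : / s * (K * (xi' - xi)) <= _); last by right; ring.
refine (Rle_trans _ _ _ (Req_le _ _ (f_equal norm E)) _).
apply: Rle_trans (norm_Cscal _ _) _.
rewrite Cmod_R Rabs_pos_eq; last lra.
apply: Rmult_le_compat_l; first lra.
have Hz0 : in_rect N (xi, psi) by split=> //=; lra.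
have Hz1 : in_rect N (ln s, psi) by split=> //=; lra.
apply: Rle_trans (HK _ _ Hz0 Hz1) _.
have -> : Cmod ((ln s, psi) - (xi, psi))%C = ln s - xi.
  have -> : ((ln s, psi) - (xi, psi))%C = RtoC (ln s - xi).
    by rewrite /Cminus /Cplus /Copp /=; congr pair; ring.
  rewrite Cmod_R Rabs_pos_eq; lra.
apply: Rmult_le_compat_l; lra.
Qed.

(** The ray pieces contribute [(xi' - xi) (Qz (xi, phi) - Qz (xi, - phi))] with a minus sign,
    the arcs contribute [xi' - xi] times the integral of the angular derivative of [Qz], and
    the two cancel up to a quadratic error. *)
Lemma hankel_shift_step h beta y N : 0 < h -> exists K, forall xi xi', ln r <= xi <= xi' -> xi' <= N ->
  norm (minus (hankel_res (exp xi') h beta y) (hankel_res (exp xi) h beta y)) <= K * (xi' - xi) ^ 2.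
Proof.
move=> Hh.
have [K [HK HQ]] := Qz_taylor h (beta + 1) y N.
have HQ1 : forall z z', in_rect N z -> in_rect N z' ->
    norm (minus (Qz h (beta + 1) y z') (Qz h (beta + 1) y z)) <= K * Cmod (z' - z)%C.
  by move=> z z' Hz Hz'; case: (HQ z z' Hz Hz').
exists (K + K + 2 * phi * K) => xi xi' Hxi HxiN.
have Hrx : r <= exp xi by rewrite -{1}(exp_ln r) //; apply: exp_le; lra.
have Hrx' : r <= exp xi' by rewrite -{1}(exp_ln r) //; apply: exp_le; lra.
have HU := good_field_resolvent y.
have H := hankel_correct (exp xi) (exp_kernel h beta) _ _ Hrx
  (kernel_ok_exp (exp xi) h beta Hrx Hh) HU.
have H' := hankel_correct (exp xi') (exp_kernel h beta) _ _ Hrx'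
  (kernel_ok_exp (exp xi') h beta Hrx' Hh) HU.
move: H H' => [l1 [l2 [l3 [h1 [h2 [h3 ->]]]]]] [k1 [k2 [k3 [g1 [g2 [g3 ->]]]]]].
have B1 := ray_shift h beta y N phi K (Rlt_le _ _ HK) (or_introl eq_refl) HQ1 xi xi' _ _ Hxi HxiN h1 g1.
have B2 := ray_shift h beta y N (- phi) K (Rlt_le _ _ HK) (or_intror eq_refl) HQ1 xi xi' _ _ Hxi HxiN h2 g2.
set eta := xi' - xi in B1 B2 *.
have Hin psi : - phi <= psi <= phi -> in_rect N (xi, psi).
  by move=> Hp; split=> /=; [lra | apply/Rabs_le_between].
have Hin' psi : - phi <= psi <= phi -> in_rect N (xi', psi).
  by move=> Hp; split=> /=; [lra | apply/Rabs_le_between].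
(* the derivative in the angle is [Ci] times the complex derivative *)
have Hftc : is_RInt (V := realify X)
    (fun psi => Cscal Ci (Qz1 h (beta + 1) y (xi, psi)) : realify X) (- phi) phi
    (minus (Qz h (beta + 1) y (xi, phi)) (Qz h (beta + 1) y (xi, - phi)) : X).
  apply: (ftc_quad (V := realify X) (fun psi => Qz h (beta + 1) y (xi, psi)) _ _ _ K); first lra.
  move=> p q Hp Hq.
  have [_ T] := HQ (xi, p) (xi, q) (Hin p Hp) (Hin q Hq).
  have Ez : ((xi, q) - (xi, p))%C = (RtoC (q - p) * Ci)%C.
    by rewrite /Cminus /Cplus /Copp /Cmult /Ci /=; congr pair; ring.
  rewrite Ez in T.
  have Em : Cmod (RtoC (q - p) * Ci)%C ^ 2 = (q - p) ^ 2.
    by rewrite Cmod_mult Cmod_Ci Rmult_1_r Cmod_R pow2_abs.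
  rewrite Em in T.
  have E : minus (minus (Qz h (beta + 1) y (xi, q)) (Qz h (beta + 1) y (xi, p)))
      (Cscal (RtoC (q - p)) (Cscal Ci (Qz1 h (beta + 1) y (xi, p)))) =
    minus (minus (Qz h (beta + 1) y (xi, q)) (Qz h (beta + 1) y (xi, p)))
      (Cscal (RtoC (q - p) * Ci)%C (Qz1 h (beta + 1) y (xi, p))) by vlinC X.
  exact: (Rle_trans _ _ _ (Req_le _ _ (f_equal norm E)) T).
have H3 : is_RInt (V := realify X)
   (fun psi => minus (minus (Cscal Ci (Qz h (beta + 1) y (xi', psi)))
       (Cscal Ci (Qz h (beta + 1) y (xi, psi))))
       (Cscal (RtoC eta) (Cscal Ci (Qz1 h (beta + 1) y (xi, psi)))) : X)
   (- phi) phi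
   (minus (minus k3 l3) (Cscal (RtoC eta)
      (minus (Qz h (beta + 1) y (xi, phi)) (Qz h (beta + 1) y (xi, - phi))))).
  apply: (is_RInt_minus (V := realify X)).
    apply: (is_RInt_minus (V := realify X)).
      apply: is_RInt_ext g3 => psi _; rewrite arc_integrand ?ln_exp //; exact: exp_pos.
    apply: is_RInt_ext h3 => psi _; rewrite arc_integrand ?ln_exp //; exact: exp_pos.
  exact: (is_RInt_scal (V := realify X) _ _ _ eta _ Hftc).
have B3 : norm (minus (minus k3 l3) (Cscal (RtoC eta)
      (minus (Qz h (beta + 1) y (xi, phi)) (Qz h (beta + 1) y (xi, - phi)))) : X) <= (phi - - phi) * (K * eta ^ 2).
  refine (norm_RInt_le_const (V := realify X) _ _ _ _ _ _ _ H3); first lra.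
  move=> psi Hpsi.
  have [_ T] := HQ (xi, psi) (xi', psi) (Hin psi Hpsi) (Hin' psi Hpsi).
  have Ez : ((xi', psi) - (xi, psi))%C = RtoC eta.
    by rewrite /Cminus /Cplus /Copp /eta /=; congr pair; ring.
  rewrite Ez Cmod_R pow2_abs in T; apply: Rle_trans T.
  have E : minus (minus (Cscal Ci (Qz h (beta + 1) y (xi', psi)))
       (Cscal Ci (Qz h (beta + 1) y (xi, psi))))
       (Cscal (RtoC eta) (Cscal Ci (Qz1 h (beta + 1) y (xi, psi)))) =
    Cscal Ci (minus (minus (Qz h (beta + 1) y (xi', psi)) (Qz h (beta + 1) y (xi, psi)))
      (Cscal (RtoC eta) (Qz1 h (beta + 1) y (xi, psi)))) by vlinC X.
  refine (Rle_trans _ _ _ (Req_le _ _ (f_equal norm E)) _).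
  apply: Rle_trans (norm_Cscal _ _) _; rewrite Cmod_Ci Rmult_1_l; exact: Rle_refl.
have -> : minus (plus (minus k1 k2) k3) (plus (minus l1 l2) l3) =
  plus (plus (opp (minus (minus l1 k1) (Cscal (RtoC eta) (Qz h (beta + 1) y (xi, phi)))))
     (minus (minus l2 k2) (Cscal (RtoC eta) (Qz h (beta + 1) y (xi, - phi)))))
   (minus (minus k3 l3) (Cscal (RtoC eta)
      (minus (Qz h (beta + 1) y (xi, phi)) (Qz h (beta + 1) y (xi, - phi))))).
  by vlinC X.
apply: Rle_trans (norm_triangle _ _) _.
apply: Rle_trans (Rplus_le_compat_r _ _ _ (norm_triangle _ _)) _.
rewrite norm_opp.
apply: Rle_trans (Rplus_le_compat _ _ _ _ (Rplus_le_compat _ _ _ _ B1 B2) B3) _.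
right; ring.
Qed.

(** Cauchy's theorem without contour integration theory: by [hankel_shift_step] the integral
    has quadratically small increments in [ln rho]. *)
Lemma hankel_shift h beta y rho rho' : 0 < h -> r <= rho <= rho' ->
  hankel_res rho h beta y = hankel_res rho' h beta y.
Proof.
move=> Hh Hrho.
have [K HK] := hankel_shift_step h beta y (ln rho') Hh.
rewrite -(exp_ln rho) -1?(exp_ln rho'); try lra.
apply: (const_of_quad (V := realify X) (fun xi => hankel_res (exp xi) h beta y) (ln rho) (ln rho') K).
  apply: ln_le; lra.
move=> p q Hp Hq; apply: HK => //; split; last lra.
have : ln r <= ln rho by apply: ln_le; lra.
lra.
Qed.

Lemma hankel_scal rho k (U : R -> R -> X) B c : r <= rho -> kernel_ok rho k -> good_field U B ->
  kernel_ok rho (fun s psi => c * k s psi)%C ->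
  hankel rho (fun s psi => c * k s psi)%C U = Cscal c (hankel rho k U).
Proof.
move=> Hrho Hk HU Hck.
apply: is_hankel_unique (hankel_correct _ _ _ _ Hrho Hck HU) _.
apply: is_hankel_ext (is_hankel_scal c _ _ _ _ (hankel_correct _ _ _ _ Hrho Hk HU)); first lra.
by move=> s psi _ _ /=; vlinC X.
Qed.

Lemma kernel_ok_scal rho k c : kernel_ok rho k ->
  kernel_ok rho (fun s psi => c * k s psi)%C.
Proof.
move=> [k1 [k2 [K [d [Hd k3]]]]].
have Hc a b : Ccont_on (fun _ : R => c) a b.
  by apply: Ccont_on_derive_C => x _; exists 0%C; apply: derive_C_const.
split; last split.
- by move=> psi N Hpsi; apply: Ccont_on_mult => //; apply: k1.
- exact: Ccont_on_mult.
- exists (Cmod c * K), d; split=> // s psi Hs Hpsi.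
  rewrite Cmod_mult Rmult_assoc; apply: Rmult_le_compat_l; [exact: Cmod_ge_0 | exact: k3].
Qed.

Context (T : R).
Hypothesis HT : 0 < T.

(** The primitive in [u] of [(T - u)^(-alpha) e^(lambda u) lambda^delta]; see
    [derive_C_caputo_kernel]. *)
Definition caputo_kernel (delta u s psi : R) : C :=
  (exp_kernel u (delta + alpha - 1) s psi * inc_gamma alpha (s * (T - u)) psi)%C.

Definition caputo_primitive (rho delta u : R) (y : X) : X := hankel rho (caputo_kernel delta u) (resolvent_field y).

Let phi_lt : 0 <= phi < PI.
Proof. lra. Qed.

Lemma Rabs_lt_PI psi : Rabs psi <= phi -> Rabs psi < PI.
Proof. lra. Qed.

Lemma kernel_ok_caputo rho delta u : r <= rho -> 0 < u < T -> kernel_ok rho (caputo_kernel delta u).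
Proof.
move=> Hrho Hu.
apply: (kernel_ok_mult rho _ _ (2 * (Rpower (cos (phi / 2)) (- alpha) * Gamma (1 - alpha)))).
- apply: kernel_ok_exp => //; lra.
- move=> psi N Hpsi; apply: Ccont_on_derive_C => s Hs; eexists.
  apply: (derive_C_comp (fun q => inc_gamma alpha q psi) (fun s => s * (T - u))).
    apply: derive_C_inc_gamma; [lra | nra |].
    apply: Rabs_lt_PI; exact: abs_ray.
  by auto_derive.
- have [K HK] := inc_gamma_lip_psi alpha (rho * (T - u)) phi ltac:(lra) ltac:(nra) phi_lt.
  apply: (Ccont_on_lip _ _ _ K) => x y Hx Hy.
  by apply: HK; apply/Rabs_le_between.
- move=> s psi Hs Hpsi; apply: inc_gamma_le; [lra | nra |].
  split; [exact: abs_ray | lra].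
Qed.

Lemma derive_C_caputo_kernel delta u s psi : 0 < u < T -> 0 < s -> Rabs psi <= phi ->
  is_derive_C (fun u => caputo_kernel delta u s psi) u (RtoC (Rpower (T - u) (- alpha)) * exp_kernel u delta s psi)%C.
Proof.
move=> Hu Hs Hpsi.
have Hq : 0 < s * (T - u) by nra.
have Hd := derive_C_inc_gamma alpha (s * (T - u)) psi ltac:(lra) Hq (Rabs_lt_PI _ Hpsi).
have Hg : is_derive (fun u => s * (T - u)) u (- s) by auto_derive => //; ring.
have H1 := derive_C_exp_kernel_h u (delta + alpha - 1) s psi Hs.
apply: derive_C_eq (derive_C_mult _ _ _ _ _ H1 (derive_C_comp (fun q => inc_gamma alpha q psi) _ _ _ _ Hd Hg)).
have Hpp : - PI < psi < PI by move: Hpsi => /Rabs_le_between; lra.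
have E1 : polar s psi = (RtoC s * polar 1 psi)%C by rewrite -polar_scale Rmult_1_r.
have E2 : (RtoC (- s) * (polar 1 psi * (inc_gamma alpha (s * (T - u)) psi - cut_pow (- alpha) (polar (s * (T - u)) psi))))%C
   = (- (polar s psi * (inc_gamma alpha (s * (T - u)) psi - cut_pow (- alpha) (polar (s * (T - u)) psi))))%C.
  rewrite E1 RtoC_opp; ring.
rewrite E2 -exp_kernel_mult_polar // cut_pow_polar //.
rewrite -(Rpower_mult_distr s (T - u)) // ?(Rmult_comm (Rpower s _)) ?polar_scale; try lra.
transitivity (RtoC (Rpower (T - u) (- alpha)) * (polar s psi * (polar (Rpower s (- alpha)) (- alpha * psi) *
   exp_kernel u (delta + alpha - 1) s psi)))%C; first ring.
rewrite exp_kernel_mult_pow // exp_kernel_mult_polar //; congr (_ * exp_kernel _ _ _ _)%C; ring.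
Qed.

Lemma derive_C_caputo_kernel' delta u s psi : 0 < u < T -> 0 < s ->
  is_derive_C (fun u => RtoC (Rpower (T - u) (- alpha)) * exp_kernel u delta s psi)%C u
   (RtoC (alpha * Rpower (T - u) (- alpha - 1)) * exp_kernel u delta s psi +
    RtoC (Rpower (T - u) (- alpha)) * exp_kernel u (delta + 1) s psi)%C.
Proof.
move=> Hu Hs; apply: derive_C_mult; last exact: derive_C_exp_kernel_h.
apply: derive_C_RtoC.
have Hd := is_derive_Rpower (T - u) (- alpha) ltac:(lra).
have Hg : is_derive (fun u => T - u) u (- 1) by auto_derive => //; ring.
have := is_derive_comp (fun x => Rpower x (- alpha)) (fun u => T - u) u _ _ Hd Hg.
rewrite /scal /= /mult /=.
by have -> : -1 * (- alpha * Rpower (T - u) (- alpha - 1)) = alpha * Rpower (T - u) (- alpha - 1) by ring.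
Qed.

Lemma caputo_primitive_derive rho delta u y : r <= rho -> 0 < u < T ->
  is_derive (V := realify X) (fun u => caputo_primitive rho delta u y) u
    (Cscal (RtoC (Rpower (T - u) (- alpha))) (hankel_res rho u delta y)).
Proof.
move=> Hrho Hu.
have HU := good_field_resolvent y.
have Hk := kernel_ok_exp rho u delta Hrho (proj1 Hu).
rewrite -(hankel_scal _ _ _ _ _ Hrho Hk HU); last exact: kernel_ok_scal.
(* on this neighborhood of [u] both [q] and [T - q] stay away from [0] *)
pose d := Rmin u (T - u) / 2.
have Hm : 0 < Rmin u (T - u) by apply: Rmin_pos; lra.
have Hd : 0 < d by rewrite /d; lra.
have Hd1 : d <= u / 2 by rewrite /d; have := Rmin_l u (T - u); lra.
have Hd2 : d <= (T - u) / 2 by rewrite /d; have := Rmin_r u (T - u); lra.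
have Hu2 : 0 < u / 2 by lra.
have [K1 [HK1 B1]] := exp_kernel_ray_le (u / 2) delta Hu2.
have [K2 [HK2 B2]] := exp_kernel_ray_le (u / 2) (delta + 1) Hu2.
set a1 := alpha * Rpower ((T - u) / 2) (- alpha - 1).
set a2 := Rpower ((T - u) / 2) (- alpha).
have Ha1 q : Rabs (q - u) < d -> Rabs (alpha * Rpower (T - q) (- alpha - 1)) <= a1.
  move=> /Rabs_def2 Hq; rewrite Rabs_pos_eq; last first.
    by left; apply: Rmult_lt_0_compat; [lra | exact: Rpower_pos].
  apply: Rmult_le_compat_l; first lra.
  apply: Rpower_anti; lra.
have Ha2 q : Rabs (q - u) < d -> Rabs (Rpower (T - q) (- alpha)) <= a2.
  move=> /Rabs_def2 Hq; rewrite Rabs_pos_eq; last by left; exact: Rpower_pos.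
  apply: Rpower_anti; lra.
have Hrho0 : 0 < rho by lra.
have key q s psi M1 M2 : Rabs (q - u) < d -> Cmod (exp_kernel q delta s psi) <= M1 ->
   Cmod (exp_kernel q (delta + 1) s psi) <= M2 ->
   Cmod (RtoC (alpha * Rpower (T - q) (- alpha - 1)) * exp_kernel q delta s psi +
    RtoC (Rpower (T - q) (- alpha)) * exp_kernel q (delta + 1) s psi)%C <= a1 * M1 + a2 * M2.
  move=> Hq H1 H2; apply: Rle_trans (Cmod_triangle _ _) _.
  rewrite !(Cmod_mult (RtoC _)) !Cmod_R.
  apply: Rplus_le_compat; apply: Rmult_le_compat; try exact: Rabs_pos; try exact: Cmod_ge_0 => //.
  - exact: Ha1.
  - exact: H1.
  - exact: Ha2.
  - exact: H2.
apply: (hankel_derive rho (caputo_kernel delta)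
  (fun u s psi => RtoC (Rpower (T - u) (- alpha)) * exp_kernel u delta s psi)%C
  (fun u s psi => RtoC (alpha * Rpower (T - u) (- alpha - 1)) * exp_kernel u delta s psi +
    RtoC (Rpower (T - u) (- alpha)) * exp_kernel u (delta + 1) s psi)%C
  (resolvent_field y) _ u d (a1 * K1 + a2 * K2) (u / 2 * - cos phi / 2)
  (a1 * (exp (2 * u * rho) * Rpower rho delta) + a2 * (exp (2 * u * rho) * Rpower rho (delta + 1)))
  Hrho Hd _ HU).
- nra.
- move=> q /Rabs_def2 Hq; apply: kernel_ok_caputo => //; lra.
- exact: kernel_ok_scal.
- move=> q s psi /Rabs_def2 Hq Hs Hpsi; split.
    apply: derive_C_caputo_kernel => //; lra.
  apply: derive_C_caputo_kernel'; lra.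
- move=> q s psi Hq Hs Hpsi.
  have -> : (a1 * K1 + a2 * K2) * exp (- (u / 2 * - cos phi / 2 * s)) =
    a1 * (K1 * exp (- (u / 2 * - cos phi / 2 * s))) + a2 * (K2 * exp (- (u / 2 * - cos phi / 2 * s))).
    ring.
  have Hq' := Rabs_def2 _ _ Hq.
  by apply: key => //; [apply: B1 | apply: B2] => //; lra.
- move=> q psi Hq Hpsi; have Hq' := Rabs_def2 _ _ Hq.
  by apply: key => //; apply: exp_kernel_arc_le; lra.
Qed.

Lemma hankel_minus_norm rho k1 k2 k (U : R -> R -> X) B K c K2 : r <= rho ->
  kernel_ok rho k1 -> kernel_ok rho k2 -> good_field U B -> 0 < c ->
  (forall s psi, rho <= s -> Rabs psi <= phi -> (k1 s psi - k2 s psi)%C = k s psi) ->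
  (forall s psi, rho <= s -> psi = phi \/ psi = - phi -> Cmod (k s psi) <= K * exp (- (c * s))) ->
  (forall psi, Rabs psi <= phi -> Cmod (k rho psi) <= K2) ->
  norm (minus (hankel rho k1 U) (hankel rho k2 U)) <=
    (2 * (K / c * exp (- (c * rho))) + 2 * phi * (rho * K2)) * B.
Proof.
move=> Hrho Hk1 Hk2 HU Hc Hk HK HK2.
have H := is_hankel_minus _ _ _ _ _ _ (hankel_correct _ _ _ _ Hrho Hk1 HU)
   (hankel_correct _ _ _ _ Hrho Hk2 HU).
have -> : (2 * (K / c * exp (- (c * rho))) + 2 * phi * (rho * K2)) * B =
  2 * (K * B / c * exp (- (c * rho))) + 2 * phi * (rho * (K2 * B)) by field; lra.
have E s psi : rho <= s -> Rabs psi <= phi ->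
    norm (minus (Cscal (k1 s psi) (U s psi)) (Cscal (k2 s psi) (U s psi))) <=
    Cmod (k s psi) * norm (U s psi).
  move=> Hs Hpsi; rewrite -Hk //.
  have -> : minus (Cscal (k1 s psi) (U s psi)) (Cscal (k2 s psi) (U s psi)) =
     Cscal (k1 s psi - k2 s psi)%C (U s psi) by vlinC X.
  exact: norm_Cscal.
have UB s psi : rho <= s -> Rabs psi <= phi -> norm (U s psi) <= B.
  by move=> Hs Hpsi; apply: (proj1 HU) => //; lra.
have ray psi : psi = phi \/ psi = - phi -> forall s, rho <= s ->
   norm (minus (Cscal (k1 s psi) (U s psi)) (Cscal (k2 s psi) (U s psi))) <=
   K * B * exp (- (c * s)).
  move=> Hpsi s Hs; have Hpa := abs_ray psi Hpsi.
  apply: Rle_trans (E s psi Hs Hpa) _.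
  have -> : K * B * exp (- (c * s)) = K * exp (- (c * s)) * B by ring.
  by apply: Rmult_le_compat; [exact: Cmod_ge_0 | exact: norm_ge_0 | exact: HK | exact: UB].
apply: (is_hankel_norm _ _ _ _ _ _ _ _ _ _ H); try lra.
- by apply: ray; left.
- by apply: ray; right.
- move=> psi Hpsi; apply: Rle_trans (E rho psi (Rle_refl _) Hpsi) _.
  by apply: Rmult_le_compat; [exact: Cmod_ge_0 | exact: norm_ge_0 | exact: HK2 | apply: UB => //; lra].
Qed.

Let kap := (1 - alpha) / 2.

(** The kernels differ by [e^(lambda u) lambda^(delta + alpha - 1)] times
    [b(lambda (T - u)) - Gamma(1 - alpha)], which is [O((|lambda| (T - u))^kap)], and by the
    increment of the exponential from [u] to [T]. *)
Lemma caputo_primitive_lim rho delta : r <= rho -> exists K, 0 <= K /\ forall u y, T / 2 <= u < T ->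
  norm (minus (caputo_primitive rho delta u y)
     (Cscal (RtoC (Gamma (1 - alpha))) (hankel_res rho T (delta + alpha - 1) y)))
    <= K * Rpower (T - u) kap * norm y.
Proof.
move=> Hrho; set beta := delta + alpha - 1.
have HT2 : 0 < T / 2 by lra.
have Hka : 0 < kap < 1 by rewrite /kap; lra.
have [Kb [HKb Bb]] := inc_gamma_lim alpha phi Hal phi_lt.
have [K1 [HK1 B1]] := exp_kernel_ray_le (T / 2) (beta + kap) HT2.
have [K2 [HK2 B2]] := exp_kernel_ray_le (T / 2) (beta + 1) HT2.
have HG := Gamma_pos alpha Hal.
set G := Gamma (1 - alpha) in Bb HG *.
set c := T / 2 * - cos phi / 2.
have Hc : 0 < c by rewrite /c; nra.
set L1 := exp (T * rho) * Rpower rho (beta + kap).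
set L2 := exp (T * rho) * Rpower rho (beta + 1).
have HL1 : 0 < L1 by apply: Rmult_lt_0_compat; [exact: exp_pos | exact: Rpower_pos].
have HL2 : 0 < L2 by apply: Rmult_lt_0_compat; [exact: exp_pos | exact: Rpower_pos].
(* [T - u <= Tk * (T - u)^kap] turns the linear error into the slower rate *)
set Tk := Rpower T (1 - kap).
have HTk : 0 < Tk by exact: Rpower_pos.
set W1 := Kb * K1 + G * (2 * (K2 * Tk)).
set W2 := Kb * L1 + G * (2 * (L2 * Tk)).
have HW1 : 0 <= W1.
  apply: Rplus_le_le_0_compat; first nra.
  apply: Rmult_le_pos; nra.
have HW2 : 0 <= W2.
  apply: Rplus_le_le_0_compat; first nra.
  apply: Rmult_le_pos; nra.
exists ((2 * (W1 / c * exp (- (c * rho))) + 2 * phi * (rho * W2)) * field_bound).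
have HCr := field_bound_pos.
split.
  apply: Rmult_le_pos; last lra.
  apply: Rplus_le_le_0_compat.
    apply: Rmult_le_pos; first lra.
    apply: Rmult_le_pos; last by left; exact: exp_pos.
    by apply: Rmult_le_pos => //; left; exact: Rinv_0_lt_compat.
  apply: Rmult_le_pos; first lra.
  by apply: Rmult_le_pos => //; lra.
move=> u y Hu.
have HU := good_field_resolvent y.
have Hp := Rpower_pos (T - u) kap.
set P := Rpower (T - u) kap in Hp *.
have HkT := kernel_ok_exp rho T beta Hrho HT.
have HkG := kernel_ok_scal rho _ (RtoC G) HkT.
rewrite -(hankel_scal _ _ _ _ _ Hrho HkT HU HkG).
have HTu : T - u <= P * Tk.
  have {1}-> : T - u = P * Rpower (T - u) (1 - kap).
    rewrite /P -Rpower_plus; have -> : kap + (1 - kap) = 1 by ring.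
    rewrite Rpower_1 //; lra.
  apply: Rmult_le_compat_l; first lra.
  apply: Rpower_mono; lra.
pose k s psi := (exp_kernel u beta s psi * (inc_gamma alpha (s * (T - u)) psi - RtoC G) -
   RtoC G * (exp_kernel T beta s psi - exp_kernel u beta s psi))%C.
have main s psi M1 M2 : rho <= s -> Rabs psi <= phi ->
   Cmod (exp_kernel u (beta + kap) s psi) <= M1 ->
   (forall x, u <= x <= T -> Cmod (exp_kernel x (beta + 1) s psi) <= M2) ->
   Cmod (k s psi) <= P * (Kb * M1 + G * (2 * (M2 * Tk))).
  move=> Hs Hpsi HM1 HM2; apply: Rle_trans (Cmod_triangle _ _) _.
  rewrite Cmod_opp !Cmod_mult (Cmod_R G) (Rabs_pos_eq G); last lra.
  have e1 : Cmod (exp_kernel u beta s psi) * Cmod (inc_gamma alpha (s * (T - u)) psi - RtoC G)%C <= P * (Kb * M1).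
    have h := Bb (s * (T - u)) psi ltac:(apply: Rmult_lt_0_compat; lra) Hpsi.
    rewrite -Rpower_mult_distr in h; try lra.
    apply: Rle_trans (Rmult_le_compat_l _ _ _ (Cmod_ge_0 _) h) _.
    rewrite -/kap -/P.
    have -> : Cmod (exp_kernel u beta s psi) * (Kb * (Rpower s kap * P)) =
       P * (Kb * Cmod (exp_kernel u (beta + kap) s psi)).
      rewrite !Cmod_exp_kernel Rpower_plus; ring.
    apply: Rmult_le_compat_l; first lra.
    exact: Rmult_le_compat_l.
  have e2 : Cmod (exp_kernel T beta s psi - exp_kernel u beta s psi)%C <= 2 * M2 * Rabs (T - u).
    apply: (C_mean_value (fun h => exp_kernel h beta s psi) (fun h => exp_kernel h (beta + 1) s psi)) => x.
    rewrite Rmin_left ?Rmax_right; try lra; move=> Hx; split; last exact: HM2.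
    apply: derive_C_exp_kernel_h; lra.
  rewrite Rabs_pos_eq in e2; last lra.
  have HM20 : 0 <= M2 by apply: Rle_trans (Cmod_ge_0 _) (HM2 u ltac:(lra)).
  have e3 : G * Cmod (exp_kernel T beta s psi - exp_kernel u beta s psi)%C <= G * (2 * M2 * (P * Tk)).
    apply: Rmult_le_compat_l; first lra.
    apply: Rle_trans e2 _; apply: Rmult_le_compat_l; lra.
  have -> : P * (Kb * M1 + G * (2 * (M2 * Tk))) = P * (Kb * M1) + G * (2 * M2 * (P * Tk)) by ring.
  lra.
have Hfin := hankel_minus_norm rho (caputo_kernel delta u) (fun s psi => RtoC G * exp_kernel T beta s psi)%C k (resolvent_field y)
   (field_bound * norm y) (P * W1) c (P * W2) Hrho (kernel_ok_caputo rho delta u Hrho ltac:(lra)) HkG HU Hc _ _ _.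
have -> : (2 * (W1 / c * exp (- (c * rho))) + 2 * phi * (rho * W2)) * field_bound * P * norm y =
  (2 * (P * W1 / c * exp (- (c * rho))) + 2 * phi * (rho * (P * W2))) * (field_bound * norm y) by field; lra.
apply: Hfin.
- by move=> s psi _ _; rewrite /caputo_kernel /k -/beta; ring.
- move=> s psi Hs Hpsi; have Hpa := abs_ray psi Hpsi.
  have -> : P * W1 * exp (- (c * s)) = P * (Kb * (K1 * exp (- (c * s))) + G * (2 * (K2 * exp (- (c * s)) * Tk))).
    rewrite /W1; ring.
  apply: main => //; first by apply: B1 => //; lra.
  move=> x Hx; apply: B2 => //; lra.
- move=> psi Hpsi; rewrite /W2.
  apply: main => //; first lra.
    apply: exp_kernel_arc_le; lra.
  move=> x Hx; apply: exp_kernel_arc_le; lra.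
Qed.

Lemma norm_le_pow_eq (u v : X) K a : 0 < a -> 0 <= K ->
  (forall e, 0 < e < T / 2 -> norm (minus u v) <= K * Rpower e a) -> u = v.
Proof.
move=> Ha HK H.
apply: (norm_le_eps_eq (V := realify X) u v K) => eps Heps.
set e := Rmin (T / 4) (Rpower eps (/ a)).
have He : 0 < e by apply: Rmin_pos; [lra | exact: Rpower_pos].
have He1 : e <= T / 4 by exact: Rmin_l.
have He2 : e <= Rpower eps (/ a) by exact: Rmin_r.
refine (Rle_trans _ _ _ (H e ltac:(lra)) _).
apply: Rmult_le_compat_l => //.
have -> : eps = Rpower (Rpower eps (/ a)) a by rewrite Rpower_mult Rinv_l ?Rpower_1 //; lra.
apply: Rpower_mono; lra.
Qed.

(** Two radii give the same derivative in [u], by [hankel_shift], and the same limit as [u]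
    tends to [T]. *)
Lemma caputo_primitive_shift rho delta u y : r <= rho -> 0 < u < T ->
  caputo_primitive rho delta u y = caputo_primitive r delta u y.
Proof.
move=> Hrho Hu.
have [K1 [HK1 L1]] := caputo_primitive_lim rho delta Hrho.
have [K2 [HK2 L2]] := caputo_primitive_lim r delta (Rle_refl r).
have Hka : 0 < kap by rewrite /kap; lra.
have Hn := norm_ge_0 y.
apply: (norm_le_pow_eq _ _ ((K1 + K2) * norm y) kap) => //.
  apply: Rmult_le_pos; lra.
move=> e He.
pose D u : realify X := minus (caputo_primitive rho delta u y) (caputo_primitive r delta u y).
have HD v : 0 < v < T -> is_derive D v zero.
  move=> Hv.
  have -> : zero = minus (Cscal (RtoC (Rpower (T - v) (- alpha))) (hankel_res rho v delta y))
     (Cscal (RtoC (Rpower (T - v) (- alpha))) (hankel_res r v delta y)) :> realify X.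
    rewrite (hankel_shift v delta y r rho); [| lra | lra].
    by rewrite minus_eq_zero.
  apply: (is_derive_minus (V := realify X)); apply: caputo_primitive_derive => //; exact: Rle_refl.
have E v : u < v < T -> D u = D v.
  move=> Hv; apply: eq_is_derive; last lra.
  move=> x Hx; apply: HD; lra.
have bd v : T / 2 <= v < T -> norm (minus (caputo_primitive rho delta v y) (caputo_primitive r delta v y)) <=
   (K1 + K2) * norm y * Rpower (T - v) kap.
  move=> Hv.
  have h1 := L1 v y Hv; have h2 := L2 v y Hv.
  rewrite -(hankel_shift T _ y r rho) // in h1; last lra.
  set Q := scal _ _ in h1 h2.
  have -> : minus (caputo_primitive rho delta v y) (caputo_primitive r delta v y) =
    plus (minus (caputo_primitive rho delta v y) Q) (opp (minus (caputo_primitive r delta v y) Q)) by vlinC X.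
  apply: Rle_trans (norm_triangle _ _) _; rewrite norm_opp; lra.
case: (Rle_lt_dec (T - e) u) => Hue.
  apply: Rle_trans (bd u ltac:(lra)) _.
  apply: Rmult_le_compat_l; first by apply: Rmult_le_pos; lra.
  apply: Rpower_mono; lra.
(* the difference is constant in [u], hence equal to its value at [T - e] *)
have Euv : minus (caputo_primitive rho delta u y) (caputo_primitive r delta u y) =
   minus (caputo_primitive rho delta (T - e) y) (caputo_primitive r delta (T - e) y) by apply: (E (T - e)); lra.
rewrite Euv; have := bd (T - e) ltac:(lra).
by have -> : T - (T - e) = e by ring.
Qed.

(** On the path of radius [1 / s] the exponential is bounded on the arc and decays on the rays
    at the scale of the radius; there the kernel times the resolvent is
    [O(s^(1 + alpha - delta))], and the length of the path counts for [1 / s]. *)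
Lemma caputo_primitive_small delta : delta <= alpha -> exists K, 0 <= K /\ forall s y, 0 < s <= T / 2 -> s <= / r ->
  norm (caputo_primitive r delta s y) <= K * Rpower s (alpha - delta) * norm y.
Proof.
move=> Hdel.
have Hch := cos_half_pos phi phi_lt.
set M := 2 * Rpower (cos (phi / 2) * (T / 2)) (- alpha) * C0.
have HM : 0 < M.
  apply: Rmult_lt_0_compat => //; apply: Rmult_lt_0_compat; [lra | exact: Rpower_pos].
exists (M * (2 * / (- cos phi) + 2 * phi * exp 1)); split.
  apply: Rmult_le_pos; first lra.
  apply: Rplus_le_le_0_compat.
    have := Rinv_0_lt_compat _ Hcos; lra.
  apply: Rmult_le_pos; [lra | left; exact: exp_pos].
move=> s y Hs Hsr.
set rho := / s.
have Hrho : r <= rho.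
  rewrite /rho -(Rinv_inv r); apply: Rinv_le_contravar; lra.
have Hrho0 : 0 < rho by lra.
have Hsrho : s * rho = 1 by rewrite /rho Rinv_r //; lra.
rewrite -(caputo_primitive_shift rho) //; last lra.
set P := Rpower s (1 + alpha - delta).
have HP : 0 < P by exact: Rpower_pos.
have Hn := norm_ge_0 y.
have main x psi : rho <= x -> Rabs psi <= phi ->
   Cmod (caputo_kernel delta s x psi) * norm (resolvent_field y x psi) <= M * P * norm y * exp (s * (x * cos psi)).
  move=> Hx Hpsi.
  have Hx0 : 0 < x by lra.
  have b1 := inc_gamma_le_q alpha (x * (T - s)) psi phi ltac:(lra) ltac:(nra) (conj Hpsi (proj2 phi_lt)).
  have b2 : Rpower (cos (phi / 2) * (x * (T - s))) (- alpha) <=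
     Rpower (cos (phi / 2) * (T / 2)) (- alpha) * Rpower x (- alpha).
    rewrite Rpower_mult_distr //; last by apply: Rmult_lt_0_compat; lra.
    apply: Rpower_anti; last lra.
    split; first by repeat apply: Rmult_lt_0_compat => //; lra.
    have -> : cos (phi / 2) * (T / 2) * x = cos (phi / 2) * (x * (T / 2)) by ring.
    apply: Rmult_le_compat_l; first lra.
    apply: Rmult_le_compat_l; lra.
  have b3 := Hbound x psi y ltac:(lra) Hpsi.
  rewrite /caputo_kernel Cmod_mult Cmod_exp_kernel.
  have Hx1 : Rpower x (delta + alpha - 1) * Rpower x (- alpha) * Rpower x (- alpha) <= P.
    rewrite -!Rpower_plus.
    have -> : delta + alpha - 1 + - alpha + - alpha = - (1 + alpha - delta) by ring.
    have -> : P = Rpower rho (- (1 + alpha - delta)).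
      by rewrite /P /rho /Rpower ln_Rinv; [congr exp; ring | lra].
    apply: Rpower_anti; lra.
  set E := exp (s * (x * cos psi)).
  have HE : 0 < E by exact: exp_pos.
  have Hq1 := Rpower_pos x (delta + alpha - 1).
  have Hq2 := Rpower_pos x (- alpha).
  have Hq3 := Rpower_pos (cos (phi / 2) * (T / 2)) (- alpha).
  apply: Rle_trans (_ : E * Rpower x (delta + alpha - 1) *
     (2 * (Rpower (cos (phi / 2) * (T / 2)) (- alpha) * Rpower x (- alpha))) *
     (C0 * Rpower x (- alpha) * norm y) <= _).
    apply: Rmult_le_compat => //.
    - apply: Rmult_le_pos; [nra | exact: Cmod_ge_0].
    - exact: norm_ge_0.
    - apply: Rmult_le_compat_l; first nra.
      lra.
  have -> : E * Rpower x (delta + alpha - 1) *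
     (2 * (Rpower (cos (phi / 2) * (T / 2)) (- alpha) * Rpower x (- alpha))) *
     (C0 * Rpower x (- alpha) * norm y) =
     M * (Rpower x (delta + alpha - 1) * Rpower x (- alpha) * Rpower x (- alpha)) * norm y * E.
    rewrite /M; ring.
  apply: Rmult_le_compat_r; first lra.
  apply: Rmult_le_compat_r; first lra.
  by apply: Rmult_le_compat_l; first lra.
have Hc : 0 < s * - cos phi by apply: Rmult_lt_0_compat; lra.
have Hk := kernel_ok_caputo rho delta s Hrho ltac:(lra).
have H := hankel_norm rho (caputo_kernel delta s) (resolvent_field y) _ (M * P * norm y) (s * - cos phi)
   (M * P * norm y * exp 1) Hrho Hk (good_field_resolvent y) Hc.
apply: Rle_trans (H _ _) _.
- move=> x psi Hx Hpsi; apply: Rle_trans (main x psi Hx (abs_ray psi Hpsi)) _.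
  rewrite (cos_ray psi Hpsi); right; congr (_ * exp _); ring.
- move=> psi Hpsi; apply: Rle_trans (main rho psi (Rle_refl _) Hpsi) _.
  apply: Rmult_le_compat_l.
    by apply: Rmult_le_pos => //; apply: Rmult_le_pos; lra.
  apply: exp_le.
  have -> : s * (rho * cos psi) = cos psi by rewrite -Rmult_assoc Hsrho Rmult_1_l.
  have := COS_bound psi; lra.
have EP : P = Rpower s (alpha - delta) * s.
  rewrite /P -{3}(Rpower_1 s); last lra.
  rewrite -Rpower_plus; congr Rpower; ring.
have He1 : exp (- (s * - cos phi * rho)) <= 1.
  rewrite -exp_0; apply: exp_le.
  have -> : s * - cos phi * rho = s * rho * - cos phi by ring.
  rewrite Hsrho; lra.
have HQ := Rpower_pos s (alpha - delta).
have -> : M * (2 * / (- cos phi) + 2 * phi * exp 1) * Rpower s (alpha - delta) * norm y =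
  2 * (M * P * norm y / (s * - cos phi) * 1) + 2 * phi * (rho * (M * P * norm y * exp 1)).
  rewrite EP /rho; field; lra.
apply: Rplus_le_compat_r; apply: Rmult_le_compat_l; first lra.
apply: Rmult_le_compat_l => //.
apply: Rmult_le_pos; last by left; exact: Rinv_0_lt_compat.
by apply: Rmult_le_pos => //; apply: Rmult_le_pos; lra.
Qed.

Lemma hankel_exp_continuous beta y u : 0 < u ->
  continuous (U := realify X) (fun u => hankel_res r u beta y) u.
Proof.
move=> Hu.
apply: (ex_derive_continuous (V := realify X) (fun u => hankel_res r u beta y)).
eexists; exact: (hankel_exp_derive r beta _ _ u (Rle_refl r) Hu (good_field_resolvent y)).
Qed.

Lemma is_RInt_caputo_primitive delta y s u : 0 < s <= u -> u < T ->
  is_RInt (V := realify X)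
    (fun v => Cscal (RtoC (Rpower (T - v) (- alpha))) (hankel_res r v delta y) : X) s u
    (minus (caputo_primitive r delta u y) (caputo_primitive r delta s y)).
Proof.
move=> Hs Hu.
apply: (is_RInt_derive (V := realify X) (fun v => caputo_primitive r delta v y)) => v;
  rewrite Rmin_left ?Rmax_right; try lra; move=> Hv.
  apply: caputo_primitive_derive; [exact: Rle_refl | lra].
apply: (continuous_scal (V := realify X) (fun v => Rpower (T - v) (- alpha)) (fun v => hankel_res r v delta y)).
  apply: (continuous_comp (fun v => T - v) (fun x => Rpower x (- alpha))).
    apply: (ex_derive_continuous (fun v => T - v)); auto_derive; exact I.
  apply: continuous_of_derive (is_derive_Rpower (T - v) (- alpha) _); lra.
apply: hankel_exp_continuous; lra.
Qed.

Lemma hankel_exp_le beta : exists K, 0 <= K /\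
  forall (U : R -> R -> X) B, good_field U B -> norm (hankel r (exp_kernel T beta) U) <= K * B.
Proof.
have [K [HK HB]] := exp_kernel_ray_le T beta HT.
set c := T * - cos phi / 2.
have Hc : 0 < c by rewrite /c; nra.
set L := exp (T * r) * Rpower r beta.
have HL : 0 < L by apply: Rmult_lt_0_compat; [exact: exp_pos | exact: Rpower_pos].
have He := exp_pos (- (c * r)).
exists (2 * (K / c * exp (- (c * r))) + 2 * phi * (r * L)); split.
  apply: Rplus_le_le_0_compat.
    have : 0 < K / c by exact: Rdiv_lt_0_compat.
    nra.
  apply: Rmult_le_pos; nra.
move=> U B HU.
have Hk := kernel_ok_exp r T beta (Rle_refl r) HT.
have H := hankel_norm r _ U B (K * B) c (L * B) (Rle_refl r) Hk HU Hc.
have -> : (2 * (K / c * exp (- (c * r))) + 2 * phi * (r * L)) * B =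
  2 * (K * B / c * exp (- (c * r))) + 2 * phi * (r * (L * B)) by field; lra.
apply: H.
- move=> s psi Hs Hpsi.
  have -> : K * B * exp (- (c * s)) = K * exp (- (c * s)) * B by ring.
  apply: Rmult_le_compat; [exact: Cmod_ge_0 | exact: norm_ge_0 | apply: HB => //; lra |].
  apply: (proj1 HU) => //; exact: abs_ray.
- move=> psi Hpsi; apply: Rmult_le_compat; [exact: Cmod_ge_0 | exact: norm_ge_0 | apply: exp_kernel_arc_le; lra |].
  apply: (proj1 HU) => //; lra.
Qed.

Lemma resolvent_field_plus y z s psi : r <= s -> Rabs psi <= phi ->
  resolvent_field (plus y z) s psi = plus (resolvent_field y s psi) (resolvent_field z s psi).
Proof. by move=> *; apply: resolvent_plus; apply: Hres. Qed.

Lemma resolvent_field_scal (k : C) y s psi : r <= s -> Rabs psi <= phi ->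
  resolvent_field (Cscal k y) s psi = Cscal k (resolvent_field y s psi).
Proof. by move=> *; apply: resolvent_scal; apply: Hres. Qed.

Lemma resolvent_field_minus y z s psi : r <= s -> Rabs psi <= phi ->
  resolvent_field (minus y z) s psi = minus (resolvent_field y s psi) (resolvent_field z s psi).
Proof.
move=> Hs Hpsi.
have -> : minus y z = plus y (Cscal (RtoC (-1)) z) by vlinC X.
by rewrite resolvent_field_plus // resolvent_field_scal //; vlinC X.
Qed.

Lemma resolvent_field_comm y s psi s' psi' : r <= s -> Rabs psi <= phi -> r <= s' -> Rabs psi' <= phi ->
  resolvent_field (resolvent_field y s psi) s' psi' = resolvent_field (resolvent_field y s' psi') s psi.
Proof. by move=> *; apply: resolvent_comm; apply: Hres. Qed.

Lemma complex_linear_resolvent s psi : r <= s -> Rabs psi <= phi ->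
  complex_linear (fun y => resolvent_field y s psi).
Proof.
move=> Hs Hpsi; split; first by move=> *; apply: resolvent_field_plus.
split; first by move=> *; apply: resolvent_field_scal.
by exists field_bound; split; [exact: field_bound_pos | move=> y; exact: resolvent_field_le].
Qed.

Lemma hankel_resolvent_minus k y z : kernel_ok r k ->
  hankel r k (resolvent_field (minus y z)) = minus (hankel r k (resolvent_field y)) (hankel r k (resolvent_field z)).
Proof.
move=> Hk.
have H y' := hankel_correct r k _ _ (Rle_refl r) Hk (good_field_resolvent y').
apply: is_hankel_unique (H _) _.
apply: is_hankel_ext (is_hankel_minus _ _ _ _ _ _ (H y) (H z)); first lra.
by move=> s psi Hs Hpsi; rewrite resolvent_field_minus //; vlinC X.
Qed.

Lemma resolvent_field_hankel k y s psi : kernel_ok r k -> r <= s -> Rabs psi <= phi ->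
  resolvent_field (hankel r k (resolvent_field y)) s psi = hankel r k (resolvent_field (resolvent_field y s psi)).
Proof.
move=> Hk Hs Hpsi.
have H y' := hankel_correct r k _ _ (Rle_refl r) Hk (good_field_resolvent y').
apply: is_hankel_unique (is_hankel_linear _ _ _ _ _ (complex_linear_resolvent s psi Hs Hpsi) (H y)) _.
apply: is_hankel_ext (H (resolvent_field y s psi)); first lra.
by move=> s' psi' Hs' Hpsi'; rewrite resolvent_field_scal // resolvent_field_comm.
Qed.

Let r0 : Rabs 0 <= phi.
Proof. rewrite Rabs_R0; lra. Qed.

Definition resolvent0 (y : X) : X := resolvent_field y r 0.

(** The value of the resolvent determines the right-hand side of the equation it solves. *)
Lemma resolvent0_inj y z : resolvent0 y = resolvent0 z -> y = z.
Proof.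
move=> E; have Hw := Hres r 0 (Rle_refl r) r0.
have [_ <-] := resolvent_solves A (lambda_pow r 0) y Hw.
have [_ <-] := resolvent_solves A (lambda_pow r 0) z Hw.
by rewrite -/(resolvent_field y r 0) -/(resolvent_field z r 0) -/(resolvent0 y) -/(resolvent0 z) E.
Qed.

Lemma resolvent0_dom y : dom A (resolvent0 y).
Proof. exact: resolvent_dom (Hres r 0 (Rle_refl r) r0). Qed.

Notation sigma y := (hankel_res r T (alpha - 1) y).

Let kerT_ok beta : kernel_ok r (exp_kernel T beta).
Proof. by apply: kernel_ok_exp => //; exact: Rle_refl. Qed.

(** By the resolvent identity the integrand is the image under [resolvent0] of
    [y + (w0 - lambda^alpha) R(lambda^alpha) y] times the kernel.  So the integral is in the
    range of [resolvent0]. *)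
Lemma sigma_spec y : dom A (sigma y) /\
  is_hankel r phi (fun s psi => minus (Cscal (exp_kernel T (alpha - 1 + alpha) s psi) (resolvent_field y s psi))
     (Cscal (exp_kernel T (alpha - 1) s psi) y)) (A (sigma y)).
Proof.
have H1 := is_hankel_res r _ y (Rle_refl r) (kerT_ok (alpha - 1)).
have H2 := is_hankel_res r _ y (Rle_refl r) (kerT_ok (alpha - 1 + alpha)).
have H3 := hankel_correct r _ _ _ (Rle_refl r) (kerT_ok (alpha - 1)) (good_field_const y).
set w0 := lambda_pow r 0.
have HY := is_hankel_plus _ _ _ _ _ _ H3 (is_hankel_minus _ _ _ _ _ _ (is_hankel_scal w0 _ _ _ _ H1) H2).
set Y := plus _ _ in HY.
have Hw0 := Hres r 0 (Rle_refl r) r0.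
have E : resolvent0 Y = sigma y.
  apply: is_hankel_unique (is_hankel_linear _ _ _ _ _ (complex_linear_resolvent r 0 (Rle_refl r) r0) HY) _.
  apply: is_hankel_ext H1; first lra.
  move=> s psi Hs Hpsi.
  have Hr1 := Rle_refl r.
  rewrite resolvent_field_plus // resolvent_field_minus // !resolvent_field_scal //.
  rewrite -(exp_kernel_mult_pow T (alpha - 1) alpha) -/(lambda_pow s psi); last lra.
  have D := resolvent_field_diff y r 0 s psi Hr1 r0 Hs Hpsi.
  rewrite resolvent_field_comm // in D.
  have {1}-> : resolvent_field y s psi = plus (resolvent_field y r 0) (minus (resolvent_field y s psi) (resolvent_field y r 0)) by vlinC X.
  rewrite D -/w0; by vlinC X.
split; first by rewrite -E; exact: resolvent0_dom.
have -> : A (sigma y) = minus (hankel r (exp_kernel T (alpha - 1 + alpha)) (resolvent_field y))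
     (hankel r (exp_kernel T (alpha - 1)) (fun _ _ => y)).
  rewrite -E app_resolvent // -/(resolvent_field Y r 0) -/(resolvent0 Y) E /Y -/w0; by vlinC X.
exact: is_hankel_minus H2 H3.
Qed.

Lemma app_sigma_dom x : dom A x -> A (sigma x) = sigma (A x).
Proof.
move=> Hx; have [_ H] := sigma_spec x.
have H1 := is_hankel_res r _ (A x) (Rle_refl r) (kerT_ok (alpha - 1)).
apply: is_hankel_unique H _; apply: is_hankel_ext H1; first lra.
move=> s psi Hs Hpsi.
rewrite -(exp_kernel_mult_pow T (alpha - 1) alpha) -/(lambda_pow s psi); last lra.
rewrite {1}/resolvent_field resolvent_app //; last exact: Hres.
by rewrite /resolvent_field; vlinC X.
Qed.

Lemma resolvent0_app_sigma y : resolvent0 (A (sigma y)) = A (sigma (resolvent0 y)).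
Proof.
have [_ H] := sigma_spec y; have [_ H'] := sigma_spec (resolvent0 y).
apply: is_hankel_unique (is_hankel_linear _ _ _ _ _ (complex_linear_resolvent r 0 (Rle_refl r) r0) H) _.
apply: is_hankel_ext H'; first lra.
move=> s psi Hs Hpsi; have Hr1 := Rle_refl r.
by rewrite resolvent_field_minus // !resolvent_field_scal // /resolvent0 (resolvent_field_comm y r 0 s psi).
Qed.

Lemma app_sigma_le : exists K, 0 <= K /\ forall y, norm (A (sigma y)) <= K * norm y.
Proof.
have [K1 [HK1 B1]] := hankel_exp_le (alpha - 1 + alpha).
have [K2 [HK2 B2]] := hankel_exp_le (alpha - 1).
exists (K1 * field_bound + K2); split; first by have := field_bound_pos; nra.
move=> y; have [_ H] := sigma_spec y.
have H2 := is_hankel_res r _ y (Rle_refl r) (kerT_ok (alpha - 1 + alpha)).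
have H3 := hankel_correct r _ _ _ (Rle_refl r) (kerT_ok (alpha - 1)) (good_field_const y).
rewrite (is_hankel_unique _ _ _ _ _ H (is_hankel_minus _ _ _ _ _ _ H2 H3)).
apply: Rle_trans (norm_triangle _ _) _; rewrite norm_opp.
have b1 := B1 _ _ (good_field_resolvent y); have b2 := B2 _ _ (good_field_const y).
have -> : (K1 * field_bound + K2) * norm y = K1 * (field_bound * norm y) + K2 * norm y by ring.
lra.
Qed.

Lemma app_sigma_minus y z : A (sigma (minus y z)) = minus (A (sigma y)) (A (sigma z)).
Proof.
have [Hy _] := sigma_spec y; have [Hz _] := sigma_spec z.
rewrite hankel_resolvent_minus //.
have E u v : minus u v = plus u (Cscal (RtoC (-1)) v) :> X by vlinC X.
rewrite !E app_plus //; last exact: dom_scal.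
by rewrite app_scal.
Qed.

(** The primitive [e^(u lambda) / u] vanishes at both ends of the path. *)
Lemma hankel_exp_zero u (x : X) : 0 < u ->
  is_hankel r phi (fun s psi => Cscal (exp_kernel u 0 s psi) x) zero.
Proof.
move=> Hu.
have Hu0 : RtoC u <> 0%C by move=> /RtoC_inj; lra.
pose P s psi : X := Cscal (RtoC (/ u) * exp_kernel u 0 s psi)%C x.
have [K [HK B]] := exp_kernel_ray_le u 0 Hu.
set c := u * - cos phi / 2 in B.
have Hc : 0 < c by rewrite /c; nra.
have ray psi : psi = phi \/ psi = - phi ->
   ray_integral r psi (fun s psi => Cscal (exp_kernel u 0 s psi) x) (minus zero (P r psi)).
  move=> Hpsi.
  apply: (is_RInt_gen_primitive (V := realify X) _ (fun s => P s psi)).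
  - apply: at_point_eventually => b /= Hb.
    apply: (is_RInt_ext (V := realify X) (fun s => Cscal (polar 1 psi * exp_kernel u 0 s psi)%C x)).
      by move=> s _; rewrite scal_assoc.
    apply: (is_RInt_scal_C (fun s => RtoC (/ u) * exp_kernel u 0 s psi)%C) => // s Hs.
    have Hd := derive_C_exp_kernel_s u 0 s psi ltac:(lra).
    split; last by eexists; apply: derive_C_mult Hd; exact: derive_C_const.
    apply: derive_C_eq (derive_C_mult _ _ _ _ _ (derive_C_const (RtoC (/ u)) s) Hd).
    rewrite RtoC_inv; last lra.
    by field.
  - move=> Q HQ; exact: locally_singleton.
  - apply/(filterlim_locally (U := realify X)) => eps.
    have [b Hb] := proj1 (filterlim_locally _ _)
      (filterlim_scal_exp_decay (/ u * K * norm x) c Hc) eps.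
    exists (Rmax b r) => s Hs.
    have Hsb : b < s by have := Rmax_l b r; lra.
    have Hsr : r <= s by have := Rmax_r b r; lra.
    apply: (norm_compat1 (V := realify X)).
    have := Hb s Hsb; rewrite /ball /= /AbsRing_ball /abs /minus /plus /opp /=.
    rewrite Ropp_0 Rplus_0_r => /(Rle_lt_trans _ _ _ (Rle_abs _)) H.
    apply: Rle_lt_trans H.
    have -> : norm (minus (P s psi) zero : realify X) = norm (P s psi).
      congr norm; by vlinC X.
    apply: Rle_trans (norm_Cscal _ _) _.
    rewrite Cmod_mult Cmod_R Rabs_pos_eq; last by left; exact: Rinv_0_lt_compat.
    have h := B u s psi (Rle_refl u) Hsr Hpsi.
    have -> : / u * K * norm x * exp (- (c * s)) = / u * (K * exp (- (c * s))) * norm x by ring.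
    apply: Rmult_le_compat_r; first exact: norm_ge_0.
    apply: Rmult_le_compat_l => //; left; exact: Rinv_0_lt_compat.
have arc : arc_integral r phi (fun s psi => Cscal (exp_kernel u 0 s psi) x)
    (minus (P r phi) (P r (- phi))).
  apply: (is_RInt_ext (V := realify X) (fun psi => Cscal (Ci * polar r psi * exp_kernel u 0 r psi)%C x)).
    by move=> psi _; rewrite scal_assoc.
  apply: (is_RInt_scal_C (fun psi => RtoC (/ u) * exp_kernel u 0 r psi)%C) => [|psi _]; first lra.
  have Hd := derive_C_exp_kernel_psi u 0 r psi.
  split; last first.
    eexists; apply: derive_C_mult Hd.
    by apply: derive_C_mult; [exact: derive_C_const | exact: derive_C_polar_psi].
  apply: derive_C_eq (derive_C_mult _ _ _ _ _ (derive_C_const (RtoC (/ u)) psi) Hd).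
  rewrite RtoC_inv; last lra.
  by field.
exists (minus zero (P r phi)), (minus zero (P r (- phi))), (minus (P r phi) (P r (- phi))).
split; first by apply: ray; left.
split; first by apply: ray; right.
split=> //; by vlinC X.
Qed.

(** From [lambda^alpha R(lambda^alpha) x = x + R(lambda^alpha) A x]; the first term
    integrates to [0]. *)
Lemma hankel_dom u x : 0 < u -> dom A x -> hankel_res r u alpha x = hankel_res r u 0 (A x).
Proof.
move=> Hu Hx.
have Hk beta : kernel_ok r (exp_kernel u beta) by apply: kernel_ok_exp => //; exact: Rle_refl.
have H1 := is_hankel_res r _ x (Rle_refl r) (Hk alpha).
have H2 := is_hankel_res r _ (A x) (Rle_refl r) (Hk 0).
have H3 := is_hankel_plus _ _ _ _ _ _ (hankel_exp_zero u x Hu) H2.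
rewrite plus_zero_l in H3.
apply: is_hankel_unique H1 _; apply: is_hankel_ext H3; first lra.
move=> s psi Hs Hpsi.
have -> : exp_kernel u alpha s psi = (lambda_pow s psi * exp_kernel u 0 s psi)%C.
  rewrite /lambda_pow exp_kernel_mult_pow; [by rewrite Rplus_0_l | lra].
rewrite {1}/resolvent_field resolvent_app //; last exact: Hres.
by rewrite /resolvent_field; vlinC X.
Qed.

Definition caputo_partial (s u : R) (y : X) : X := minus (caputo_primitive r alpha u y) (caputo_primitive r alpha s y).

Lemma is_RInt_caputo_partial s u y : 0 < s <= u -> u < T ->
  is_RInt (V := realify X)
    (fun v => Cscal (RtoC (Rpower (T - v) (- alpha))) (hankel_res r v alpha y) : X) s u
    (caputo_partial s u y).
Proof. exact: is_RInt_caputo_primitive. Qed.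

Lemma caputo_partial_dom s u x : 0 < s <= u -> u < T -> dom A x ->
  caputo_partial s u x = minus (caputo_primitive r 0 u (A x)) (caputo_primitive r 0 s (A x)).
Proof.
move=> Hs Hu Hx.
have H1 := is_RInt_caputo_primitive alpha x s u Hs Hu.
have H2 := is_RInt_caputo_primitive 0 (A x) s u Hs Hu.
rewrite /caputo_partial -(is_RInt_unique (V := realify X) _ _ _ _ H1).
rewrite -(is_RInt_unique (V := realify X) _ _ _ _ H2).
apply: (RInt_ext (V := realify X)) => v.
rewrite Rmin_left ?Rmax_right; try lra; move=> Hv.
by rewrite hankel_dom //; lra.
Qed.

Lemma caputo_partial_minus s u y z : 0 < s < T -> 0 < u < T ->
  caputo_partial s u (minus y z) = minus (caputo_partial s u y) (caputo_partial s u z).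
Proof.
move=> Hs Hu; rewrite /caputo_partial /caputo_primitive !hankel_resolvent_minus; try by apply: kernel_ok_caputo => //; exact: Rle_refl.
by vlinC X.
Qed.

Notation G := (Gamma (1 - alpha)).

Lemma caputo_partial_lim_dom x : dom A x -> exists K, 0 <= K /\ forall s u,
  0 < s <= T / 2 -> s <= / r -> T / 2 <= u < T ->
  norm (minus (caputo_partial s u x) (Cscal (RtoC G) (A (sigma x)))) <=
    K * (Rpower (T - u) kap + Rpower s alpha).
Proof.
move=> Hx.
have [K1 [HK1 B1]] := caputo_primitive_lim r 0 (Rle_refl r).
have [K2 [HK2 B2]] := caputo_primitive_small 0 ltac:(lra).
have Hn := norm_ge_0 (A x).
exists (K1 * norm (A x) + K2 * norm (A x)); split; first nra.
move=> s u Hs Hsr Hu.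
rewrite caputo_partial_dom //; try lra.
rewrite app_sigma_dom //.
have b1 := B1 u (A x) Hu; have b2 := B2 s (A x) Hs Hsr.
rewrite Rplus_0_l in b1; rewrite Rminus_0_r in b2.
set Q := scal _ _ in b1 *.
have -> : minus (minus (caputo_primitive r 0 u (A x)) (caputo_primitive r 0 s (A x))) Q =
  plus (minus (caputo_primitive r 0 u (A x)) Q) (opp (caputo_primitive r 0 s (A x))) by vlinC X.
apply: Rle_trans (norm_triangle _ _) _; rewrite norm_opp.
have := Rpower_pos (T - u) kap; have := Rpower_pos s alpha => p1 p2.
have q1 : 0 <= K1 * norm (A x) * Rpower s alpha by apply: Rmult_le_pos; nra.
have q2 : 0 <= K2 * norm (A x) * Rpower (T - u) kap by apply: Rmult_le_pos; nra.
lra.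
Qed.

(** Here [delta = alpha], and the value of the primitive at [s] does not tend to [0] but is
    bounded by a multiple of the norm of [y]. *)
Lemma caputo_partial_bound : exists K, 0 <= K /\ forall s u y,
  0 < s <= T / 2 -> s <= / r -> T / 2 <= u < T -> norm (caputo_partial s u y) <= K * norm y.
Proof.
have [K1 [HK1 B1]] := caputo_primitive_lim r alpha (Rle_refl r).
have [K2 [HK2 B2]] := caputo_primitive_small alpha (Rle_refl alpha).
have [K3 [HK3 B3]] := hankel_exp_le (alpha + alpha - 1).
have HG := Gamma_pos alpha Hal.
have HCr := field_bound_pos.
have Hka : 0 < kap by rewrite /kap; lra.
have HP := Rpower_pos T kap.
have q1 : 0 <= K1 * Rpower T kap by nra.
have q2 : 0 <= G * (K3 * field_bound) by apply: Rmult_le_pos; nra.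
exists (K1 * Rpower T kap + G * (K3 * field_bound) + K2); split; first lra.
move=> s u y Hs Hsr Hu.
have Hn := norm_ge_0 y.
have b1 := B1 u y Hu; have b2 := B2 s y Hs Hsr; have b3 := B3 _ _ (good_field_resolvent y).
have Es : Rpower s (alpha - alpha) = 1.
  by rewrite Rminus_diag /Rpower Rmult_0_l exp_0.
rewrite Es Rmult_1_r in b2.
have b1' : K1 * Rpower (T - u) kap * norm y <= K1 * Rpower T kap * norm y.
  apply: Rmult_le_compat_r => //; apply: Rmult_le_compat_l => //.
  apply: Rpower_mono; lra.
(* near [T] the primitive is close to its limit, which is bounded by the norm of [y] *)
set Q := hankel_res r T (alpha + alpha - 1) y in b1 b3.
have b4 : norm (Cscal (RtoC G) Q) <= G * (K3 * (field_bound * norm y)).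
  apply: Rle_trans (norm_Cscal _ _) _; rewrite Cmod_R Rabs_pos_eq; last lra.
  apply: Rmult_le_compat_l; lra.
have -> : caputo_partial s u y = plus (plus (minus (caputo_primitive r alpha u y) (Cscal (RtoC G) Q))
   (Cscal (RtoC G) Q)) (opp (caputo_primitive r alpha s y)) by rewrite /caputo_partial; vlinC X.
apply: Rle_trans (norm_triangle _ _) _; rewrite norm_opp.
apply: Rle_trans (Rplus_le_compat_r _ _ _ (norm_triangle _ _)) _.
have -> : (K1 * Rpower T kap + G * (K3 * field_bound) + K2) * norm y =
  K1 * Rpower T kap * norm y + G * (K3 * (field_bound * norm y)) + K2 * norm y by ring.
lra.
Qed.

Definition tends_to (F : R -> R -> X) (l : X) : Prop :=
  forall eps, 0 < eps -> exists d, 0 < d /\ forall s u, 0 < s < d -> T - d < u < T ->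
    norm (minus (F s u) l) < eps.

Lemma caputo_partial_tends_dom x : dom A x ->
  tends_to (fun s u => caputo_partial s u x) (Cscal (RtoC G) (A (sigma x))).
Proof.
move=> Hx eps Heps.
have [K [HK B]] := caputo_partial_lim_dom x Hx.
have Hka : 0 < kap by rewrite /kap; lra.
have He : 0 < eps / (2 * (K + 1)) by apply: Rdiv_lt_0_compat; lra.
have [d1 [Hd1 H1]] := Rpower_small kap _ Hka He.
have [d2 [Hd2 H2]] := Rpower_small alpha _ (proj1 Hal) He.
have Hri := Rinv_0_lt_compat _ Hr.
exists (Rmin (Rmin d1 d2) (Rmin (T / 2) (/ r))); split.
  by repeat apply: Rmin_pos => //; lra.
move=> s u Hs Hu.
have m1 := Rmin_l (Rmin d1 d2) (Rmin (T / 2) (/ r)).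
have m2 := Rmin_r (Rmin d1 d2) (Rmin (T / 2) (/ r)).
have m3 := Rmin_l d1 d2; have m4 := Rmin_r d1 d2.
have m5 := Rmin_l (T / 2) (/ r); have m6 := Rmin_r (T / 2) (/ r).
apply: Rle_lt_trans (B s u _ _ _) _; try lra.
have h1 := H1 (T - u) ltac:(lra); have h2 := H2 s ltac:(lra).
apply: Rle_lt_trans (_ : K * (eps / (K + 1)) < _).
  apply: Rmult_le_compat_l => //.
  have -> : eps / (K + 1) = eps / (2 * (K + 1)) + eps / (2 * (K + 1)) by field; lra.
  lra.
have -> : K * (eps / (K + 1)) = eps - eps / (K + 1) by field; lra.
have : 0 < eps / (K + 1) by apply: Rdiv_lt_0_compat; lra.
lra.
Qed.

(** The bound of [caputo_partial_bound] is uniform in [s] and [u], so the limits known on the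
    domain pass to its closure. *)
Lemma caputo_partial_tends y : closure (T := X) (dom A) y ->
  tends_to (fun s u => caputo_partial s u y) (Cscal (RtoC G) (A (sigma y))).
Proof.
move=> Hy eps Heps.
have [K [HK B]] := caputo_partial_bound; have [L [HL D]] := app_sigma_le.
have HG := Gamma_pos alpha Hal.
have Hden : 0 < 4 * (K + G * L + 1).
  have : 0 <= G * L by nra. lra.
have Hn : 0 < eps / (4 * (K + G * L + 1)) by exact: Rdiv_lt_0_compat.
have Hf := norm_factor_gt_0 (V := X).
have Hb : 0 < eps / (4 * (K + G * L + 1)) / norm_factor (V := X) by exact: Rdiv_lt_0_compat.
(* the factor [4] leaves room for the two error terms that are multiples of [norm (minus y x)] *)
have [x [Hball Hx]] := Hy (mkposreal _ Hb).
have Hyx : norm (minus y x) < eps / (4 * (K + G * L + 1)).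
  have := norm_compat2 _ _ _ Hball => /=.
  have -> : norm_factor (V := X) * (eps / (4 * (K + G * L + 1)) / norm_factor (V := X)) =
     eps / (4 * (K + G * L + 1)) by field; lra.
  by rewrite -opp_minus norm_opp.
have [d [Hd H]] := caputo_partial_tends_dom x Hx (eps / 2) ltac:(lra).
have Hri := Rinv_0_lt_compat _ Hr.
exists (Rmin d (Rmin (T / 2) (/ r))); split.
  by repeat apply: Rmin_pos => //; lra.
move=> s u Hs Hu.
have m1 := Rmin_l d (Rmin (T / 2) (/ r)); have m2 := Rmin_r d (Rmin (T / 2) (/ r)).
have m5 := Rmin_l (T / 2) (/ r); have m6 := Rmin_r (T / 2) (/ r).
have h1 := H s u ltac:(lra) ltac:(lra).
have h2 := B s u (minus y x) ltac:(lra) ltac:(lra) ltac:(lra).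
have h3 := D (minus y x).
rewrite caputo_partial_minus in h2; try lra.
rewrite app_sigma_minus in h3.
have -> : minus (caputo_partial s u y) (Cscal (RtoC G) (A (sigma y))) =
  plus (plus (minus (caputo_partial s u y) (caputo_partial s u x))
   (minus (caputo_partial s u x) (Cscal (RtoC G) (A (sigma x)))))
   (Cscal (RtoC (- G)) (minus (A (sigma y)) (A (sigma x)))).
  by rewrite RtoC_opp; vlinC X.
apply: Rle_lt_trans (norm_triangle _ _) _.
apply: Rle_lt_trans (Rplus_le_compat_r _ _ _ (norm_triangle _ _)) _.
have h4 : norm (Cscal (RtoC (- G)) (minus (A (sigma y)) (A (sigma x)))) <= G * (L * norm (minus y x)).
  apply: Rle_trans (norm_Cscal _ _) _; rewrite Cmod_R Rabs_Ropp Rabs_pos_eq; last lra.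
  by apply: Rmult_le_compat_l; lra.
have h5 : (K + G * L) * norm (minus y x) <= eps / 4.
  apply: Rle_trans (_ : (K + G * L) * (eps / (4 * (K + G * L + 1))) <= _).
    apply: Rmult_le_compat_l; [nra | lra].
  have -> : (K + G * L) * (eps / (4 * (K + G * L + 1))) = eps / 4 - eps / (4 * (K + G * L + 1)) by field; nra.
  lra.
have : (K + G * L) * norm (minus y x) = K * norm (minus y x) + G * (L * norm (minus y x)) by ring.
lra.
Qed.

Notation c0 := (/ (2 * PI * Ci))%C.

Lemma hankel_integral_eq (F : C -> X) l :
  is_hankel r phi (fun s psi => F (polar s psi)) l -> hankel_integral r phi F = l.
Proof.
move=> [l1 [l2 [l3 [h1 [h2 [h3 ->]]]]]].
by rewrite /hankel_integral (is_RInt_gen_unique (V := realify X) _ _ h1)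
  (is_RInt_gen_unique (V := realify X) _ _ h2) (is_RInt_unique (V := realify X) _ _ _ _ h3).
Qed.

Lemma resolvent_family_eq u y : 0 < u ->
  resolvent_family A alpha r phi u y = Cscal c0 (hankel_res r u (alpha - 1) y).
Proof.
move=> Hu; rewrite /resolvent_family; case: Req_EM_T => [|_]; first lra.
congr scal; apply: hankel_integral_eq.
have Hk := kernel_ok_exp r u (alpha - 1) (Rle_refl r) Hu.
apply: is_hankel_ext (is_hankel_res r _ y (Rle_refl r) Hk); first lra.
move=> s psi Hs Hpsi.
have Hs0 : 0 < s by lra.
have Hpp : - PI < psi < PI by move: Hpsi => /Rabs_le_between; lra.
rewrite !Cpow_polar // -/(lambda_pow s psi) -/(resolvent_field y s psi); congr (scal _ _).
rewrite -(Cexp_polar _ _ (Rpower_pos s (alpha - 1))) -Cexp_plus /exp_kernel; congr Cexp.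
have -> : (ln (Rpower s (alpha - 1)), (alpha - 1) * psi) = (RtoC (alpha - 1) * (ln s, psi))%C.
  by rewrite /Rpower ln_exp /Cmult /=; congr pair; ring.
by rewrite (Cmult_comm (polar s psi)).
Qed.

Context (ti t : R).
Hypothesis Ht : t - ti = T.

Let g (y : X) (s : R) : X := resolvent_family A alpha r phi (s - ti) y.
Let dg (y : X) (s : R) : X := Cscal c0 (hankel_res r (s - ti) alpha y).

Lemma family_derive y s : ti < s -> is_derive (V := realify X) (g y) s (dg y s).
Proof.
move=> Hs.
apply: (is_derive_ext_loc (V := realify X) (fun s => Cscal c0 (hankel_res r (s - ti) (alpha - 1) y))).
  have Hd : 0 < s - ti by lra.
  exists (mkposreal _ Hd) => x Hx; rewrite /g resolvent_family_eq //.
  move: Hx; rewrite /ball /= /AbsRing_ball /abs /minus /plus /opp /= => /Rabs_def2; lra.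
apply: (is_derive_complex_linear _ _ _ _ (complex_linear_scal c0)).
have H := hankel_exp_derive r (alpha - 1) _ _ (s - ti) (Rle_refl r) ltac:(lra) (good_field_resolvent y).
have E : alpha - 1 + 1 = alpha by ring.
rewrite E in H.
have Hg : is_derive (fun s => s - ti) s 1 by auto_derive => //; ring.
have := is_derive_comp (V := realify X) (fun u => hankel_res r u (alpha - 1) y) (fun s => s - ti) s _ _ H Hg.
by rewrite [scal 1 _](scal_one (K := R_Ring) (V := realify X)).
Qed.

Lemma family_integral y s u : ti < s <= u -> u < t ->
  is_RInt (V := realify X)
    (fun v => Cscal (RtoC (Rpower (t - v) (- alpha))) (dg y v)) s u
    (Cscal c0 (caputo_partial (s - ti) (u - ti) y)).
Proof.
move=> Hs Hu.
have H := is_RInt_caputo_partial (s - ti) (u - ti) y ltac:(lra) ltac:(lra).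
have HR := complex_linear_real _ (complex_linear_scal (X := X) c0).
have H1 := is_RInt_linear (V := realify X) (W := realify X) _ HR _ _ _ _ H.
have E1 : s - ti = 1 * s + - ti by ring.
have E2 : u - ti = 1 * u + - ti by ring.
rewrite E1 E2 in H1.
have H2 := is_RInt_comp_lin (V := realify X) _ _ _ _ _ _ H1.
rewrite E1 E2.
apply: (is_RInt_ext (V := realify X)) H2 => v _.
rewrite (scal_one (K := R_Ring) (V := realify X)) /dg.
have -> : T - (1 * v + - ti) = t - v by rewrite -Ht; ring.
have -> : 1 * v + - ti = v - ti by ring.
by vlinC X.
Qed.

Let limit y : X := Cscal (RtoC G) (Cscal c0 (A (sigma y))).

Lemma family_app y : A (g y t) = Cscal c0 (A (sigma y)).
Proof.
rewrite /g Ht resolvent_family_eq // app_scal //; exact: (proj1 (sigma_spec y)).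
Qed.

Lemma family_dom y : dom A (g y t).
Proof.
rewrite /g Ht resolvent_family_eq //; apply: dom_scal; exact: (proj1 (sigma_spec y)).
Qed.

Lemma limit_eq y v : v = Cscal (RtoC (/ G)) (limit y) -> v = A (g y t).
Proof.
move=> ->; rewrite family_app /limit.
have HG := Gamma_pos alpha Hal.
rewrite (scal_assoc (RtoC (/ G) : C_AbsRing) (RtoC G : C_AbsRing)) -[RHS](scal_one (K := C_Ring) (V := X)); congr (scal _ _).
change (RtoC (/ G) * RtoC G = RtoC 1)%C; rewrite -RtoC_mult Rinv_l //; lra.
Qed.

Lemma c0_pos : 0 < Cmod c0.
Proof.
have Hne : (2 * PI * Ci)%C <> 0%C.
  apply: Cmult_neq_0.
    by rewrite -RtoC_mult => /RtoC_inj; have := PI_RGT_0; lra.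
  by move=> E; have := Cmod_Ci; rewrite E Cmod_0; lra.
rewrite Cmod_inv //; apply: Rinv_0_lt_compat; exact/Cmod_gt_0.
Qed.

Lemma caputo_exists y : closure (T := X) (dom A) y -> is_caputo alpha ti (g y) t (A (g y t)).
Proof.
move=> Hy; exists (dg y), (limit y); split; last split.
- by move=> s Hs; apply: family_derive; lra.
- move=> P HP.
  have [eps Heps] := locally_norm_le_locally (V := realify X) _ _ HP.
  have Hc := c0_pos.
  have He : 0 < eps / Cmod c0 by apply: Rdiv_lt_0_compat; [exact: cond_pos | lra].
  have [d [Hd H]] := caputo_partial_tends y Hy _ He.
  have Hd' : 0 < Rmin d (T / 2) by apply: Rmin_pos; lra.
  have Hd1 := Rmin_l d (T / 2); have Hd2 := Rmin_r d (T / 2).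
  exists (fun s => ti < s < ti + Rmin d (T / 2)) (fun s => t - Rmin d (T / 2) < s < t).
  + exact: at_right_near.
  + exact: at_left_near.
  move=> s u Hs Hu /=.
  exists (Cscal c0 (caputo_partial (s - ti) (u - ti) y)); split.
    apply: family_integral; lra.
  apply: Heps.
  have h := H (s - ti) (u - ti) ltac:(lra) ltac:(lra).
  have E : minus (Cscal c0 (caputo_partial (s - ti) (u - ti) y)) (limit y) =
    Cscal c0 (minus (caputo_partial (s - ti) (u - ti) y) (Cscal (RtoC G) (A (sigma y)))).
    by rewrite /limit; vlinC X.
  refine (Rle_lt_trans _ _ _ (Req_le _ _ (f_equal norm E)) _).
  apply: Rle_lt_trans (norm_Cscal _ _) _.
  have := Rmult_lt_compat_l _ _ _ Hc h.
  have -> : Cmod c0 * (eps / Cmod c0) = eps by field; lra.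
  by [].
- rewrite family_app /limit; symmetry.
  have := limit_eq y _ eq_refl; rewrite family_app; exact.
Qed.

Lemma resolvent0_caputo_partial s u y : 0 < s < T -> 0 < u < T ->
  resolvent0 (caputo_partial s u y) = caputo_partial s u (resolvent0 y).
Proof.
move=> Hs Hu; have Hr1 := Rle_refl r.
rewrite /caputo_partial /caputo_primitive /resolvent0 resolvent_field_minus // !resolvent_field_hankel //; exact: kernel_ok_caputo.
Qed.

(** The integrals that converge to [I] become, after applying [resolvent0], those of
    [resolvent0 y], an element of the domain; their limit is known, and [resolvent0] is
    injective. *)
Lemma caputo_unique y v : is_caputo alpha ti (g y) t v -> v = A (g y t).
Proof.
move=> [g' [I [Hg' [HI Hv]]]].
suff E : I = limit y by apply: limit_eq; rewrite -E.
apply: (resolvent0_inj).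
have HR := complex_linear_resolvent r 0 (Rle_refl r) r0.
have El : resolvent0 (limit y) = limit (resolvent0 y).
  by rewrite /limit /resolvent0 !(proj1 (proj2 HR)) -/(resolvent0 _) resolvent0_app_sigma.
rewrite El.
have HCr := field_bound_pos; have Hc := c0_pos.
apply: (norm_le_eps_eq (V := realify X) _ _ (field_bound + Cmod c0)) => eps Heps.
have Hball : locally (I : realify X) (ball_norm (I : realify X) (mkposreal _ Heps)).
  exact: locally_ball_norm.
have [Q1 Q2 HQ1 HQ2 HQ] := HI _ Hball.
have [d [Hd H]] := caputo_partial_tends_dom (resolvent0 y) (resolvent0_dom y) eps Heps.
have Hd' : 0 < Rmin d (T / 2) by apply: Rmin_pos; lra.
have Hd1 := Rmin_l d (T / 2); have Hd2 := Rmin_r d (T / 2).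
have [s [Qs Hs]] := filter_ex _ (filter_and _ _ HQ1 (at_right_near ti _ Hd')).
have [u [Qu Hu]] := filter_ex _ (filter_and _ _ HQ2 (at_left_near t _ Hd')).
have [I' [/= HI' HII']] := HQ s u Qs Qu.
have EI : I' = Cscal c0 (caputo_partial (s - ti) (u - ti) y).
  have H1 := family_integral y s u ltac:(lra) ltac:(lra).
  rewrite -(is_RInt_unique (V := realify X) _ _ _ _ H1).
  rewrite -(is_RInt_unique (V := realify X) _ _ _ _ HI').
  apply: (RInt_ext (V := realify X)) => x; rewrite Rmin_left ?Rmax_right; try lra; move=> Hx.
  congr (scal _ _); apply: is_derive_unique_normed (Hg' x _) (family_derive y x _); lra.
have h1 : norm (minus I' I) < eps by exact: HII'.
have h2 := H (s - ti) (u - ti) ltac:(lra) ltac:(lra).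
have E : minus (resolvent0 I) (limit (resolvent0 y)) =
   plus (opp (resolvent0 (minus I' I)))
    (Cscal c0 (minus (caputo_partial (s - ti) (u - ti) (resolvent0 y))
      (Cscal (RtoC G) (A (sigma (resolvent0 y)))))).
  have -> : resolvent0 (minus I' I) = minus (resolvent0 I') (resolvent0 I).
    by apply: resolvent_field_minus => //; exact: Rle_refl.
  have -> : resolvent0 I' = Cscal c0 (caputo_partial (s - ti) (u - ti) (resolvent0 y)).
    rewrite EI -resolvent0_caputo_partial; try lra.
    exact: (proj1 (proj2 HR)).
  by rewrite /limit; vlinC X.
refine (Rle_trans _ _ _ (Req_le _ _ (f_equal norm E)) _).
apply: Rle_trans (norm_triangle _ _) _; rewrite norm_opp.
have h3 := resolvent_field_le (minus I' I) r 0 (Rle_refl r) r0.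
have h4 := norm_Cscal c0 (minus (caputo_partial (s - ti) (u - ti) (resolvent0 y))
      (Cscal (RtoC G) (A (sigma (resolvent0 y))))).
have h5 : field_bound * norm (minus I' I) <= field_bound * eps by apply: Rmult_le_compat_l; lra.
have h6 := Rmult_le_compat_l _ _ _ (Rlt_le _ _ Hc) (Rlt_le _ _ h2).
refine (Rle_trans _ _ _ (Rplus_le_compat _ _ _ _ h3 h4) _).
refine (Rle_trans _ _ _ (Rplus_le_compat _ _ _ _ h5 h6) _); lra.
Qed.
End Contour.

(** * The Caputo derivative of the resolvent family *)
(** Bounds by [|lambda^alpha|] instead of [|lambda^alpha - mu|] make every later estimate
    homogeneous in [lambda]. *)
Lemma region_resolvent (X : CompleteNormedModule C_AbsRing) (A : operator X)
  (M theta alpha mu r phi : R) :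
  sectorial A M theta alpha mu -> suitable_path theta alpha mu r phi -> 0 < alpha < 1 ->
  exists C0, 0 < C0 /\
    (forall s psi, r <= s -> Rabs psi <= phi -> in_resolvent_set A (lambda_pow alpha s psi)) /\
    (forall s psi y, r <= s -> Rabs psi <= phi ->
       norm (resolvent A (lambda_pow alpha s psi) y) <= C0 * Rpower s (- alpha) * norm y).
Proof.
move=> [_ [Hth [HM HA]]] [Hr [Hphi Hpath]] Hal.
have Hpi := PI_RGT_0.
set k := cos theta; set rho0 := Rpower r alpha; set eta0 := alpha * phi.
have Hk : 0 < k < 1.
  split; first by apply: cos_gt_0; lra.
  rewrite /k -cos_0; apply: cos_decreasing_1; lra.
have Hrho0 : 0 < rho0 by exact: Rpower_pos.
have Heta0 : 0 < eta0 < PI by rewrite /eta0; split; nra.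
have Hpp psi : Rabs psi <= phi -> - PI < psi < PI by move=> /Rabs_le_between; lra.
have Hon s psi : r <= s -> Rabs psi <= phi -> on_hankel r phi (polar s psi) ->
    off_sector k mu (Rpower s alpha * cos (alpha * psi)) (Rpower s alpha * sin (alpha * psi)).
  move=> Hs Hpsi Ho; apply/(off_sectorP mu theta) => //.
  rewrite -Cpow_polar; [exact: Hpath | lra | exact: Hpp].
have Hreg : forall rho eta, rho0 <= rho -> Rabs eta <= eta0 ->
     off_sector k mu (rho * cos eta) (rho * sin eta).
  apply: off_sector_region => //.
    move=> rho Hrho.
    have Hrp : 0 < rho by lra.
    have E : Rpower (Rpower rho (/ alpha)) alpha = rho.
      by rewrite Rpower_mult Rinv_l ?Rpower_1 //; lra.
    have Hs : r <= Rpower rho (/ alpha).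
      have -> : r = Rpower rho0 (/ alpha).
        rewrite /rho0 Rpower_mult Rinv_r ?Rpower_1 //; lra.
      apply: Rpower_mono; first lra.
      by left; apply: Rinv_0_lt_compat; lra.
    rewrite -E; apply: Hon => //; first by rewrite Rabs_pos_eq; lra.
    exists (Rpower rho (/ alpha)), phi; split=> //; left; split=> //; by left.
  move=> eta Heta.
  have E : eta = alpha * (eta / alpha) by field; lra.
  have Hpsi : - phi <= eta / alpha <= phi.
    split; [apply/Rle_div_r; rewrite /eta0 in Heta; lra | apply/Rle_div_l; rewrite /eta0 in Heta; lra].
  rewrite E; apply: Hon; [lra | by apply/Rabs_le_between |].
  exists r, (eta / alpha); split=> //; right; split=> //.
have [c [Hc Hdist]] : exists c, 0 < c /\ forall rho eta, rho0 <= rho -> Rabs eta <= eta0 ->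
    c * rho <= Cmod (polar rho eta - mu)%C.
  apply: (off_sector_dist k) => //.
  have := Hreg rho0 0 (Rle_refl _); rewrite cos_0 sin_0 Rmult_1_r Rmult_0_r; apply.
  rewrite Rabs_R0; lra.
have Hlam s psi : r <= s -> Rabs psi <= phi -> rho0 <= Rpower s alpha /\ Rabs (alpha * psi) <= eta0.
  move=> Hs Hpsi; split; first by apply: Rpower_mono; lra.
  rewrite Rabs_mult (Rabs_pos_eq alpha); last lra.
  by apply: Rmult_le_compat_l; lra.
have Hin s psi : r <= s -> Rabs psi <= phi -> Defs.Cpow (polar s psi) alpha = lambda_pow alpha s psi /\
   ~ in_sector mu theta (Defs.Cpow (polar s psi) alpha).
  move=> Hs Hpsi; have [h1 h2] := Hlam s psi Hs Hpsi.
  rewrite Cpow_polar; [ | lra | exact: Hpp].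
  split=> //; apply/off_sectorP => //; exact: Hreg.
exists (M / c); split; first exact: Rdiv_lt_0_compat.
split.
  move=> s psi Hs Hpsi; have [<- Hn] := Hin s psi Hs Hpsi.
  exact: (proj1 (HA _ Hn)).
move=> s psi y Hs Hpsi; have [E Hn] := Hin s psi Hs Hpsi.
have := proj2 (HA _ Hn) y; rewrite E => H; apply: Rle_trans H _.
apply: Rmult_le_compat_r; first exact: norm_ge_0.
have [h1 h2] := Hlam s psi Hs Hpsi.
have Hd := Hdist _ _ h1 h2; rewrite -/(lambda_pow alpha s psi) in Hd.
have Hsp := Rpower_pos s alpha.
have -> : M / c * Rpower s (- alpha) = M / (c * Rpower s alpha).
  rewrite Rpower_Ropp; field; lra.
apply: Rmult_le_compat_l; first lra.
apply: Rinv_le_contravar => //; exact: Rmult_lt_0_compat.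
Qed.

Theorem lemma3p1
  (X : CompleteNormedModule C_AbsRing) (A : operator X)
  (M theta alpha mu : R) (HA : sectorial A M theta alpha mu)
  (r phi : R) (Hc : suitable_path theta alpha mu r phi)
  (ti : R) (Hti : 0 <= ti) (yi : X)
  (Halpha : 0 < alpha < 1) (t : R) (Ht : ti < t) :
  let g := fun s : R => resolvent_family A alpha r phi (s - ti) yi in
  dom A (g t) /\
  (closure (dom A) yi -> is_caputo alpha ti g t (A (g t))) /\
  (forall v : X, is_caputo alpha ti g t v -> v = A (g t)).
Proof.
have [C0 [HC0 [Hres Hbound]]] := region_resolvent X A M theta alpha mu r phi HA Hc Halpha.
have [Hr [Hphi _]] := Hc.
have HT : 0 < t - ti by lra.
move=> g; split; last split.
- exact: (family_dom r phi Hr Hphi A alpha C0 Halpha HC0 Hres Hbound (t - ti) HT ti t eq_refl yi).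
- exact: (caputo_exists r phi Hr Hphi A alpha C0 Halpha HC0 Hres Hbound (t - ti) HT ti t eq_refl yi).
- exact: (caputo_unique r phi Hr Hphi A alpha C0 Halpha HC0 Hres Hbound (t - ti) HT ti t eq_refl yi).
Qed.
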